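(* Let $\beta>0$ with $\beta^2\neq1/4$, let $\mu=\mathrm{Re}\sqrt{1/4-\beta^2}$, and let $m\ge1$ be an integer. There exist $\varepsilon_0>0$ and $C>0$, with $C$ independent of $m$, such that for all $\varepsilon\in(0,\varepsilon_0)$ and all $y,y_0\in[0,1]$ with $m|y-y_0|\le3\beta$, $$|y-y_0+i\varepsilon|^{-\frac12+\mu}\,\|\mathcal{G}^\pm_{m,\varepsilon}(y,y_0,\cdot)\|_{L^2_z(0,1)}+|y-y_0+i\varepsilon|^{\frac12+\mu}\,\|\partial_y\mathcal{G}^\pm_{m,\varepsilon}(y,y_0,\cdot)\|_{L^2_z(0,1)}\le\frac{C}{m^{1+\mu}}.$$
   Context: For $y_0\in[0,1]$, $\varepsilon>0$ the Taylor–Goldstein operator is $\mathrm{TG}^\pm_{m,\varepsilon}=\partial_y^2-m^2+\frac{\beta^2}{(y-y_0\pm i\varepsilon)^2}$ on $y\in(0,1)$. $\mathcal{G}^\pm_{m,\varepsilon}(y,y_0,z)$ denotes its Green's function: $\mathrm{TG}^\pm_{m,\varepsilon}\mathcal{G}^\pm_{m,\varepsilon}(\cdot,y_0,z)=\delta(\cdot-z)$ with homogeneous Dirichlet conditions at $y=0$ and $y=1$. The estimate is asserted for each choice of sign $\pm$. *)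

(* Defs.v *)
From Stdlib Require Import Reals Lra Psatz.
From Coquelicot Require Import Coquelicot.
Open Scope R_scope.

(** Principal branch of the complex square root. *)
Definition Csqrt (z : C) : C :=
  (sqrt ((Cmod z + Re z) / 2),
   (if Rlt_dec (Im z) 0 then -1 else 1) * sqrt ((Cmod z - Re z) / 2)).

Lemma Csqrt_sqr (z : C) : (Csqrt z * Csqrt z)%C = z.
Proof.
destruct z as [a b]; unfold Csqrt, Cmult; simpl.
set (r := Cmod (a, b)).
assert (Hr : r * r = a * a + b * b).
{ unfold r, Cmod; rewrite sqrt_sqrt; simpl; nra. }
assert (Hr0 : 0 <= r) by apply Cmod_ge_0.
assert (H1 : 0 <= (r + a) / 2) by nra.
assert (H2 : 0 <= (r - a) / 2) by nra.
assert (Hp : sqrt ((r + a) / 2) * sqrt ((r - a) / 2) = Rabs b / 2).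
{ rewrite <- sqrt_mult by assumption.
  replace ((r + a) / 2 * ((r - a) / 2)) with (Rsqr (b / 2)).
  - rewrite sqrt_Rsqr_abs; unfold Rdiv.
    rewrite Rabs_mult, (Rabs_pos_eq (/ 2)); lra.
  - unfold Rsqr; nra. }
pose proof (sqrt_sqrt _ H1) as S1.
pose proof (sqrt_sqrt _ H2) as S2.
destruct (Rlt_dec b 0) as [Hb | Hb].
- rewrite (Rabs_left b Hb) in Hp; f_equal; nra.
- rewrite (Rabs_pos_eq b) in Hp by lra; f_equal; nra.
Qed.

Lemma Csqrt_Re_ge0 (z : C) : 0 <= Re (Csqrt z).
Proof. apply sqrt_pos. Qed.

Definition mu (beta : R) : R := Re (Csqrt (RtoC (1 / 4 - beta ^ 2))).

Variant pm : Set := Plus | Minus.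

Definition sgn (s : pm) : R := match s with Plus => 1 | Minus => -1 end.

Definition potential (s : pm) (beta eps y0 y : R) : C :=
  (RtoC (beta ^ 2) / ((y - y0, sgn s * eps)%R * (y - y0, sgn s * eps)%R))%C.

(** The Taylor-Goldstein operator, applied to a real-valued function. *)
Definition TG (s : pm) (beta : R) (m : nat) (eps y0 : R) (phi : R -> R)
    (y : R) : C :=
  (RtoC (Derive_n phi 2 y) - RtoC (INR m ^ 2) * RtoC (phi y)
   + potential s beta eps y0 y * RtoC (phi y))%C.

(** Real-valued elements of C_c^oo(0,1), extended by zero to the real line. *)
Definition test_function (phi : R -> R) : Prop :=
  (forall (n : nat) (x : R), ex_derive_n phi n x) /\
  exists a b : R, 0 < a /\ a < b /\ b < 1 /\
    forall x : R, ~ (a <= x <= b) -> phi x = 0.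

(** [TG u = delta_z] in the sense of distributions on (0,1).  The transpose of
    [TG] is [TG] itself, and by linearity real test functions suffice. *)
Definition TG_eq_delta (s : pm) (beta : R) (m : nat) (eps y0 : R)
    (u : R -> C) (z : R) : Prop :=
  forall phi : R -> R, test_function phi ->
    is_RInt (V := C_R_NormedModule)
      (fun y => (u y * TG s beta m eps y0 phi y)%C) 0 1 (RtoC (phi z)).

(** [G y z] stands for the value at [(y, y0, z)] of the Green's function, the
    parameter [y0] being fixed. Its values for [y] outside [0,1] or [z] outside
    (0,1) are irrelevant. *)
Definition is_Green (s : pm) (beta : R) (m : nat) (eps y0 : R)
    (G : R -> R -> C) : Prop :=
  forall z : R, 0 < z < 1 ->
    continuous_on (fun y : R => 0 <= y <= 1) (fun y : R => G y z) /\
    TG_eq_delta s beta m eps y0 (fun y => G y z) z /\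
    G 0 z = RtoC 0 /\ G 1 z = RtoC 0.

(** Derivative of a function defined on [0,1]; one-sided at the endpoints. *)
Definition is_derive_01 (f : R -> C) (y : R) (l : C) : Prop :=
  filterlim (fun x : R => ((f x - f y) / RtoC (x - y))%C)
    (within (fun x : R => 0 <= x <= 1) (locally' y)) (locally l).

(** [g] is the function [d_y G (y, .)] on (0,1). A Green's function has a kink
    on the diagonal, so the null set [z = y] is excluded. *)
Definition is_partial_y (G : R -> R -> C) (y : R) (g : R -> C) : Prop :=
  forall z : R, 0 < z < 1 -> z <> y -> is_derive_01 (fun x => G x z) y (g z).

(** The L^2(0,1) norm, by Riemann integration; [L2norm f] is meaningful under
    [in_L2 f], and then coincides with the Lebesgue norm. *)
Definition in_L2 (f : R -> C) : Prop := ex_RInt (fun z => Cmod (f z) ^ 2) 0 1.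

Definition L2norm (f : R -> C) : R := sqrt (RInt (fun z => Cmod (f z) ^ 2) 0 1).

(* Main.v *)
Require Import Defs.
From Stdlib Require Import Reals Lra Lia Psatz Factorial.
From Coquelicot Require Import Coquelicot.
Open Scope R_scope.

(** Put [x = m (y - y0)], [h = m eps], [z = x + i h] and [nu^2 = 1/4 - beta^2].  The
    homogeneous equation becomes [u'' = (1 - beta^2 / z^2) u], with the explicit solutions
    [psi nu = z^(1/2+nu) F_nu(z^2)] and [psi (-nu)], [F_nu] entire; near [z = 0] they have
    size at most [|z|^(1/2-mu)], and their derivatives [|z|^(-1/2-mu)].  The Green's function
    is built from the solutions [psi nu p psi (-nu) - psi (-nu) p psi nu] vanishing at the
    end points [p = -m y0] and [p = m (1-y0)].

    The key point is that the Wronskian of these two solutions is bounded below by a constant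
    times [(|psi nu|+|psi (-nu)|)(-m y0) * (|psi nu|+|psi (-nu)|)(m (1-y0))], uniformly in [m]
    and [y0], once [h] is small depending on [m].  At [h = 0] the values of [F_nu] are real
    for [nu] real, and [F_nu], [F_(-nu)] are conjugate and non-zero for [nu] imaginary, so
    that passing from [x > 0] to [x < 0] through the upper half-plane only multiplies
    [z^(2 nu)] by [exp (2 i pi nu)]: a rotation by an angle in (0,pi), respectively a dilation
    by a factor different from 1.  The loss of reality for [h > 0] is absorbed in the
    smallness of [h].

    For [|x| >= 3 beta] the real part of the potential [1 - beta^2 / z^2] is at least 1/2, and
    the identity for [(Re (conj u * u'))'] bounds the L2 norm of a solution vanishing at an
    end point by its Cauchy data at [|x| = 3 beta]; thus no information on [psi] for large
    [x] is needed.

    Every Green's function is the one constructed here: a difference of two is a weak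
    solution of the homogeneous problem, hence C^2 by testing against second primitives of
    three-point combinations of bump functions, and then vanishes by Wronskian arguments. *)

(** * Complex-valued functions of a real variable *)

(** The obstacle is uniformity in m: the end points lie at distances up to m from the singularity,
    where the Frobenius solutions are exponentially large. Nothing is therefore normalised there.
    With S(p) = |psi nu|(p) + |psi (-nu)|(p), the solution vanishing at p is, up to constants, at
    most S(p) |z|^(1/2-mu) near the singularity, its L2 norm up to p is at most S(p), and the
    Wronskian for the end points p, p' is at least S(p) S(p'). The unknown sizes cancel in the
    quotient defining the Green's function.

    The power of m is then pure scaling. Its exponent 1 + mu is 1 from the Wronskian, 1/2 from the
    change of variable in the L2 norm and -1/2 + mu from |z| = m |y-y0+i eps|; for the derivative in
    y, one power of m is lost and |z|^(-1/2-mu) gives it back.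

    The threshold for eps depends on m because the comparison with the real axis uses Lipschitz
    constants of F_nu on discs of radius (m+1)^2. The lower sign follows from the upper one by
    complex conjugation. *)

Definition is_derive_RC (f : R -> C) (x : R) (l : C) : Prop :=
  is_derive (fun t => fst (f t)) x (fst l) /\
  is_derive (fun t => snd (f t)) x (snd l).

Lemma is_derive_eq (f : R -> R) (x a b : R) :
  is_derive f x a -> a = b -> is_derive f x b.
Proof. now intros H <-. Qed.

Lemma is_derive_Rmult (f g : R -> R) (x a b : R) :
  is_derive f x a -> is_derive g x b ->
  is_derive (fun t => f t * g t) x (a * g x + f x * b).
Proof.
intros Hf Hg; apply (is_derive_mult f g x a b Hf Hg).
intros; apply Rmult_comm.
Qed.

Lemma is_derive_RC_eq (f : R -> C) (x : R) (a b : C) :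
  is_derive_RC f x a -> a = b -> is_derive_RC f x b.
Proof. now intros H <-. Qed.

Lemma is_derive_RC_ext (f g : R -> C) (x : R) (l : C) :
  (forall t, f t = g t) -> is_derive_RC f x l -> is_derive_RC g x l.
Proof.
intros E [H1 H2]; split; [apply is_derive_ext with (2 := H1) |
  apply is_derive_ext with (2 := H2)]; intros t; now rewrite E.
Qed.

Lemma is_derive_RC_const (c : C) (x : R) : is_derive_RC (fun _ => c) x 0.
Proof. split; apply (@is_derive_const R_AbsRing R_NormedModule). Qed.

Lemma is_derive_RC_plus (f g : R -> C) (x : R) (a b : C) :
  is_derive_RC f x a -> is_derive_RC g x b ->
  is_derive_RC (fun t => (f t + g t)%C) x (a + b)%C.
Proof.
intros [F1 F2] [G1 G2]; split.
- apply (is_derive_plus _ _ _ _ _ F1 G1).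
- apply (is_derive_plus _ _ _ _ _ F2 G2).
Qed.

Lemma is_derive_RC_opp (f : R -> C) (x : R) (a : C) :
  is_derive_RC f x a -> is_derive_RC (fun t => (- f t)%C) x (- a)%C.
Proof.
intros [F1 F2]; split;
 [apply (is_derive_opp _ _ _ F1) | apply (is_derive_opp _ _ _ F2)].
Qed.

Lemma is_derive_RC_minus (f g : R -> C) (x : R) (a b : C) :
  is_derive_RC f x a -> is_derive_RC g x b ->
  is_derive_RC (fun t => (f t - g t)%C) x (a - b)%C.
Proof.
intros F G; apply is_derive_RC_plus; [exact F | now apply is_derive_RC_opp].
Qed.

Lemma is_derive_RC_mult (f g : R -> C) (x : R) (a b : C) :
  is_derive_RC f x a -> is_derive_RC g x b ->
  is_derive_RC (fun t => (f t * g t)%C) x (a * g x + f x * b)%C.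
Proof.
intros [F1 F2] [G1 G2]; split; eapply is_derive_eq.
- apply (is_derive_minus _ _ _ _ _ (is_derive_Rmult _ _ _ _ _ F1 G1)
           (is_derive_Rmult _ _ _ _ _ F2 G2)).
- unfold minus, plus, opp; simpl; ring.
- apply (is_derive_plus _ _ _ _ _ (is_derive_Rmult _ _ _ _ _ F1 G2)
           (is_derive_Rmult _ _ _ _ _ F2 G1)).
- unfold plus; simpl; ring.
Qed.

Lemma is_derive_RC_scal (c : C) (f : R -> C) (x : R) (a : C) :
  is_derive_RC f x a -> is_derive_RC (fun t => (c * f t)%C) x (c * a)%C.
Proof.
intros F; eapply is_derive_RC_eq.
- apply is_derive_RC_mult; [apply is_derive_RC_const | exact F].
- cbv beta; ring.
Qed.

Lemma is_derive_RC_conj (f : R -> C) (x : R) (a : C) :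
  is_derive_RC f x a -> is_derive_RC (fun t => Cconj (f t)) x (Cconj a).
Proof. intros [F1 F2]; split; [exact F1 | apply (is_derive_opp _ _ _ F2)]. Qed.

Lemma is_derive_RC_RtoC (f : R -> R) (x a : R) :
  is_derive f x a -> is_derive_RC (fun t => RtoC (f t)) x (RtoC a).
Proof.
intros F; split; [exact F | simpl; apply (@is_derive_const R_AbsRing R_NormedModule)].
Qed.

Lemma is_derive_RC_comp (f : R -> C) (g : R -> R) (x b : R) (a : C) :
  is_derive_RC f (g x) a -> is_derive g x b ->
  is_derive_RC (fun t => f (g t)) x (RtoC b * a)%C.
Proof.
intros [F1 F2] G; split; eapply is_derive_eq.
- apply (is_derive_comp (fun t => fst (f t)) g _ _ _ F1 G).
- unfold scal; simpl; unfold mult; simpl; ring.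
- apply (is_derive_comp (fun t => snd (f t)) g _ _ _ F2 G).
- unfold scal; simpl; unfold mult; simpl; ring.
Qed.

Lemma is_derive_RC_affine (f : R -> C) (c d x : R) (a : C) :
  is_derive_RC f (c * x + d) a ->
  is_derive_RC (fun t => f (c * t + d)) x (RtoC c * a)%C.
Proof.
intros F; apply (is_derive_RC_comp f (fun t => c * t + d)); [exact F |].
auto_derive; [exact I | ring].
Qed.

Lemma is_derive_RC_zero (f : R -> C) (a b : R) : a <= b ->
  (forall t, a <= t <= b -> is_derive_RC f t 0) -> f a = f b.
Proof.
intros [Hab | <-] H; [| reflexivity].
apply injective_projections;
 [apply (eq_is_derive (fun t => fst (f t))) |
  apply (eq_is_derive (fun t => snd (f t)))]; try exact Hab;
 intros t Ht; apply H, Ht.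
Qed.

Lemma is_derive_RC_continuous (f : R -> C) (x : R) (l : C) :
  is_derive_RC f x l -> continuous f x.
Proof.
intros [F1 F2].
assert (C1 : continuous (fun t => fst (f t)) x)
  by (apply (@ex_derive_continuous R_AbsRing R_NormedModule); eexists; exact F1).
assert (C2 : continuous (fun t => snd (f t)) x)
  by (apply (@ex_derive_continuous R_AbsRing R_NormedModule); eexists; exact F2).
apply continuous_ext with (fun t => (fst (f t), snd (f t))).
- intros t; now destruct (f t).
- intros P [eps HP].
  specialize (C1 (fun y => ball (fst (f x)) eps y) (locally_ball _ eps)).
  specialize (C2 (fun y => ball (snd (f x)) eps y) (locally_ball _ eps)).
  unfold filtermap in *.
  generalize (filter_and _ _ C1 C2); apply filter_imp.
  intros t [H1 H2]; apply HP; split; assumption.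
Qed.

Lemma continuous_fst_C (f : R -> C) (x : R) :
  continuous f x -> continuous (fun t => fst (f t)) x.
Proof.
intros H; apply (continuous_comp f fst); [exact H | apply continuous_fst].
Qed.

Lemma continuous_snd_C (f : R -> C) (x : R) :
  continuous f x -> continuous (fun t => snd (f t)) x.
Proof.
intros H; apply (continuous_comp f snd); [exact H | apply continuous_snd].
Qed.

Lemma continuous_pair_C (f g : R -> R) (x : R) :
  continuous f x -> continuous g x -> continuous (fun t => (f t, g t) : C) x.
Proof.
intros F G P [eps HP].
specialize (F (fun y => ball (f x) eps y) (locally_ball _ eps)).
specialize (G (fun y => ball (g x) eps y) (locally_ball _ eps)).
unfold filtermap in *.
generalize (filter_and _ _ F G); apply filter_imp.
intros t [H1 H2]; apply HP; split; assumption.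
Qed.

Lemma continuous_Cmult (f g : R -> C) (x : R) :
  continuous f x -> continuous g x -> continuous (fun t => (f t * g t)%C) x.
Proof.
intros F G; unfold Cmult.
pose proof (continuous_fst_C _ _ F). pose proof (continuous_snd_C _ _ F).
pose proof (continuous_fst_C _ _ G). pose proof (continuous_snd_C _ _ G).
apply continuous_pair_C.
- apply (continuous_minus (V := R_NormedModule));
   apply (continuous_mult (K := R_AbsRing)); assumption.
- apply (continuous_plus (V := R_NormedModule));
   apply (continuous_mult (K := R_AbsRing)); assumption.
Qed.

Lemma continuous_Cplus (f g : R -> C) (x : R) :
  continuous f x -> continuous g x -> continuous (fun t => (f t + g t)%C) x.
Proof.
intros F G; apply (continuous_plus (V := C_R_NormedModule)); assumption.
Qed.

Lemma continuous_Cmod (f : R -> C) (x : R) :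
  continuous f x -> continuous (fun t => Cmod (f t)) x.
Proof.
intros F; unfold Cmod.
assert (S : forall g : R -> R, continuous g x -> continuous (fun t => g t ^ 2) x).
{ intros g G; apply continuous_ext with (fun t => g t * g t); [intros; simpl; ring |].
  exact (continuous_mult (K := R_AbsRing) g g x G G). }
apply (continuous_comp (fun t => fst (f t) ^ 2 + snd (f t) ^ 2) sqrt).
- exact (continuous_plus (V := R_NormedModule) _ _ x
    (S _ (continuous_fst_C _ _ F)) (S _ (continuous_snd_C _ _ F))).
- apply continuous_sqrt.
Qed.

Lemma is_RInt_C (f : R -> C) (a b : R) (l : C) :
  is_RInt (fun t => fst (f t)) a b (fst l) ->
  is_RInt (fun t => snd (f t)) a b (snd l) ->
  is_RInt (V := C_R_NormedModule) f a b l.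
Proof.
intros H1 H2; rewrite (surjective_pairing l).
exact (is_RInt_fct_extend_pair (U := R_NormedModule) (V := R_NormedModule)
  f a b (fst l) (snd l) H1 H2).
Qed.

Lemma is_RInt_C_inv (f : R -> C) (a b : R) (l : C) :
  is_RInt (V := C_R_NormedModule) f a b l ->
  is_RInt (fun t => fst (f t)) a b (fst l) /\
  is_RInt (fun t => snd (f t)) a b (snd l).
Proof.
intros H; split.
- exact (is_RInt_fct_extend_fst (U := R_NormedModule) (V := R_NormedModule)
    f a b l H).
- exact (is_RInt_fct_extend_snd (U := R_NormedModule) (V := R_NormedModule)
    f a b l H).
Qed.

Lemma is_RInt_derive_RC (f df : R -> C) (a b : R) : a <= b ->
  (forall x, a <= x <= b -> is_derive_RC f x (df x)) ->
  (forall x, a <= x <= b -> continuous df x) ->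
  is_RInt (V := C_R_NormedModule) df a b (f b - f a)%C.
Proof.
intros Hab Hd Hc; apply is_RInt_C.
- apply (is_RInt_derive (V := R_CompleteNormedModule) (fun t => fst (f t)));
  intros x; rewrite Rmin_left, Rmax_right by lra; intros Hx;
  [apply Hd, Hx | apply continuous_fst_C, Hc, Hx].
- apply (is_RInt_derive (V := R_CompleteNormedModule) (fun t => snd (f t)));
  intros x; rewrite Rmin_left, Rmax_right by lra; intros Hx;
  [apply Hd, Hx | apply continuous_snd_C, Hc, Hx].
Qed.

(** A quadratic remainder determines the derivative, so that differentiability follows from
    inequalities alone, both for power series and for [flat] at the origin. *)
Lemma is_derive_quad (g : R -> R) (x a K : R) :
  (forall t, Rabs (t - x) <= 1 -> Rabs (g t - g x - a * (t - x)) <= K * (t - x) ^ 2) ->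
  is_derive g x a.
Proof.
intros H.
apply is_derive_Reals; intros eps Heps.
assert (Hd : 0 < Rmin 1 (eps / (Rabs K + 1))).
{ apply Rmin_pos; [lra |]; apply Rdiv_lt_0_compat; [lra |].
  pose proof (Rabs_pos K); lra. }
exists (mkposreal _ Hd); intros u Hu0 Hu; simpl in Hu.
specialize (H (x + u)).
replace (x + u - x) with u in H by ring.
assert (H1 : Rabs u <= 1) by (pose proof (Rmin_l 1 (eps / (Rabs K + 1))); lra).
assert (H2 : Rabs u < eps / (Rabs K + 1))
  by (pose proof (Rmin_r 1 (eps / (Rabs K + 1))); lra).
specialize (H H1).
replace ((g (x + u) - g x) / u - a) with ((g (x + u) - g x - a * u) / u)
  by (field; exact Hu0).
assert (Hp : 0 < Rabs u) by now apply Rabs_pos_lt.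
unfold Rdiv; rewrite Rabs_mult, Rabs_inv.
apply Rmult_lt_reg_r with (Rabs u); [exact Hp |].
rewrite Rmult_assoc, Rinv_l, Rmult_1_r by lra.
assert (HK := Rabs_pos K).
assert (H3 : Rabs u * (Rabs K + 1) < eps).
{ replace eps with (eps / (Rabs K + 1) * (Rabs K + 1)) by (field; lra).
  apply Rmult_lt_compat_r; lra. }
rewrite <- (pow2_abs u) in H.
eapply Rle_lt_trans; [exact H |].
apply Rle_lt_trans with (Rabs u * (Rabs K + 1) * Rabs u).
- assert (K * Rabs u ^ 2 <= Rabs K * Rabs u ^ 2)
    by (apply Rmult_le_compat_r; [apply pow2_ge_0 | apply Rle_abs]).
  assert (0 <= Rabs u * Rabs u) by (apply Rmult_le_pos; lra). lra.
- now apply Rmult_lt_compat_r.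
Qed.

Lemma is_derive_RC_quad (f : R -> C) (x : R) (l : C) (K : R) :
  (forall t, Rabs (t - x) <= 1 ->
     Cmod (f t - f x - l * RtoC (t - x))%C <= K * (t - x) ^ 2) ->
  is_derive_RC f x l.
Proof.
intros H; split; apply is_derive_quad with K; intros t Ht; specialize (H t Ht);
  refine (Rle_trans _ _ _ _ H).
- eapply Rle_trans; [| apply re_le_Cmod]; apply Req_le, f_equal; simpl; ring.
- eapply Rle_trans; [| eapply Rle_trans; [apply Rmax_r | apply Rmax_Cmod]].
  apply Req_le, f_equal; simpl; ring.
Qed.

(** * Entire power series *)

(** Total, like [Series]; used under [Cabs_summable], where both components converge. *)
Definition Cseries (a : nat -> C) : C :=
  (Series (fun n => fst (a n)), Series (fun n => snd (a n))).

Definition Cabs_summable (a : nat -> C) : Prop := ex_series (fun n => Cmod (a n)).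

Lemma Rabs_fst_le_Cmod (z : C) : Rabs (fst z) <= Cmod z.
Proof. apply re_le_Cmod. Qed.

Lemma Rabs_snd_le_Cmod (z : C) : Rabs (snd z) <= Cmod z.
Proof. eapply Rle_trans; [apply Rmax_r | apply Rmax_Cmod]. Qed.

Lemma Cmod_sqr (z : C) : Cmod z * Cmod z = fst z * fst z + snd z * snd z.
Proof. pose proof (Cmod2_alt z) as H; unfold Re, Im in H; lra. Qed.

Lemma ex_series_dominated (a b : nat -> R) :
  (forall n, Rabs (a n) <= b n) -> ex_series b -> ex_series a.
Proof. intros H Hb; apply (ex_series_le (K := R_AbsRing) (V := R_CompleteNormedModule) a b H Hb). Qed.

Lemma Cabs_summable_fst (a : nat -> C) :
  Cabs_summable a -> ex_series (fun n => fst (a n)).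
Proof. apply ex_series_dominated; intros n; apply Rabs_fst_le_Cmod. Qed.

Lemma Cabs_summable_snd (a : nat -> C) :
  Cabs_summable a -> ex_series (fun n => snd (a n)).
Proof. apply ex_series_dominated; intros n; apply Rabs_snd_le_Cmod. Qed.

Lemma Cabs_summable_dominated (a : nat -> C) (b : nat -> R) :
  (forall n, Cmod (a n) <= b n) -> ex_series b -> Cabs_summable a.
Proof.
intros H; apply ex_series_dominated; intros n.
rewrite Rabs_pos_eq; [apply H | apply Cmod_ge_0].
Qed.

Lemma Cabs_summable_scal (c : C) (a : nat -> C) :
  Cabs_summable a -> Cabs_summable (fun n => (c * a n)%C).
Proof.
intros H; apply (Cabs_summable_dominated _ (fun n => Cmod c * Cmod (a n))).
- intros n; rewrite Cmod_mult; lra.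
- apply (ex_series_scal (K := R_AbsRing) (V := R_NormedModule)), H.
Qed.

Lemma Cabs_summable_plus (a b : nat -> C) :
  Cabs_summable a -> Cabs_summable b -> Cabs_summable (fun n => (a n + b n)%C).
Proof.
intros Ha Hb.
apply (Cabs_summable_dominated _ (fun n => Cmod (a n) + Cmod (b n))).
- intros n; apply Cmod_triangle.
- apply (ex_series_plus (V := R_NormedModule)); assumption.
Qed.

Lemma Cseries_ext (a b : nat -> C) : (forall n, a n = b n) -> Cseries a = Cseries b.
Proof.
intros H; unfold Cseries; f_equal; apply Series_ext; intros n; now rewrite H.
Qed.

Lemma Cseries_plus (a b : nat -> C) : Cabs_summable a -> Cabs_summable b ->
  Cseries (fun n => (a n + b n)%C) = (Cseries a + Cseries b)%C.
Proof.
intros Ha Hb; apply injective_projections; simpl.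
- apply Series_plus; now apply Cabs_summable_fst.
- apply Series_plus; now apply Cabs_summable_snd.
Qed.

Lemma Cseries_scal (c : C) (a : nat -> C) : Cabs_summable a ->
  Cseries (fun n => (c * a n)%C) = (c * Cseries a)%C.
Proof.
intros Ha.
pose proof (Cabs_summable_fst _ Ha) as H1.
pose proof (Cabs_summable_snd _ Ha) as H2.
assert (Es : forall c (u : nat -> R), ex_series u -> ex_series (fun n => c * u n))
  by (intros; now apply (ex_series_scal (K := R_AbsRing) (V := R_NormedModule))).
apply injective_projections; simpl.
- rewrite Series_minus by (apply Es; assumption).
  now rewrite !Series_scal_l.
- rewrite Series_plus by (apply Es; assumption).
  now rewrite !Series_scal_l.
Qed.

Lemma Cseries_incr (a : nat -> C) : Cabs_summable a ->
  Cseries a = (a O + Cseries (fun n => a (S n)))%C.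
Proof.
intros Ha; apply injective_projections; simpl; apply Series_incr_1.
- now apply Cabs_summable_fst.
- now apply Cabs_summable_snd.
Qed.

Lemma Series_ge_0 (a : nat -> R) : (forall n, 0 <= a n) -> ex_series a -> 0 <= Series a.
Proof.
intros Hp Ha; apply Rle_trans with (1 := Rabs_pos (Series a)).
rewrite (Series_ext a (fun n => Rabs (a n))) at 2
  by (intros n; now rewrite Rabs_pos_eq).
apply Series_Rabs; revert Ha; apply ex_series_ext; intros n.
now rewrite Rabs_pos_eq.
Qed.

(** Componentwise estimates would lose a factor. Instead the sum s is tested against its own
    conjugate: |s|^2 is the sum of the Re (conj s a_n), hence at most |s| times the sum of the
    |a_n|. *)
Lemma Cmod_Cseries (a : nat -> C) : Cabs_summable a ->
  Cmod (Cseries a) <= Series (fun n => Cmod (a n)).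
Proof.
intros Ha; set (s := Cseries a).
assert (Hs : Cmod s * Cmod s <= Cmod s * Series (fun n => Cmod (a n))).
{ rewrite <- Series_scal_l.
  assert (Es : forall c (u : nat -> R), ex_series u -> ex_series (fun n => c * u n))
    by (intros; now apply (ex_series_scal (K := R_AbsRing) (V := R_NormedModule))).
  replace (Cmod s * Cmod s)
    with (Series (fun n => fst s * fst (a n) + snd s * snd (a n))).
  2:{ rewrite Series_plus, !Series_scal_l, Cmod_sqr; [reflexivity | |]; apply Es;
      [now apply Cabs_summable_fst | now apply Cabs_summable_snd]. }
  assert (Hn : forall n, Rabs (fst s * fst (a n) + snd s * snd (a n))
                         <= Cmod s * Cmod (a n)).
  { intros n; rewrite <- (Cmod_conj s), <- Cmod_mult.
    eapply Rle_trans; [| apply re_le_Cmod]; apply Req_le, f_equal; simpl; ring. }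
  eapply Rle_trans; [apply Rle_abs |]; eapply Rle_trans.
  - apply Series_Rabs, ex_series_dominated with (2 := Es (Cmod s) _ Ha).
    intros n; rewrite Rabs_Rabsolu; apply Hn.
  - apply Series_le; [| exact (Es (Cmod s) _ Ha)].
    intros n; split; [apply Rabs_pos | apply Hn]. }
destruct (Req_dec (Cmod s) 0) as [E | E].
- rewrite E; apply Series_ge_0; [intros; apply Cmod_ge_0 | exact Ha].
- apply Rmult_le_reg_l with (Cmod s); [| exact Hs].
  pose proof (Cmod_ge_0 s); lra.
Qed.

Definition entire_coef (a : nat -> C) : Prop :=
  forall r, 0 <= r -> ex_series (fun n => Cmod (a n) * r ^ n).

Definition Cpseries (a : nat -> C) (z : C) : C := Cseries (fun n => (a n * z ^ n)%C).

Definition coef_derive (a : nat -> C) (n : nat) : C :=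
  (RtoC (INR (S n)) * a (S n))%C.

Lemma entire_coef_summable (a : nat -> C) (z : C) :
  entire_coef a -> Cabs_summable (fun n => (a n * z ^ n)%C).
Proof.
intros H; apply (Cabs_summable_dominated _ (fun n => Cmod (a n) * Cmod z ^ n)).
- intros n; rewrite Cmod_mult, Cmod_pow; lra.
- apply H, Cmod_ge_0.
Qed.

Lemma INR_le_pow2 (n : nat) : INR n <= 2 ^ n.
Proof.
induction n as [| n IH]; [simpl; lra |].
rewrite S_INR; simpl.
assert (1 <= 2 ^ n) by (apply pow_R1_Rle; lra); lra.
Qed.

(** The factor n is at most 2^n and only enlarges the radius, which is harmless for an entire
    series. The radius r + 1 replaces r because r may be smaller than 1. *)
Lemma entire_coef_derive (a : nat -> C) : entire_coef a -> entire_coef (coef_derive a).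
Proof.
intros H r Hr.
apply ex_series_dominated with
  (fun n => Cmod (a (S n)) * (2 * (r + 1)) ^ (S n)).
- intros n.
  assert (Hp : 0 <= r ^ n) by now apply pow_le.
  rewrite Rabs_pos_eq by (apply Rmult_le_pos; [apply Cmod_ge_0 | exact Hp]).
  unfold coef_derive; rewrite Cmod_mult, Cmod_R, Rabs_pos_eq by apply pos_INR.
  rewrite (Rmult_comm (INR _)), Rmult_assoc.
  apply Rmult_le_compat_l; [apply Cmod_ge_0 |].
  rewrite Rpow_mult_distr; apply Rmult_le_compat.
  + apply pos_INR.
  + exact Hp.
  + apply INR_le_pow2.
  + apply Rle_trans with ((r + 1) ^ n); [apply pow_incr; lra |].
    assert (0 <= (r + 1) ^ n) by (apply pow_le; lra); simpl; nra.
- apply (ex_series_incr_1 (K := R_AbsRing) (V := R_NormedModule)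
    (fun n => Cmod (a n) * (2 * (r + 1)) ^ n)).
  apply H; lra.
Qed.

(** By induction: the remainder of order n + 1 is z times that of order n plus n w^(n-1) (z-w)^2.
    For n = 0 the truncated predecessor does not matter, its factor [INR n] being 0. *)
Lemma Cpow_taylor2 (z w : C) (r : R) (n : nat) : 1 <= r -> Cmod z <= r -> Cmod w <= r ->
  Cmod (z ^ n - w ^ n - RtoC (INR n) * w ^ pred n * (z - w))%C
  <= INR n ^ 2 * r ^ n * Cmod (z - w)%C ^ 2.
Proof.
intros Hr Hz Hw; induction n as [| n IH].
- apply Req_le; simpl; replace (1 - 1 - 0 * 1 * (z - w))%C with (RtoC 0) by ring.
  rewrite Cmod_0; ring.
- replace (z ^ S n - w ^ S n - RtoC (INR (S n)) * w ^ pred (S n) * (z - w))%C with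
    (z * (z ^ n - w ^ n - RtoC (INR n) * w ^ pred n * (z - w))
     + RtoC (INR n) * w ^ pred n * (z - w) * (z - w))%C.
  2:{ rewrite S_INR, RtoC_plus; destruct n as [| n]; simpl; ring. }
  eapply Rle_trans; [apply Cmod_triangle |].
  rewrite !Cmod_mult, Cmod_R, Rabs_pos_eq by apply pos_INR.
  rewrite Cmod_pow.
  assert (Hn := pos_INR n). assert (Hd := Cmod_ge_0 (z - w)%C).
  assert (Hrn : 1 <= r ^ n) by now apply pow_R1_Rle.
  assert (Hw' : Cmod w ^ pred n <= r ^ S n).
  { apply Rle_trans with (r ^ pred n); [apply pow_incr; split; [apply Cmod_ge_0 | exact Hw] |].
    apply Rle_pow; [exact Hr | lia]. }
  set (d := Cmod (z - w)%C) in *.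
  assert (Hz0 := Cmod_ge_0 z).
  apply Rle_trans with (r * (INR n ^ 2 * r ^ n * d ^ 2) + INR n * r ^ S n * d * d).
  + apply Rplus_le_compat.
    * apply Rmult_le_compat; try assumption; apply Cmod_ge_0.
    * do 2 (apply Rmult_le_compat_r; [exact Hd |]).
      now apply Rmult_le_compat_l.
  + rewrite S_INR; simpl.
    assert (0 <= r * r ^ n * (d * d) * (INR n + 1)); [| nra].
    repeat apply Rmult_le_pos; lra.
Qed.

(** Summing the remainders of the monomials differentiates the series term by term, with a constant
    uniform on the disc; n^2 <= 4^n makes the sum converge. *)
Lemma Cpseries_taylor2 (a : nat -> C) (r : R) : entire_coef a -> 1 <= r ->
  exists K, 0 <= K /\ forall z w, Cmod z <= r -> Cmod w <= r ->
    Cmod (Cpseries a z - Cpseries a w - Cpseries (coef_derive a) w * (z - w))%C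
    <= K * Cmod (z - w)%C ^ 2.
Proof.
intros Ha Hr.
set (b := fun n => Cmod (a n) * (INR n ^ 2 * r ^ n)).
assert (Hb : ex_series b).
{ apply ex_series_dominated with (fun n => Cmod (a n) * (4 * r) ^ n); [| apply Ha; lra].
  intros n; unfold b.
  assert (Hrn : 1 <= r ^ n) by now apply pow_R1_Rle.
  assert (Hn := pos_INR n). assert (H2 := INR_le_pow2 n).
  rewrite Rabs_pos_eq.
  - apply Rmult_le_compat_l; [apply Cmod_ge_0 |].
    rewrite Rpow_mult_distr; apply Rmult_le_compat_r; [lra |].
    replace 4 with (2 * 2) by ring; rewrite Rpow_mult_distr; simpl; nra.
  - apply Rmult_le_pos; [apply Cmod_ge_0 |]; apply Rmult_le_pos; [nra | lra]. }
exists (Series b); split.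
{ apply Series_ge_0; [| exact Hb]; intros n; unfold b.
  apply Rmult_le_pos; [apply Cmod_ge_0 |]; apply Rmult_le_pos; [apply pow2_ge_0 |].
  apply pow_le; lra. }
intros z w Hz Hw.
set (e := fun n => (a n * (z ^ n - w ^ n - RtoC (INR n) * w ^ pred n * (z - w)))%C).
assert (He : forall n, Cmod (e n) <= Cmod (z - w)%C ^ 2 * b n).
{ intros n; unfold e, b; rewrite Cmod_mult.
  replace (Cmod (z - w)%C ^ 2 * (Cmod (a n) * (INR n ^ 2 * r ^ n))) with
    (Cmod (a n) * (INR n ^ 2 * r ^ n * Cmod (z - w)%C ^ 2)) by ring.
  apply Rmult_le_compat_l; [apply Cmod_ge_0 |]; now apply Cpow_taylor2. }
assert (Hsb : ex_series (fun n => Cmod (z - w)%C ^ 2 * b n))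
  by now apply (ex_series_scal (K := R_AbsRing) (V := R_NormedModule)).
assert (Hse : Cabs_summable e) by now apply Cabs_summable_dominated with (1 := He).
replace (Cpseries a z - Cpseries a w - Cpseries (coef_derive a) w * (z - w))%C
  with (Cseries e).
{ eapply Rle_trans; [now apply Cmod_Cseries |].
  rewrite (Rmult_comm (Series b)), <- Series_scal_l; apply Series_le; [| exact Hsb].
  intros n; split; [apply Cmod_ge_0 | apply He]. }
pose proof (entire_coef_summable a z Ha) as Sz.
pose proof (entire_coef_summable a w Ha) as Sw.
pose proof (entire_coef_summable _ w (entire_coef_derive a Ha)) as Sd.
(* Indexed from 0 with a vanishing initial term, so that a shift by one turns it into the
   differentiated series. *)
set (g := fun n => (a n * (RtoC (INR n) * w ^ pred n * (z - w)))%C).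
assert (Sg : Cabs_summable g).
{ apply (ex_series_incr_1 (K := R_AbsRing) (V := R_NormedModule)).
  apply (Cabs_summable_scal (z - w)) in Sd; revert Sd; apply ex_series_ext.
  intros n; unfold g, coef_derive; apply f_equal.
  change (pred (S n)) with n; ring. }
assert (Eg : Cseries g = (Cpseries (coef_derive a) w * (z - w))%C).
{ rewrite (Cseries_incr g Sg).
  replace (g O) with (RtoC 0) by (unfold g; simpl; ring).
  unfold Cpseries; rewrite Cmult_comm, <- Cseries_scal by exact Sd.
  rewrite Cplus_0_l; apply Cseries_ext; intros n; unfold g, coef_derive.
  change (pred (S n)) with n; ring. }
rewrite <- Eg; unfold Cpseries.
rewrite (Cseries_ext e (fun n => (a n * z ^ n + ((-1) * (a n * w ^ n) + (-1) * g n))%C))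
  by (intros n; unfold e, g; ring).
pose proof (Cabs_summable_scal (-1) _ Sw) as Sw'.
pose proof (Cabs_summable_scal (-1) _ Sg) as Sg'.
rewrite (Cseries_plus _ _ Sz (Cabs_summable_plus _ _ Sw' Sg')).
rewrite (Cseries_plus _ _ Sw' Sg'), (Cseries_scal _ _ Sw), (Cseries_scal _ _ Sg).
ring.
Qed.

Lemma Cpseries_bounded (a : nat -> C) (r : R) : entire_coef a -> 0 <= r ->
  exists M, 0 < M /\ forall z, Cmod z <= r -> Cmod (Cpseries a z) <= M.
Proof.
intros Ha Hr; exists (Rabs (Series (fun n => Cmod (a n) * r ^ n)) + 1); split.
{ pose proof (Rabs_pos (Series (fun n => Cmod (a n) * r ^ n))); lra. }
intros z Hz; eapply Rle_trans; [apply Cmod_Cseries; now apply entire_coef_summable |].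
eapply Rle_trans; [| apply Rlt_le, Rlt_plus_1].
eapply Rle_trans; [| apply Rle_abs].
apply Series_le; [| now apply Ha]; intros n; split; [apply Cmod_ge_0 |].
rewrite Cmod_mult, Cmod_pow; apply Rmult_le_compat_l; [apply Cmod_ge_0 |].
apply pow_incr; split; [apply Cmod_ge_0 | exact Hz].
Qed.

Lemma Cpseries_lipschitz (a : nat -> C) (r : R) : entire_coef a -> 0 <= r ->
  exists L, 0 < L /\ forall z w, Cmod z <= r -> Cmod w <= r ->
    Cmod (Cpseries a z - Cpseries a w)%C <= L * Cmod (z - w)%C.
Proof.
intros Ha Hr.
(* Radius r + 1, since the Taylor estimate asks for a radius of at least 1. *)
destruct (Cpseries_taylor2 a (r + 1) Ha) as (K & HK & H); [lra |].
destruct (Cpseries_bounded _ r (entire_coef_derive a Ha) Hr) as (M & HM & HB).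
exists (M + K * (2 * r)); split; [nra |].
intros z w Hz Hw; specialize (H z w); specialize (HB w Hw).
replace (Cpseries a z - Cpseries a w)%C with
  ((Cpseries a z - Cpseries a w - Cpseries (coef_derive a) w * (z - w))
   + Cpseries (coef_derive a) w * (z - w))%C by ring.
eapply Rle_trans; [apply Cmod_triangle |].
rewrite Cmod_mult.
assert (Hd : Cmod (z - w)%C <= 2 * r).
{ unfold Cminus; eapply Rle_trans; [apply Cmod_triangle |]; rewrite Cmod_opp; lra. }
pose proof (Cmod_ge_0 (z - w)%C).
assert (Cmod (Cpseries (coef_derive a) w) * Cmod (z - w)%C <= M * Cmod (z - w)%C)
  by now apply Rmult_le_compat_r.
assert (K * Cmod (z - w)%C ^ 2 <= K * (2 * r) * Cmod (z - w)%C).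
{ rewrite Rmult_assoc; apply Rmult_le_compat_l; [exact HK |].
  simpl; rewrite Rmult_1_r; now apply Rmult_le_compat_r. }
assert (Cmod z <= r + 1) by lra. assert (Cmod w <= r + 1) by lra.
specialize (H H3 H4); lra.
Qed.

(** The chain rule for the two inner functions in use, t w and (t + i h)^2, whose remainders are 0
    and (t - x)^2. *)
Lemma is_derive_RC_Cpseries (a : nat -> C) (g : R -> C) (x : R) (l : C) (B : R) :
  entire_coef a ->
  (forall t, Cmod (g t - g x - l * RtoC (t - x))%C <= B * (t - x) ^ 2) ->
  is_derive_RC (fun t => Cpseries a (g t)) x (Cpseries (coef_derive a) (g x) * l)%C.
Proof.
intros Ha Hg.
assert (HB : 0 <= B).
{ specialize (Hg (x + 1)); replace (x + 1 - x) with 1 in Hg by ring.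
  pose proof (Cmod_ge_0 (g (x + 1)%R - g x - l * 1)%C); lra. }
set (D := Cmod l + B).
assert (HD : 0 <= D) by (unfold D; pose proof (Cmod_ge_0 l); lra).
assert (Hlip : forall t, Rabs (t - x) <= 1 -> Cmod (g t - g x)%C <= D * Rabs (t - x)).
{ intros t Ht.
  replace (g t - g x)%C with ((g t - g x - l * RtoC (t - x)) + l * RtoC (t - x))%C by ring.
  eapply Rle_trans; [apply Cmod_triangle |]; rewrite Cmod_mult, Cmod_R.
  specialize (Hg t). rewrite <- (pow2_abs (t - x)) in Hg.
  pose proof (Rabs_pos (t - x)).
  assert (B * Rabs (t - x) ^ 2 <= B * Rabs (t - x))
    by (apply Rmult_le_compat_l; [exact HB | simpl; nra]).
  unfold D; lra. }
set (r := Cmod (g x) + D + 1).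
pose proof (Cmod_ge_0 (g x)) as Hgx.
destruct (Cpseries_taylor2 a r Ha) as (K & HK & H); [unfold r; lra |].
set (M := Cmod (Cpseries (coef_derive a) (g x))).
apply is_derive_RC_quad with (K * D ^ 2 + M * B).
intros t Ht.
replace (Cpseries a (g t) - Cpseries a (g x)
         - Cpseries (coef_derive a) (g x) * l * RtoC (t - x))%C
  with ((Cpseries a (g t) - Cpseries a (g x)
         - Cpseries (coef_derive a) (g x) * (g t - g x))
        + Cpseries (coef_derive a) (g x) * (g t - g x - l * RtoC (t - x)))%C by ring.
eapply Rle_trans; [apply Cmod_triangle |].
rewrite Rmult_plus_distr_r; apply Rplus_le_compat.
- eapply Rle_trans; [apply H |].
  + replace (g t) with ((g t - g x) + g x)%C by ring.
    eapply Rle_trans; [apply Cmod_triangle |].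
    specialize (Hlip t Ht); unfold r; pose proof (Rabs_pos (t - x)); nra.
  + unfold r; lra.
  + rewrite Rmult_assoc; apply Rmult_le_compat_l; [exact HK |].
    rewrite <- (pow2_abs (t - x)), <- Rpow_mult_distr.
    apply pow_incr; split; [apply Cmod_ge_0 | now apply Hlip].
- rewrite Cmod_mult, Rmult_assoc; apply Rmult_le_compat_l; [apply Cmod_ge_0 |].
  apply Hg.
Qed.

(** * Frobenius solutions *)

Definition Cexp (z : C) : C := (exp (fst z) * cos (snd z), exp (fst z) * sin (snd z)).

Lemma Cexp_plus (z w : C) : Cexp (z + w)%C = (Cexp z * Cexp w)%C.
Proof.
unfold Cexp, Cmult, Cplus; simpl; rewrite exp_plus, cos_plus, sin_plus.
f_equal; ring.
Qed.

Lemma Cexp_0 : Cexp 0 = 1.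
Proof. unfold Cexp; simpl; rewrite exp_0, cos_0, sin_0; unfold RtoC; f_equal; ring. Qed.

Lemma Cmod_Cexp (z : C) : Cmod (Cexp z) = exp (fst z).
Proof.
unfold Cmod, Cexp; simpl.
replace (_ + _) with (Rsqr (exp (fst z))).
- apply sqrt_Rsqr, Rlt_le, exp_pos.
- pose proof (sin2_cos2 (snd z)) as H; unfold Rsqr in *; nra.
Qed.

Lemma is_derive_RC_Cexp (f : R -> C) (x : R) (l : C) : is_derive_RC f x l ->
  is_derive_RC (fun t => Cexp (f t)) x (l * Cexp (f x))%C.
Proof.
intros [F1 F2].
assert (De : is_derive (fun t => exp (fst (f t))) x (fst l * exp (fst (f x)))).
{ eapply is_derive_eq; [apply (is_derive_comp exp (fun t => fst (f t)));
   [apply is_derive_exp | exact F1] | reflexivity]. }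
split; eapply is_derive_eq.
- apply is_derive_Rmult; [exact De |].
  apply (is_derive_comp cos (fun t => snd (f t))); [apply is_derive_cos | exact F2].
- unfold scal; simpl; unfold mult; simpl; ring.
- apply is_derive_Rmult; [exact De |].
  apply (is_derive_comp sin (fun t => snd (f t))); [apply is_derive_sin | exact F2].
- unfold scal; simpl; unfold mult; simpl; ring.
Qed.

(* Logarithm of [x + i h] for [h > 0], with argument in (0,pi). *)
Definition Clog_up (h x : R) : C := (ln (Cmod (x, h)), PI / 2 - atan (x / h)).

Lemma Cmod_up_pos (h x : R) : 0 < h -> 0 < Cmod (x, h).
Proof.
intros Hh; apply Cmod_gt_0; intros E; apply (f_equal snd) in E; simpl in E; lra.
Qed.

Lemma up_neq_0 (h x : R) : 0 < h -> ((x, h) : C) <> 0.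
Proof. intros Hh; now apply Cmod_gt_0, Cmod_up_pos. Qed.

Lemma Cmod_up_sqr (h x : R) : Cmod (x, h) * Cmod (x, h) = x * x + h * h.
Proof. apply Cmod_sqr. Qed.

Lemma is_derive_RC_Clog_up (h x : R) : 0 < h ->
  is_derive_RC (Clog_up h) x (/ (x, h))%C.
Proof.
intros Hh; split; unfold Clog_up, Cmod; simpl; auto_derive.
- repeat split; try (apply sqrt_lt_R0); nra.
- pose proof (Cmod_up_sqr h x) as Hs; pose proof (Cmod_up_pos h x Hh) as Hp.
  unfold Cmod in Hs, Hp; simpl in Hs, Hp.
  set (r := sqrt _) in *.
  replace (x * (x * 1) + h * (h * 1)) with (r * r) by (rewrite Hs; ring).
  field; lra.
- exact I.
- field; nra.
Qed.

Lemma Cexp_Clog_up (h x : R) : 0 < h -> Cexp (Clog_up h x) = (x, h).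
Proof.
intros Hh; unfold Cexp, Clog_up; simpl.
rewrite exp_ln by now apply Cmod_up_pos.
rewrite cos_shift, sin_shift, sin_atan, cos_atan.
assert (E : sqrt (1 + (x / h)²) = Cmod (x, h) / h).
{ apply sqrt_lem_1.
  - pose proof (Rle_0_sqr (x / h)); lra.
  - pose proof (Cmod_up_pos h x Hh); apply Rlt_le, Rdiv_lt_0_compat; lra.
  - replace (Cmod (x, h) / h * (Cmod (x, h) / h))
      with (Cmod (x, h) * Cmod (x, h) / (h * h)) by (field; lra).
    rewrite Cmod_up_sqr; unfold Rsqr; field; lra. }
rewrite E; pose proof (Cmod_up_pos h x Hh); f_equal; field; lra.
Qed.

Lemma arg_up_bounds (h x : R) : 0 < snd (Clog_up h x) < PI.
Proof. pose proof (atan_bound (x / h)); simpl; lra. Qed.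

Lemma arg_up_ge0 (h x : R) : 0 < h -> 0 <= x -> snd (Clog_up h x) <= PI / 2.
Proof.
intros Hh Hx; simpl; enough (0 <= atan (x / h)) by lra.
assert (H : 0 <= x / h) by (apply Rmult_le_pos; [lra | apply Rlt_le, Rinv_0_lt_compat, Hh]).
destruct H as [H | <-]; [left; rewrite <- atan_0; now apply atan_increasing |].
rewrite atan_0; lra.
Qed.

Lemma arg_up_opp (h x : R) : snd (Clog_up h (- x)) = PI - snd (Clog_up h x).
Proof. simpl; unfold Rdiv; rewrite Ropp_mult_distr_l_reverse, atan_opp; lra. Qed.

Lemma arg_up_ge (h x : R) : 0 < h -> h <= x -> snd (Clog_up h x) <= PI / 4.
Proof.
intros Hh Hx; simpl; enough (PI / 4 <= atan (x / h)) by lra.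
assert (H : 1 <= x / h) by (apply Rle_div_r; lra).
rewrite <- atan_1; destruct H as [H | <-]; [left; now apply atan_increasing | right; reflexivity].
Qed.

(** The coefficients 1 / (4^k k! (1+nu)(2+nu)...(k+nu)) of Gamma(1+nu) (z/2)^(-nu) I_nu(z) in powers
    of z^2. *)
Fixpoint frob (nu : C) (k : nat) : C :=
  match k with
  | O => 1
  | S k' => (frob nu k' / (4 * RtoC (INR k) * (RtoC (INR k) + nu)))%C
  end.

(** The condition on Re nu, satisfied by both exponents, keeps k + 1 + nu at distance at least 1/2
    from 0. *)
Lemma frob_factor_bound (nu : C) (k : nat) : - (1 / 2) <= Re nu ->
  2 * INR (S k) <= Cmod (4 * RtoC (INR (S k)) * (RtoC (INR (S k)) + nu))%C.
Proof.
intros Hnu; rewrite !Cmod_mult, !Cmod_R, (Rabs_pos_eq (INR (S k))), (Rabs_pos_eq 4)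
  by (try apply pos_INR; lra).
assert (H : INR (S k) + Re nu <= Cmod (RtoC (INR (S k)) + nu)%C).
{ eapply Rle_trans; [| apply re_le_Cmod]; eapply Rle_trans; [| apply Rle_abs].
  simpl; apply Req_le; reflexivity. }
pose proof (pos_INR k); rewrite S_INR in *; nra.
Qed.

Lemma frob_factor_neq0 (nu : C) (k : nat) : - (1 / 2) <= Re nu ->
  (4 * RtoC (INR (S k)) * (RtoC (INR (S k)) + nu))%C <> 0.
Proof.
intros Hnu; apply Cmod_gt_0.
pose proof (frob_factor_bound nu k Hnu); pose proof (pos_INR k); rewrite S_INR in *; lra.
Qed.

Lemma frob_bound (nu : C) (k : nat) : - (1 / 2) <= Re nu ->
  Cmod (frob nu k) <= / INR (fact k).
Proof.
intros Hnu; induction k as [| k IH].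
- simpl; rewrite Cmod_1; lra.
- change (frob nu (S k)) with
    (frob nu k / (4 * RtoC (INR (S k)) * (RtoC (INR (S k)) + nu)))%C.
  rewrite Cmod_div by now apply frob_factor_neq0.
  pose proof (frob_factor_bound nu k Hnu) as Hf.
  change (fact (S k)) with (S k * fact k)%nat; rewrite mult_INR, Rinv_mult.
  assert (0 < INR (S k)) by apply lt_0_INR, Nat.lt_0_succ.
  unfold Rdiv; rewrite Rmult_comm; apply Rmult_le_compat.
  + apply Rlt_le, Rinv_0_lt_compat; lra.
  + apply Cmod_ge_0.
  + apply Rinv_le_contravar; lra.
  + exact IH.
Qed.

Lemma entire_coef_frob (nu : C) : - (1 / 2) <= Re nu -> entire_coef (frob nu).
Proof.
intros Hnu r Hr.
apply ex_series_dominated with (fun n => / INR (fact n) * r ^ n).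
- intros n; assert (0 <= r ^ n) by now apply pow_le.
  rewrite Rabs_pos_eq by (apply Rmult_le_pos; [apply Cmod_ge_0 | assumption]).
  apply Rmult_le_compat_r; [assumption | now apply frob_bound].
- exists (exp r); apply is_series_ext with (2 := is_exp_Reals r).
  intros n; unfold scal; simpl; unfold mult; simpl.
  rewrite pow_n_pow; apply Rmult_comm.
Qed.

(* [z^(1/2+nu) * frobF nu (z^2)] solves [u'' = (1 - (1/4-nu^2)/z^2) u]; up to
   normalization it is [sqrt z * I_nu(z)], [I_nu] the modified Bessel function. *)
Definition frobF (nu z : C) : C := Cpseries (frob nu) z.
Definition frobF' (nu z : C) : C := Cpseries (coef_derive (frob nu)) z.
Definition frobF'' (nu z : C) : C := Cpseries (coef_derive (coef_derive (frob nu))) z.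

(** Coefficientwise this is the recursion 4 (k+1) (k+1+nu) a_(k+1) = a_k. The series of z F'' is
    re-indexed through [g], whose term of index 0 vanishes. *)
Lemma frobF_ode (nu z : C) : - (1 / 2) <= Re nu ->
  (4 * z * frobF'' nu z + 4 * (1 + nu) * frobF' nu z = frobF nu z)%C.
Proof.
intros Hnu; pose proof (entire_coef_frob nu Hnu) as H0.
pose proof (entire_coef_derive _ H0) as H1.
pose proof (entire_coef_derive _ H1) as H2.
pose proof (entire_coef_summable _ z H1) as S1.
pose proof (entire_coef_summable _ z H2) as S2.
set (g := fun k => (4 * RtoC (INR k) * (coef_derive (frob nu) k * z ^ k))%C).
pose proof (Cabs_summable_scal (4 * z) _ S2) as S2'.
assert (Sg : Cabs_summable g).
{ apply (ex_series_incr_1 (K := R_AbsRing) (V := R_NormedModule)).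
  revert S2'; apply ex_series_ext; intros k; unfold g; apply f_equal.
  unfold coef_derive at 1; rewrite Cpow_S; ring. }
assert (Eg : (4 * z * frobF'' nu z)%C = Cseries g).
{ rewrite (Cseries_incr g Sg); unfold frobF'', Cpseries.
  rewrite <- Cseries_scal by exact S2.
  replace (g O) with (RtoC 0) by (unfold g; simpl; ring).
  rewrite Cplus_0_l; apply Cseries_ext; intros k; unfold g.
  unfold coef_derive at 1; rewrite Cpow_S; ring. }
rewrite Eg; unfold frobF', frobF, Cpseries.
rewrite <- (Cseries_scal _ _ S1).
rewrite <- (Cseries_plus _ _ Sg (Cabs_summable_scal _ _ S1)).
apply Cseries_ext; intros k; unfold g, coef_derive.
change (frob nu (S k)) with
    (frob nu k / (4 * RtoC (INR (S k)) * (RtoC (INR (S k)) + nu)))%C.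
pose proof (frob_factor_neq0 nu k Hnu) as Hn.
rewrite S_INR, RtoC_plus in *.
field; repeat split; intros E; apply Hn; rewrite E; ring.
Qed.

Lemma frobF_0 (nu : C) : - (1 / 2) <= Re nu -> frobF nu 0 = 1.
Proof.
intros Hnu; pose proof (entire_coef_frob nu Hnu) as H0.
unfold frobF, Cpseries; rewrite Cseries_incr by now apply entire_coef_summable.
rewrite (Cseries_ext _ (fun n => (0 * (frob nu (S n) * 1 ^ (S n)))%C)).
- rewrite Cseries_scal; [simpl; ring |].
  apply (ex_series_incr_1 (K := R_AbsRing) (V := R_NormedModule)
    (fun n => Cmod (frob nu n * 1 ^ n)%C)).
  now apply entire_coef_summable.
- intros n; rewrite !Cpow_S; ring.
Qed.

Lemma is_derive_RC_frobF_line (nu w : C) (t : R) : - (1 / 2) <= Re nu ->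
  is_derive_RC (fun t => frobF nu (RtoC t * w)) t (frobF' nu (RtoC t * w) * w)%C.
Proof.
intros Hnu; apply (is_derive_RC_Cpseries _ (fun t => RtoC t * w)%C t w 0).
- now apply entire_coef_frob.
- intros s; apply Req_le; rewrite Rmult_0_l.
  replace (_ - _)%C with (RtoC 0); [apply Cmod_0 |].
  rewrite RtoC_minus; ring.
Qed.

Lemma is_derive_RC_frobF'_line (nu w : C) (t : R) : - (1 / 2) <= Re nu ->
  is_derive_RC (fun t => frobF' nu (RtoC t * w)) t (frobF'' nu (RtoC t * w) * w)%C.
Proof.
intros Hnu; apply (is_derive_RC_Cpseries _ (fun t => RtoC t * w)%C t w 0).
- now apply entire_coef_derive, entire_coef_frob.
- intros s; apply Req_le; rewrite Rmult_0_l.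
  replace (_ - _)%C with (RtoC 0); [apply Cmod_0 |].
  rewrite RtoC_minus; ring.
Qed.

Lemma up_sqr_taylor (h x t : R) :
  Cmod (((t, h) : C) * (t, h) - ((x, h) : C) * (x, h) - 2 * (x, h) * RtoC (t - x))%C
  <= 1 * (t - x) ^ 2.
Proof.
replace (_ - _)%C with (RtoC ((t - x) ^ 2)).
- rewrite Cmod_R, Rabs_pos_eq by apply pow2_ge_0; lra.
- apply injective_projections; simpl; ring.
Qed.

Lemma is_derive_RC_frobF_up (nu : C) (h x : R) : - (1 / 2) <= Re nu ->
  is_derive_RC (fun t => frobF nu (((t, h) : C) * (t, h))) x
    (frobF' nu (((x, h) : C) * (x, h)) * (2 * (x, h)))%C.
Proof.
intros Hnu; apply (is_derive_RC_Cpseries _ (fun t => ((t, h) : C) * (t, h))%C x _ 1).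
- now apply entire_coef_frob.
- intros s; apply up_sqr_taylor.
Qed.

Lemma is_derive_RC_frobF'_up (nu : C) (h x : R) : - (1 / 2) <= Re nu ->
  is_derive_RC (fun t => frobF' nu (((t, h) : C) * (t, h))) x
    (frobF'' nu (((x, h) : C) * (x, h)) * (2 * (x, h)))%C.
Proof.
intros Hnu; apply (is_derive_RC_Cpseries _ (fun t => ((t, h) : C) * (t, h))%C x _ 1).
- now apply entire_coef_derive, entire_coef_frob.
- intros s; apply up_sqr_taylor.
Qed.

(* The Wronskian of the two Frobenius solutions, cleared of its powers of [z]. *)
Lemma frobF_wronskian (nu z : C) : Rabs (Re nu) <= 1 / 2 ->
  (2 * nu * frobF nu z * frobF (- nu) z
   + 2 * z * (frobF' nu z * frobF (- nu) z - frobF nu z * frobF' (- nu) z)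
   = 2 * nu)%C.
Proof.
intros Hnu.
assert (Hp : - (1 / 2) <= Re nu) by (apply Rabs_le_between in Hnu; lra).
assert (Hm : - (1 / 2) <= Re (- nu)%C)
  by (apply Rabs_le_between in Hnu; unfold Re in *; simpl; lra).
(* The left-hand side along the segment from 0 to z: the two differential equations make it
   constant, and its value at t = 0 is 2 nu. *)
set (q := fun t : R => (2 * nu * frobF nu (t * z) * frobF (- nu) (t * z)
   + 2 * (t * z) * (frobF' nu (t * z) * frobF (- nu) (t * z)
                    - frobF nu (t * z) * frobF' (- nu) (t * z)))%C).
assert (E : q 0 = q 1).
{ apply is_derive_RC_zero; [lra |]; intros t _; eapply is_derive_RC_eq.
  - pose proof (is_derive_RC_frobF_line nu z t Hp) as DF.
    pose proof (is_derive_RC_frobF_line (- nu) z t Hm) as DG.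
    pose proof (is_derive_RC_frobF'_line nu z t Hp) as DF'.
    pose proof (is_derive_RC_frobF'_line (- nu) z t Hm) as DG'.
    assert (Dt : is_derive_RC (fun t => (2 * (RtoC t * z))%C) t (2 * (1 * z))%C).
    { apply is_derive_RC_scal; eapply is_derive_RC_eq.
      - apply is_derive_RC_mult; [apply is_derive_RC_RtoC, is_derive_id |
          apply is_derive_RC_const].
      - cbv beta; change (@one R_AbsRing) with 1; ring. }
    exact (is_derive_RC_plus _ _ _ _ _
      (is_derive_RC_mult _ _ _ _ _ (is_derive_RC_scal (2 * nu) _ _ _ DF) DG)
      (is_derive_RC_mult _ _ _ _ _ Dt
        (is_derive_RC_minus _ _ _ _ _ (is_derive_RC_mult _ _ _ _ _ DF' DG)
          (is_derive_RC_mult _ _ _ _ _ DF DG')))).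
  - cbv beta.
    pose proof (frobF_ode nu (t * z)%C Hp) as O1.
    pose proof (frobF_ode (- nu) (t * z)%C Hm) as O2.
    set (F := frobF nu (t * z)%C) in *. set (G := frobF (- nu) (t * z)%C) in *.
    set (F1 := frobF' nu (t * z)%C) in *. set (G1 := frobF' (- nu) (t * z)%C) in *.
    set (F2 := frobF'' nu (t * z)%C) in *. set (G2 := frobF'' (- nu) (t * z)%C) in *.
    clearbody F G F1 G1 F2 G2.
    transitivity (z * / 2 * ((4 * (t * z) * F2 + 4 * (1 + nu) * F1) * G
                  - F * (4 * (t * z) * G2 + 4 * (1 + - nu) * G1)))%C.
    + field; intros E; apply (f_equal fst) in E; simpl in E; lra.
    + rewrite O1, O2; ring. }
unfold q in E; rewrite !Cmult_0_l, !frobF_0, !Cmult_1_l in E by assumption.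
rewrite <- E; ring.
Qed.

(** * Complex powers on the line Im z = h, and the Frobenius solutions *)

Definition Cpow_up (nu : C) (h x : R) : C := Cexp (nu * Clog_up h x).

Lemma Cmod_Cpow_up (nu : C) (h x : R) :
  Cmod (Cpow_up nu h x) = Rpower (Cmod (x, h)) (Re nu) * exp (- (Im nu * snd (Clog_up h x))).
Proof.
unfold Cpow_up; rewrite Cmod_Cexp; unfold Rpower; rewrite <- exp_plus.
apply f_equal; simpl; unfold Re, Im; ring.
Qed.

Lemma Cpow_up_plus (nu nu' : C) (h x : R) :
  Cpow_up (nu + nu') h x = (Cpow_up nu h x * Cpow_up nu' h x)%C.
Proof. unfold Cpow_up; rewrite <- Cexp_plus; f_equal; ring. Qed.

Lemma Cpow_up_1 (h x : R) : 0 < h -> Cpow_up 1 h x = (x, h).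
Proof. intros Hh; unfold Cpow_up; rewrite Cmult_1_l; now apply Cexp_Clog_up. Qed.

Lemma is_derive_RC_Cpow_up (nu : C) (h x : R) : 0 < h ->
  is_derive_RC (Cpow_up nu h) x (nu / (x, h) * Cpow_up nu h x)%C.
Proof.
intros Hh; unfold Cpow_up.
apply is_derive_RC_Cexp, is_derive_RC_scal, is_derive_RC_Clog_up, Hh.
Qed.

Lemma is_derive_RC_up (h x : R) : is_derive_RC (fun t => ((t, h) : C)) x 1.
Proof.
split; simpl; [apply (@is_derive_id R_AbsRing) |].
apply (@is_derive_const R_AbsRing R_NormedModule).
Qed.

(** The inverse is the power of exponent -1, whose derivative is known. *)
Lemma is_derive_RC_up_inv (h x : R) : 0 < h ->
  is_derive_RC (fun t => / ((t, h) : C))%C x (- (/ ((x, h) * (x, h))))%C.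
Proof.
intros Hh; assert (Hn := up_neq_0 h x Hh).
apply is_derive_RC_ext with (fun t => Cpow_up (-1) h t).
- intros t; assert (Hn' := up_neq_0 h t Hh).
  assert (E : (Cpow_up (-1) h t * (t, h) = 1)%C).
  { rewrite <- (Cpow_up_1 h t Hh) at 1; rewrite <- Cpow_up_plus.
    replace (-1 + 1)%C with (RtoC 0) by ring.
    unfold Cpow_up; rewrite Cmult_0_l; apply Cexp_0. }
  transitivity ((Cpow_up (-1) h t * (t, h)) / (t, h))%C; [field; exact Hn' |].
  rewrite E; unfold Cdiv; ring.
- eapply is_derive_RC_eq; [now apply is_derive_RC_Cpow_up |].
  assert (E : (Cpow_up (-1) h x * (x, h) = 1)%C).
  { rewrite <- (Cpow_up_1 h x Hh) at 1; rewrite <- Cpow_up_plus.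
    replace (-1 + 1)%C with (RtoC 0) by ring.
    unfold Cpow_up; rewrite Cmult_0_l; apply Cexp_0. }
  transitivity (- (Cpow_up (-1) h x * (x, h)) / ((x, h) * (x, h)))%C;
    [field; exact Hn | rewrite E; field; exact Hn].
Qed.

Definition psi (nu : C) (h x : R) : C :=
  (Cpow_up (RtoC (1 / 2) + nu) h x * frobF nu ((x, h) * (x, h)))%C.

Definition dpsi (nu : C) (h x : R) : C :=
  (Cpow_up (RtoC (1 / 2) + nu) h x *
   ((RtoC (1 / 2) + nu) * / (x, h) * frobF nu ((x, h) * (x, h))
    + 2 * (x, h) * frobF' nu ((x, h) * (x, h))))%C.

Definition bessel_pot (nu : C) (h x : R) : C :=
  (1 - (RtoC (1 / 4) - nu * nu) / ((x, h) * (x, h)))%C.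

Lemma is_derive_RC_psi (nu : C) (h x : R) : 0 < h -> - (1 / 2) <= Re nu ->
  is_derive_RC (psi nu h) x (dpsi nu h x).
Proof.
intros Hh Hnu; unfold psi; eapply is_derive_RC_eq.
- exact (is_derive_RC_mult _ _ _ _ _ (is_derive_RC_Cpow_up _ h x Hh)
    (is_derive_RC_frobF_up nu h x Hnu)).
- unfold dpsi; field; now apply up_neq_0.
Qed.

(** Once the power z^(1/2+nu) is factored out, what remains is the equation of [frobF] at z^2. *)
Lemma is_derive_RC_dpsi (nu : C) (h x : R) : 0 < h -> - (1 / 2) <= Re nu ->
  is_derive_RC (dpsi nu h) x (bessel_pot nu h x * psi nu h x)%C.
Proof.
intros Hh Hnu; unfold dpsi; eapply is_derive_RC_eq.
- exact (is_derive_RC_mult _ _ _ _ _ (is_derive_RC_Cpow_up _ h x Hh)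
    (is_derive_RC_plus _ _ _ _ _
      (is_derive_RC_mult _ _ _ _ _
        (is_derive_RC_scal _ _ _ _ (is_derive_RC_up_inv h x Hh))
        (is_derive_RC_frobF_up nu h x Hnu))
      (is_derive_RC_mult _ _ _ _ _
        (is_derive_RC_scal _ _ _ _ (is_derive_RC_up h x))
        (is_derive_RC_frobF'_up nu h x Hnu)))).
- unfold psi, bessel_pot.
  pose proof (frobF_ode nu ((x, h) * (x, h))%C Hnu) as O.
  assert (Hn := up_neq_0 h x Hh).
  replace (RtoC (1 / 4)) with (/ 4)%C
    by (apply injective_projections; simpl; field).
  replace (RtoC (1 / 2)) with (/ 2)%C
    by (apply injective_projections; simpl; field).
  set (F := frobF nu _) in *; set (F1 := frobF' nu _) in *; set (F2 := frobF'' nu _) in *.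
  set (P := Cpow_up _ h x); set (z := ((x, h) : C)) in *; clearbody F F1 F2 P z.
  transitivity (P * ((4 * (z * z) * F2 + 4 * (1 + nu) * F1)
                     - (/ 4 - nu * nu) / (z * z) * F))%C.
  + field; repeat split; try exact Hn;
    intros E; apply (f_equal fst) in E; simpl in E; lra.
  + rewrite O; field; repeat split; try exact Hn;
    intros E; apply (f_equal fst) in E; simpl in E; lra.
Qed.

(** The powers z^(1/2+nu) and z^(1/2-nu) multiply to z, so the branch of the logarithm disappears
    and [frobF_wronskian] applies. For nu <> 0 the value is non-zero, and the two solutions form a
    basis. *)
Lemma psi_wronskian (nu : C) (h x : R) : 0 < h -> Rabs (Re nu) <= 1 / 2 ->
  (psi nu h x * dpsi (- nu) h x - dpsi nu h x * psi (- nu) h x = - (2 * nu))%C.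
Proof.
intros Hh Hnu; unfold psi, dpsi.
assert (Hn := up_neq_0 h x Hh).
pose proof (frobF_wronskian nu ((x, h) * (x, h))%C Hnu) as W.
assert (P : (Cpow_up (RtoC (1 / 2) + nu) h x * Cpow_up (RtoC (1 / 2) + - nu) h x = (x, h))%C).
{ rewrite <- Cpow_up_plus, <- (Cpow_up_1 h x Hh); f_equal.
  transitivity (RtoC (1 / 2) + RtoC (1 / 2))%C; [ring |].
  rewrite <- RtoC_plus; f_equal; lra. }
set (F := frobF nu _) in *; set (F1 := frobF' nu _) in *.
set (G := frobF (- nu) _) in *; set (G1 := frobF' (- nu) _) in *.
set (A := Cpow_up (RtoC (1 / 2) + nu) h x) in *.
set (B := Cpow_up (RtoC (1 / 2) + - nu) h x) in *.
set (z := ((x, h) : C)) in *; clearbody F F1 G G1 A B z.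
rewrite <- W.
transitivity ((A * B) * (F * ((RtoC (1 / 2) - nu) * / z * G + 2 * z * G1)
   - ((RtoC (1 / 2) + nu) * / z * F + 2 * z * F1) * G))%C; [ring |].
rewrite P; field; exact Hn.
Qed.

Lemma Rpower_pos (x y : R) : 0 < Rpower x y.
Proof. apply exp_pos. Qed.

(** On a bounded range the exponent may be lowered by at most 1 at the cost of a factor r; this
    replaces Re nu by the worst exponent -mu. *)
Lemma Rpower_le_scaled (x r a b : R) : 0 < x -> x <= r -> 1 <= r -> b <= a -> a <= b + 1 ->
  Rpower x a <= r * Rpower x b.
Proof.
intros Hx Hxr Hr Hba Hab.
replace a with ((a - b) + b) by ring; rewrite Rpower_plus.
apply Rmult_le_compat_r; [apply Rlt_le, Rpower_pos |].
apply Rle_trans with (Rpower r (a - b)).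
- apply Rle_Rpower_l; lra.
- rewrite <- (Rpower_1 r) at 2 by lra; apply Rle_Rpower; lra.
Qed.

(** The series are bounded on |z| <= r. The argument of z lies in (0,pi), so that |z^nu| exceeds
    |z|^(Re nu) by at most the factor exp (|Im nu| pi), whatever h. Both signs of nu receive the
    same exponent. *)
Lemma psi_bound (nu : C) (mu0 r : R) : Rabs (Re nu) <= mu0 -> mu0 <= 1 / 2 -> 1 <= r ->
  exists M, 0 < M /\ forall h x, 0 < h -> Cmod (x, h) <= r ->
    Cmod (psi nu h x) <= M * Rpower (Cmod (x, h)) (1 / 2 - mu0) /\
    Cmod (dpsi nu h x) <= M * Rpower (Cmod (x, h)) (- (1 / 2) - mu0).
Proof.
intros Hnu Hmu Hr.
assert (Hre : - mu0 <= Re nu <= mu0) by now apply Rabs_le_between.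
assert (Hp : - (1 / 2) <= Re nu) by lra.
destruct (Cpseries_bounded _ (r * r) (entire_coef_frob nu Hp)) as (M0 & HM0 & B0); [nra |].
destruct (Cpseries_bounded _ (r * r) (entire_coef_derive _ (entire_coef_frob nu Hp)))
  as (M1 & HM1 & B1); [nra |].
set (E := exp (Rabs (Im nu) * PI)).
assert (HE : 0 < E) by apply exp_pos.
set (D := Cmod (RtoC (1 / 2) + nu)%C).
assert (HD : 0 <= D) by apply Cmod_ge_0.
exists (r * E * M0 + r * E * (D * M0 + 2 * r * r * M1)).
assert (P1 : 0 < r * E * M0) by (apply Rmult_lt_0_compat; [apply Rmult_lt_0_compat |]; lra).
assert (P2 : 0 <= r * E * (D * M0 + 2 * r * r * M1)).
{ apply Rmult_le_pos; [nra |].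
  assert (0 <= D * M0) by nra; assert (0 <= r * r * M1) by nra; lra. }
split; [lra |]; intros h x Hh Hx.
assert (Hz := Cmod_up_pos h x Hh).
assert (Hzz : Cmod (((x, h) : C) * (x, h))%C <= r * r).
{ rewrite Cmod_mult; apply Rmult_le_compat; lra. }
specialize (B0 _ Hzz); specialize (B1 _ Hzz).
fold (frobF nu ((x, h) * (x, h))%C) in B0; fold (frobF' nu ((x, h) * (x, h))%C) in B1.
set (z := Cmod (x, h)) in *.
assert (Harg : exp (- (Im (RtoC (1 / 2) + nu)%C * snd (Clog_up h x))) <= E).
{ assert (Ht := arg_up_bounds h x).
  assert (Hi : Im (RtoC (1 / 2) + nu)%C = Im nu) by (unfold Im; simpl; ring).
  rewrite Hi; unfold E.
  assert (Hle : - (Im nu * snd (Clog_up h x)) <= Rabs (Im nu) * PI).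
  { eapply Rle_trans; [apply Rle_abs |]; rewrite Rabs_Ropp, Rabs_mult.
    apply Rmult_le_compat_l; [apply Rabs_pos | rewrite Rabs_pos_eq; lra]. }
  destruct Hle as [Hl | ->]; [left; now apply exp_increasing | right; reflexivity]. }
assert (Hre' : Re (RtoC (1 / 2) + nu)%C = 1 / 2 + Re nu) by (unfold Re; simpl; ring).
assert (HP : forall k, (k = 1 / 2 \/ k = - (1 / 2)) ->
  Rpower z (Re nu + k) <= r * Rpower z (k - mu0)).
{ intros k Hk; apply Rpower_le_scaled; lra. }
assert (Hpow : Cmod (Cpow_up (RtoC (1 / 2) + nu) h x) <= Rpower z (Re nu + 1 / 2) * E).
{ rewrite Cmod_Cpow_up, Hre', (Rplus_comm (1 / 2)).
  apply Rmult_le_compat_l; [apply Rlt_le, Rpower_pos | exact Harg]. }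
assert (Q1 := Rpower_pos z (1 / 2 - mu0)).
assert (Q2 := Rpower_pos z (- (1 / 2) - mu0)).
split.
- unfold psi; rewrite Cmod_mult.
  apply Rle_trans with (r * Rpower z (1 / 2 - mu0) * E * M0).
  + apply Rmult_le_compat; try apply Cmod_ge_0; [| exact B0].
    eapply Rle_trans; [exact Hpow |]; apply Rmult_le_compat_r; [lra |].
    apply HP; now left.
  + nra.
- unfold dpsi; rewrite Cmod_mult.
  assert (Hin : Cmod ((RtoC (1 / 2) + nu) * / (x, h) * frobF nu ((x, h) * (x, h))
    + 2 * (x, h) * frobF' nu ((x, h) * (x, h)))%C <= / z * (D * M0 + 2 * r * r * M1)).
  { eapply Rle_trans; [apply Cmod_triangle |].
    rewrite !Cmod_mult, Cmod_inv, Cmod_R, (Rabs_pos_eq 2) by (lra || now apply up_neq_0).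
    fold z; fold D.
    rewrite Rmult_plus_distr_l; apply Rplus_le_compat.
    - rewrite (Rmult_comm D), Rmult_assoc; apply Rmult_le_compat_l.
      + now apply Rlt_le, Rinv_0_lt_compat.
      + now apply Rmult_le_compat_l.
    - apply Rmult_le_reg_l with z; [exact Hz |].
      rewrite <- (Rmult_assoc z (/ z)), Rinv_r, Rmult_1_l by lra.
      apply Rle_trans with (2 * (r * r) * M1); [| lra].
      replace (z * (2 * z * Cmod (frobF' nu ((x, h) * (x, h)))))
        with (2 * (z * z) * Cmod (frobF' nu ((x, h) * (x, h)))) by ring.
      apply Rmult_le_compat; [nra | apply Cmod_ge_0 | nra | exact B1]. }
  apply Rle_trans with
    (Rpower z (Re nu + 1 / 2) * E * (/ z * (D * M0 + 2 * r * r * M1))).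
  + apply Rmult_le_compat; try apply Cmod_ge_0; assumption.
  + replace (Rpower z (Re nu + 1 / 2)) with (Rpower z (Re nu + - (1 / 2)) * z).
    2:{ rewrite <- (Rpower_1 z) at 2 by exact Hz; rewrite <- Rpower_plus; f_equal; lra. }
    replace (_ * z * E * (/ z * _)) with
      (Rpower z (Re nu + - (1 / 2)) * (E * (D * M0 + 2 * r * r * M1))) by (field; lra).
    apply Rle_trans with (r * Rpower z (- (1 / 2) - mu0) * (E * (D * M0 + 2 * r * r * M1))).
    * apply Rmult_le_compat_r; [| apply HP; now right].
      apply Rmult_le_pos; [lra |].
      assert (0 <= D * M0) by nra; assert (0 <= r * r * M1) by nra; lra.
    * nra.
Qed.

(** * Lower bound for the Wronskian *)

Lemma derive_ge0_le (f df : R -> R) (a b : R) : a <= b ->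
  (forall x, a <= x <= b -> is_derive f x (df x) /\ 0 <= df x) -> f a <= f b.
Proof.
intros Hab H.
destruct (MVT_gen f a b df) as (c & Hc & E).
- intros x; rewrite Rmin_left, Rmax_right by lra; intros Hx; apply H; lra.
- intros x; rewrite Rmin_left, Rmax_right by lra; intros Hx.
  apply continuity_pt_filterlim, (@ex_derive_continuous R_AbsRing R_NormedModule).
  exists (df x); now apply H.
- rewrite Rmin_left, Rmax_right in Hc by lra; destruct (H c Hc); nra.
Qed.

(** * The Frobenius series on the real axis *)

Lemma Cconj_RtoC (x : R) : Cconj x = x.
Proof. unfold Cconj, RtoC; simpl; f_equal; ring. Qed.

Lemma Cpseries_conj (a : nat -> C) (z : C) :
  Cconj (Cpseries a z) = Cpseries (fun n => Cconj (a n)) (Cconj z).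
Proof.
unfold Cpseries, Cseries.
rewrite (Series_ext (fun n => fst (Cconj (a n) * Cconj z ^ n)%C)
  (fun n => fst (a n * z ^ n)%C)).
2:{ intros n; rewrite <- Cpow_conj, <- Cmult_conj; reflexivity. }
rewrite (Series_ext (fun n => snd (Cconj (a n) * Cconj z ^ n)%C)
  (fun n => - snd (a n * z ^ n)%C)).
2:{ intros n; rewrite <- Cpow_conj, <- Cmult_conj; reflexivity. }
now rewrite Series_opp.
Qed.

Lemma frob_conj (nu : C) (k : nat) : - (1 / 2) <= Re nu ->
  Cconj (frob nu k) = frob (Cconj nu) k.
Proof.
intros Hnu; induction k as [| k IH]; [apply Cconj_RtoC |].
change (frob nu (S k)) with
    (frob nu k / (4 * RtoC (INR (S k)) * (RtoC (INR (S k)) + nu)))%C.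
rewrite Cdiv_conj by now apply frob_factor_neq0.
rewrite !Cmult_conj, Cplus_conj, !Cconj_RtoC, IH; reflexivity.
Qed.

Lemma frobF_conj (nu z : C) : - (1 / 2) <= Re nu ->
  Cconj (frobF nu z) = frobF (Cconj nu) (Cconj z).
Proof.
intros Hnu; unfold frobF; rewrite Cpseries_conj; unfold Cpseries.
apply Cseries_ext; intros n; now rewrite frob_conj.
Qed.

Lemma frobF'_conj (nu z : C) : - (1 / 2) <= Re nu ->
  Cconj (frobF' nu z) = frobF' (Cconj nu) (Cconj z).
Proof.
intros Hnu; unfold frobF'; rewrite Cpseries_conj; unfold Cpseries.
apply Cseries_ext; intros n; unfold coef_derive.
now rewrite Cmult_conj, Cconj_RtoC, frob_conj.
Qed.

Lemma Cconj_self (z : C) : Cconj z = z -> z = RtoC (fst z).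
Proof.
intros H; apply (f_equal snd) in H; simpl in H.
apply injective_projections; simpl; lra.
Qed.

Lemma frob_real (n : R) (k : nat) : - (1 / 2) <= n -> exists r, 0 < r /\ frob n k = RtoC r.
Proof.
intros Hn; induction k as [| k (r & Hr & IH)]; [exists 1; split; [lra | reflexivity] |].
assert (H1 : 0 < INR (S k)) by apply lt_0_INR, Nat.lt_0_succ.
assert (H2 : 0 < INR (S k) + n) by (pose proof (pos_INR k); rewrite S_INR in *; lra).
exists (r / (4 * INR (S k) * (INR (S k) + n))); split.
- apply Rdiv_lt_0_compat; [exact Hr |]; repeat apply Rmult_lt_0_compat; lra.
- change (frob n (S k)) with
    (frob n k / (4 * RtoC (INR (S k)) * (RtoC (INR (S k)) + RtoC n)))%C.
  rewrite IH, RtoC_div, !RtoC_mult, RtoC_plus; [reflexivity |].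
  apply Rgt_not_eq; repeat apply Rmult_lt_0_compat; lra.
Qed.

Lemma frobF_real (n x : R) : - (1 / 2) <= n -> frobF n x = RtoC (fst (frobF n x)).
Proof.
intros Hn; apply Cconj_self; rewrite frobF_conj by exact Hn.
now rewrite !Cconj_RtoC.
Qed.

Lemma frobF'_real (n x : R) : - (1 / 2) <= n -> frobF' n x = RtoC (fst (frobF' n x)).
Proof.
intros Hn; apply Cconj_self; rewrite frobF'_conj by exact Hn.
now rewrite !Cconj_RtoC.
Qed.

(** All coefficients are positive, and the two leading terms give the bound since 4 (1+n) <= 6. The
    linear growth makes n/(x F_n F_(-n)) integrable at infinity in the next lemma. *)
Lemma frobF_real_ge (n x : R) : - (1 / 2) <= n <= 1 / 2 -> 0 <= x ->
  1 + x / 6 <= fst (frobF n x).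
Proof.
intros Hn Hx.
change (1 + x / 6 <= Series (fun k => fst (frob n k * x ^ k)%C)).
assert (Hpos : forall k, 0 <= fst (frob n k * x ^ k)%C).
{ intros k; destruct (frob_real n k) as (r & Hr & E); [lra |].
  rewrite E, <- RtoC_pow, <- RtoC_mult; simpl.
  apply Rmult_le_pos; [lra | now apply pow_le]. }
assert (Hs : ex_series (fun k => fst (frob n k * x ^ k)%C)).
{ apply Cabs_summable_fst, entire_coef_summable, entire_coef_frob; simpl; lra. }
assert (Hs1 := proj1 (ex_series_incr_1 (K := R_AbsRing) (V := R_NormedModule) _) Hs).
assert (Hs2 := proj1 (ex_series_incr_1 (K := R_AbsRing) (V := R_NormedModule) _) Hs1).
rewrite Series_incr_1, Series_incr_1 by assumption.
assert (0 <= Series (fun k => fst (frob n (S (S k)) * x ^ (S (S k)))%C)).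
{ apply Series_ge_0; [intros k; apply Hpos | exact Hs2]. }
assert (E1 : fst (frob n 1 * x ^ 1)%C = x / (4 * (1 + n))).
{ replace (frob n 1 * x ^ 1)%C with (RtoC (x / (4 * (1 + n)))); [reflexivity |].
  rewrite RtoC_div, RtoC_mult, RtoC_plus by lra.
  change (frob n 1) with (1 / (4 * 1 * (1 + RtoC n)))%C.
  simpl; field; intros E; rewrite <- RtoC_plus in E; apply RtoC_inj in E; lra. }
cbv beta; rewrite E1; replace (fst (frob n 0 * x ^ 0)%C) with 1 by (simpl; ring).
assert (x / 6 <= x / (4 * (1 + n))).
{ apply Rmult_le_compat_l; [exact Hx |]; apply Rinv_le_contravar; lra. }
lra.
Qed.

(* [L = n ln x + ln F_n - ln F_(-n)] has [L' = n/(x F_n F_(-n))] by the Wronskian identity. *)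
Lemma frobF_ratio_bounded (n : R) : 0 < n < 1 / 2 ->
  exists B, 0 < B /\ forall x, 1 / 4 <= x ->
    Rpower x n * fst (frobF n x) <= B * fst (frobF (- n) x) /\
    fst (frobF (- n) x) <= B * (Rpower x n * fst (frobF n x)).
Proof.
intros Hn.
assert (EN : (- RtoC n)%C = RtoC (- n)) by (now rewrite RtoC_opp).
rewrite EN.
set (f := fun x : R => fst (frobF (RtoC n) x)).
set (g := fun x : R => fst (frobF (RtoC (- n)) x)).
set (f1 := fun x : R => fst (frobF' (RtoC n) x)).
set (g1 := fun x : R => fst (frobF' (RtoC (- n)) x)).
assert (Hline : forall k x : R, - (1 / 2) <= k ->
  is_derive (fun x : R => fst (frobF k x)) x (fst (frobF' k x))).
{ intros k x Hk; destruct (is_derive_RC_frobF_line k 1 x Hk) as [H _].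
  rewrite !Cmult_1_r in H; apply is_derive_ext with (2 := H).
  intros t; now rewrite Cmult_1_r. }
assert (Hf : forall x, is_derive f x (f1 x)) by (intros; apply Hline; lra).
assert (Hg : forall x, is_derive g x (g1 x)) by (intros; apply Hline; lra).
assert (Pf : forall x, 0 <= x -> 1 + x / 6 <= f x)
  by (intros; apply frobF_real_ge; lra).
assert (Pg : forall x, 0 <= x -> 1 + x / 6 <= g x)
  by (intros; apply frobF_real_ge; lra).
assert (W : forall x, n * f x * g x + x * (f1 x * g x - f x * g1 x) = n).
{ intros x; assert (H : Rabs (Re n) <= 1 / 2) by (simpl; rewrite Rabs_pos_eq; lra).
  pose proof (frobF_wronskian n x H) as E.
  rewrite EN in E.
  rewrite (frobF_real n), (frobF_real (- n)), (frobF'_real n), (frobF'_real (- n)) in E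
    by lra.
  rewrite <- !RtoC_mult, <- !RtoC_minus, <- !RtoC_mult, <- RtoC_plus in E.
  apply RtoC_inj in E; fold (f x) (g x) (f1 x) (g1 x) in E; lra. }
set (L := fun x => n * ln x + (ln (f x) - ln (g x))).
set (L1 := fun x => n / (x * f x * g x)).
assert (HL : forall x, 0 < x -> is_derive L x (L1 x)).
{ intros x Hx; assert (F0 := Pf x). assert (G0 := Pg x).
  eapply is_derive_eq.
  - apply (is_derive_plus (fun x => n * ln x) (fun x => ln (f x) - ln (g x))).
    + apply (is_derive_scal ln x n (/ x)), is_derive_ln, Hx.
    + apply (is_derive_minus (fun x => ln (f x)) (fun x => ln (g x))).
      * apply (is_derive_comp ln f); [apply is_derive_ln; lra | apply Hf].
      * apply (is_derive_comp ln g); [apply is_derive_ln; lra | apply Hg].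
  - unfold plus, minus, opp, scal; simpl; unfold mult; simpl; unfold L1, plus; simpl.
    specialize (W x).
    transitivity ((n * f x * g x + x * (f1 x * g x - f x * g1 x)) / (x * f x * g x)).
    + field; repeat split; lra.
    + now rewrite W. }
(* Here f g >= x / 6 and n < 1/2. *)
assert (HL1 : forall x, 0 < x -> 0 <= L1 x <= 3 / (x * x)).
{ intros x Hx; assert (F0 := Pf x). assert (G0 := Pg x).
  assert (Hfg : x / 6 <= f x * g x) by nra.
  assert (Hp : 0 < x * f x * g x) by (repeat apply Rmult_lt_0_compat; lra).
  split; [apply Rlt_le, Rdiv_lt_0_compat; lra |].
  unfold L1; apply Rle_div_l; [lra |].
  replace (3 / (x * x) * (x * f x * g x)) with (3 * (f x * g x) / x) by (field; lra).
  apply Rle_div_r; [lra |]; nra. }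
assert (Lo : forall x, 1 / 4 <= x -> L (1 / 4) <= L x).
{ intros x Hx; apply (derive_ge0_le L L1); [exact Hx |].
  intros y Hy; split; [apply HL; lra | apply HL1; lra]. }
(* 12 is the integral of 3 / x^2 from 1/4 to infinity; the integral is avoided by the monotonicity
   of - L x - 3 / x. *)
assert (Up : forall x, 1 / 4 <= x -> L x <= L (1 / 4) + 12).
{ intros x Hx.
  assert (H : - L (1 / 4) + (- 3) * / (1 / 4) <= - L x + (- 3) * / x).
  { apply (derive_ge0_le (fun x => - L x + (- 3) * / x)
      (fun x => - L1 x + (- 3) * (- / (x * x)))); [exact Hx |].
    intros y Hy; split; [| specialize (HL1 y); unfold Rdiv in HL1; lra].
    apply (is_derive_plus (fun x => - L x) (fun x => (- 3) * / x)).
    - apply (is_derive_opp L), HL; lra.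
    - auto_derive; [lra | field; lra]. }
  assert (0 < / x) by (apply Rinv_0_lt_compat; lra); lra. }
set (M := Rabs (L (1 / 4)) + 12); exists (exp M); split; [apply exp_pos |].
intros x Hx; assert (F0 := Pf x). assert (G0 := Pg x).
assert (HM : - M <= L x <= M).
{ specialize (Lo x Hx); specialize (Up x Hx); unfold M.
  pose proof (Rle_abs (L (1 / 4))); pose proof (Rle_abs (- L (1 / 4))).
  rewrite Rabs_Ropp in *; lra. }
fold (f x) (g x).
assert (E : Rpower x n * f x = exp (L x) * g x).
{ unfold L, Rpower; rewrite exp_plus; unfold Rminus; rewrite exp_plus, exp_Ropp.
  rewrite !exp_ln by lra; field; lra. }
assert (Hexp : forall a b, a <= b -> exp a <= exp b).
{ intros a b [H | ->]; [left; now apply exp_increasing | apply Rle_refl]. }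
rewrite E; split.
- apply Rmult_le_compat_r; [lra | apply Hexp; lra].
- rewrite <- Rmult_assoc, <- exp_plus, <- (Rmult_1_l (g x)) at 1.
  apply Rmult_le_compat_r; [lra |]; rewrite <- exp_0; apply Hexp; lra.
Qed.

(** Both z^2 and x^2 lie in the disc of radius (m+1)^2, at distance at most (2m+1) h. The Lipschitz
    constant on that disc is not controlled in m, whence the dependence of [h0] on m. *)
Lemma frobF_near_real (nu : C) (m d : R) : - (1 / 2) <= Re nu -> 1 <= m -> 0 < d ->
  exists h0, 0 < h0 <= 1 / 2 /\ forall h x, 0 < h < h0 -> Rabs x <= m ->
    Cmod (frobF nu ((x, h) * (x, h)) - frobF nu (RtoC (x * x)))%C <= d.
Proof.
intros Hnu Hm Hd.
destruct (Cpseries_lipschitz _ ((m + 1) * (m + 1)) (entire_coef_frob nu Hnu))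
  as (L & HL & H); [nra |].
exists (Rmin (1 / 2) (d / (L * (2 * m + 1)))).
assert (Hp : 0 < L * (2 * m + 1)) by nra.
split.
{ split; [| apply Rmin_l]; apply Rmin_pos; [lra |]; now apply Rdiv_lt_0_compat. }
intros h x Hh Hx.
assert (h1 : h < 1 / 2) by (pose proof (Rmin_l (1 / 2) (d / (L * (2 * m + 1)))); lra).
assert (h2 : h < d / (L * (2 * m + 1)))
  by (pose proof (Rmin_r (1 / 2) (d / (L * (2 * m + 1)))); lra).
apply Rlt_div_r in h2; [| exact Hp].
assert (Hx2 : x * x <= m * m).
{ rewrite <- (Rabs_pos_eq (x * x)) by nra; rewrite Rabs_mult; pose proof (Rabs_pos x); nra. }
assert (Hz : Cmod (x, h) <= m + 1).
{ replace ((x, h) : C) with (RtoC x + RtoC h * Ci)%C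
    by (apply injective_projections; simpl; ring).
  eapply Rle_trans; [apply Cmod_triangle |].
  rewrite Cmod_mult, !Cmod_R, Cmod_Ci, (Rabs_pos_eq h) by lra; lra. }
eapply Rle_trans.
- apply H.
  + rewrite Cmod_mult; pose proof (Cmod_ge_0 (x, h)); nra.
  + rewrite Cmod_R, Rabs_pos_eq; nra.
- assert (E : Cmod ((x, h) * (x, h) - RtoC (x * x))%C <= (2 * m + 1) * h).
  { replace ((x, h) * (x, h) - RtoC (x * x))%C
      with (RtoC (2 * x * h) * Ci + RtoC (- (h * h)))%C
      by (apply injective_projections; simpl; ring).
    eapply Rle_trans; [apply Cmod_triangle |].
    rewrite Cmod_mult, !Cmod_R, Cmod_Ci, Rabs_Ropp, !Rabs_mult.
    rewrite (Rabs_pos_eq h), (Rabs_pos_eq 2) by lra.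
    pose proof (Rabs_pos x); nra. }
  apply Rle_trans with (L * ((2 * m + 1) * h)); [apply Rmult_le_compat_l; lra | lra].
Qed.

(** For imaginary nu and real x the values for nu and -nu are conjugate and would vanish together,
    against [frobF_wronskian]. *)
Lemma frobF_imag_nonzero (tau x : R) : 0 < tau -> frobF (0, tau) x <> 0.
Proof.
intros Ht E.
assert (H : Rabs (Re (0, tau)) <= 1 / 2) by (simpl; rewrite Rabs_R0; lra).
pose proof (frobF_wronskian (0, tau) x H) as W.
assert (E' : frobF (- (0, tau))%C x = 0).
{ replace (- (0, tau))%C with (Cconj (0, tau))
    by (apply injective_projections; simpl; ring).
  rewrite <- (Cconj_RtoC x), <- frobF_conj by (simpl; lra).
  rewrite E; apply Cconj_RtoC. }
rewrite E, E' in W.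
apply (f_equal snd) in W; simpl in W; lra.
Qed.

Lemma Cmod_frobF_imag_opp (tau x : R) :
  Cmod (frobF (- (0, tau))%C x) = Cmod (frobF (0, tau) x).
Proof.
replace (- (0, tau))%C with (Cconj (0, tau))
  by (apply injective_projections; simpl; ring).
rewrite <- (Cconj_RtoC x) at 1; rewrite <- frobF_conj by (simpl; lra).
apply Cmod_conj.
Qed.

(** By compactness. The bound may depend on m: it only fixes how small h must be. *)
Lemma frobF_imag_lower (tau m : R) : 0 < tau -> 0 <= m ->
  exists g, 0 < g /\ forall x, 0 <= x <= m -> g <= Cmod (frobF (0, tau) x).
Proof.
intros Ht Hm.
destruct (continuity_ab_min (fun x : R => Cmod (frobF (0, tau) x)) 0 m Hm)
  as (x0 & Hmin & _).
{ intros c _; apply continuity_pt_filterlim.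
  apply (continuous_Cmod (fun x : R => frobF (0, tau) x)).
  apply is_derive_RC_continuous with (frobF' (0, tau) c).
  apply is_derive_RC_ext with (fun t : R => frobF (0, tau) (RtoC t * 1)%C).
  - intros t; now rewrite Cmult_1_r.
  - eapply is_derive_RC_eq; [apply is_derive_RC_frobF_line; simpl; lra |].
    now rewrite !Cmult_1_r. }
exists (Cmod (frobF (0, tau) x0)); split; [| exact Hmin].
apply Cmod_gt_0, frobF_imag_nonzero, Ht.
Qed.

(** The two points lie on opposite sides of the imaginary axis. One of a, b is at least 1/2 >= h, so
    that its point is off the vertical by an angle of at least pi/4. *)
Lemma arg_up_gap (h a b : R) : 0 < h <= 1 / 2 -> 0 <= a -> 0 <= b -> 1 <= a + b ->
  PI / 4 <= snd (Clog_up h (- a)) - snd (Clog_up h b).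
Proof.
intros Hh Ha Hb Hab; rewrite arg_up_opp.
assert (0 < PI) by apply PI_RGT_0.
assert (A1 := arg_up_ge0 h a (proj1 Hh) Ha). assert (B1 := arg_up_ge0 h b (proj1 Hh) Hb).
destruct (Rle_dec (1 / 2) b) as [Hc | Hc].
- assert (B2 := arg_up_ge h b (proj1 Hh)); lra.
- assert (A2 := arg_up_ge h a (proj1 Hh)); lra.
Qed.

(** At an end point p, the size of the coefficients in the basis [psi nu], [psi (- nu)] of the
    solution vanishing at p. *)
Definition psi_size (nu : C) (h x : R) : R := Cmod (psi nu h x) + Cmod (psi (- nu) h x).

Definition psi_det (nu : C) (h a b : R) : C :=
  (psi (- nu) h a * psi nu h b - psi nu h a * psi (- nu) h b)%C.

(** The order of the quantifiers is the point: [c] is chosen before m, [h0] after it. *)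
Definition psi_det_bounded_below (nu : C) : Prop :=
  exists c, 0 < c /\ forall m, 1 <= m -> exists h0, 0 < h0 <= 1 / 2 /\
    forall h a b, 0 < h < h0 -> 0 <= a -> 0 <= b -> a + b = m ->
      c * (psi_size nu h (- a) * psi_size nu h b) <= Cmod (psi_det nu h (- a) b).

(** Up to the error of replacing z^2 by x^2, both terms of the determinant have the modulus s(-a)
    s(b) g(-a) g(b) times exponentials of the arguments. By [arg_up_gap] these are at least q > 1 in
    one term and at most 1 in the other, so the terms cannot cancel. *)
Lemma psi_det_lower_imag (tau : R) : 0 < tau -> psi_det_bounded_below (0, tau).
Proof.
intros Ht.
set (q := exp (tau * (PI / 4))); set (E := exp (tau * PI)).
assert (HPI := PI_RGT_0).
assert (Hq : 1 < q).
{ unfold q; rewrite <- exp_0; apply exp_increasing; nra. }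
assert (HE : 1 < E).
{ unfold E; rewrite <- exp_0; apply exp_increasing; nra. }
assert (Hexp : forall a b, a <= b -> exp a <= exp b).
{ intros a b [H | ->]; [left; now apply exp_increasing | apply Rle_refl]. }
(* The relative error allowed on [frobF], small enough for q (1-d)^2 - (1+d)^2 >= (q-1)/2. *)
set (d := (q - 1) / (10 * q)).
assert (Hd : 0 < d) by (apply Rdiv_lt_0_compat; lra).
assert (Hdq : d * (10 * q) = q - 1) by (unfold d; field; lra).
assert (Hd1 : d < 1) by nra.
(* (q-1)/2 from the determinant, divided by (4 E)^2 from the two sizes. *)
exists ((q - 1) / (32 * (E * E))); split; [apply Rdiv_lt_0_compat; nra |].
intros m Hm.
destruct (frobF_imag_lower tau (m * m) Ht) as (g0 & Hg0 & Hmin); [nra |].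
(* An absolute error d g0 is a relative error d, because g0 bounds |F| from below on the range of
   x^2. *)
assert (Hdg : 0 < d * g0) by nra.
assert (Rp : - (1 / 2) <= Re (0, tau)) by (simpl; lra).
assert (Rm : - (1 / 2) <= Re (- (0, tau))%C) by (simpl; lra).
destruct (frobF_near_real (0, tau) m (d * g0) Rp Hm Hdg) as (h1 & Hh1 & N1).
destruct (frobF_near_real (- (0, tau))%C m (d * g0) Rm Hm Hdg) as (h2 & Hh2 & N2).
exists (Rmin h1 h2); split.
{ split; [apply Rmin_pos; lra | eapply Rle_trans; [apply Rmin_l | lra]]. }
intros h a b Hh Ha Hb Hab.
assert (hh1 : h < h1) by (pose proof (Rmin_l h1 h2); lra).
assert (hh2 : h < h2) by (pose proof (Rmin_r h1 h2); lra).
assert (Hgap := arg_up_gap h a b).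
set (g := fun x : R => Cmod (frobF (0, tau) (RtoC (x * x)))).
set (s := fun x => Rpower (Cmod (x, h)) (1 / 2)).
set (th := fun x => snd (Clog_up h x)).
assert (Hth : forall x, 0 < th x < PI) by (intros; apply arg_up_bounds).
assert (Hs : forall x, 0 < s x) by (intros; apply Rpower_pos).
assert (HF : forall x, Rabs x <= m ->
  0 < g x /\
  (1 - d) * g x <= Cmod (frobF (0, tau) ((x, h) * (x, h))%C) <= (1 + d) * g x /\
  (1 - d) * g x <= Cmod (frobF (- (0, tau))%C ((x, h) * (x, h))%C) <= (1 + d) * g x).
{ intros x Hx.
  assert (Hx2 : 0 <= x * x <= m * m).
  { split; [nra |]; rewrite <- (Rabs_pos_eq (x * x)) by nra.
    rewrite Rabs_mult; pose proof (Rabs_pos x); nra. }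
  specialize (Hmin _ Hx2); fold (g x) in Hmin.
  specialize (N1 h x (conj (proj1 Hh) hh1) Hx); specialize (N2 h x (conj (proj1 Hh) hh2) Hx).
  assert (Hdd : d * g0 <= d * g x) by (apply Rmult_le_compat_l; lra).
  assert (Tri : forall u v : C, Cmod u <= Cmod v + Cmod (u - v)%C /\
                                Cmod v <= Cmod u + Cmod (u - v)%C).
  { intros u v; split.
    - replace u with (v + (u - v))%C at 1 by ring; apply Cmod_triangle.
    - replace v with (u + - (u - v))%C at 1 by ring.
      rewrite <- (Cmod_opp (u - v)); apply Cmod_triangle. }
  destruct (Tri (frobF (0, tau) ((x, h) * (x, h))%C) (frobF (0, tau) (x * x)%R)) as [T1 T2].
  destruct (Tri (frobF (- (0, tau))%C ((x, h) * (x, h))%C)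
                (frobF (- (0, tau))%C (x * x)%R)) as [T3 T4].
  rewrite Cmod_frobF_imag_opp in T3, T4.
  fold (g x) in T1, T2, T3, T4; lra. }
assert (HPp : forall x, Cmod (Cpow_up (RtoC (1 / 2) + (0, tau)) h x)
                        = s x * exp (- (tau * th x))).
{ intros x; rewrite Cmod_Cpow_up; unfold Re, Im; simpl.
  now rewrite Rplus_0_r, Rplus_0_l. }
assert (HPm : forall x, Cmod (Cpow_up (RtoC (1 / 2) + - (0, tau)) h x)
                        = s x * exp (tau * th x)).
{ intros x; rewrite Cmod_Cpow_up; unfold Re, Im; simpl.
  rewrite Ropp_0, Rplus_0_r, Rplus_0_l; unfold s, th; simpl; f_equal; f_equal; ring. }
assert (Hsize : forall x, Rabs x <= m -> psi_size (0, tau) h x <= 4 * s x * E * g x).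
{ intros x Hx; destruct (HF x Hx) as (G0 & G1 & G2); unfold psi_size, psi.
  rewrite !Cmod_mult, HPp, HPm.
  assert (Htt : 0 <= tau * th x <= tau * PI)
    by (specialize (Hth x); split;
        [apply Rmult_le_pos; lra | apply Rmult_le_compat_l; lra]).
  assert (exp (- (tau * th x)) <= E) by (apply Hexp; lra).
  assert (exp (tau * th x) <= E) by (apply Hexp; lra).
  assert (K : forall e w, 0 < e <= E -> 0 <= w <= (1 + d) * g x ->
    s x * e * w <= 2 * s x * E * g x).
  { intros e w He Hw; specialize (Hs x).
    apply Rle_trans with (s x * E * ((1 + d) * g x)).
    - apply Rmult_le_compat; [apply Rmult_le_pos; lra | lra | apply Rmult_le_compat_l; lra | lra].
    - assert (P : 0 < s x * E * g x) by (repeat apply Rmult_lt_0_compat; lra).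
      assert (Q := Rmult_le_compat_r _ _ _ (Rlt_le _ _ P) (Rlt_le _ _ Hd1)); lra. }
  pose proof (exp_pos (- (tau * th x))). pose proof (exp_pos (tau * th x)).
  pose proof (K (exp (- (tau * th x))) (Cmod (frobF (0, tau) ((x, h) * (x, h))))) as K1.
  pose proof (K (exp (tau * th x)) (Cmod (frobF (- (0, tau)) ((x, h) * (x, h))))) as K2.
  pose proof (Cmod_ge_0 (frobF (0, tau) ((x, h) * (x, h)))).
  pose proof (Cmod_ge_0 (frobF (- (0, tau)) ((x, h) * (x, h)))).
  lra. }
assert (Ra : Rabs (- a) <= m) by (rewrite Rabs_Ropp, Rabs_pos_eq; lra).
assert (Rb : Rabs b <= m) by (rewrite Rabs_pos_eq; lra).
assert (Sa := Hsize _ Ra). assert (Sb := Hsize _ Rb).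
destruct (HF _ Ra) as (Ga & A1 & A2). destruct (HF _ Rb) as (Gb & B1 & B2).
assert (Hlow : s (- a) * s b * (g (- a) * g b) * ((q - 1) / 2)
               <= Cmod (psi_det (0, tau) h (- a) b)).
{ unfold psi_det.
  assert (Tri : forall u v : C, Cmod u - Cmod v <= Cmod (u - v)%C).
  { intros u v; enough (Cmod u <= Cmod (u - v)%C + Cmod v) by lra.
    replace u with ((u - v) + v)%C at 1 by ring; apply Cmod_triangle. }
  eapply Rle_trans; [| apply Tri].
  unfold psi; rewrite !Cmod_mult, !HPp, !HPm.
  set (Fpa := Cmod (frobF (0, tau) ((- a, h) * (- a, h)))) in *.
  set (Fma := Cmod (frobF (- (0, tau)) ((- a, h) * (- a, h)))) in *.
  set (Fpb := Cmod (frobF (0, tau) ((b, h) * (b, h)))) in *.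
  set (Fmb := Cmod (frobF (- (0, tau)) ((b, h) * (b, h)))) in *.
  assert (Hgap' : tau * (PI / 4) <= tau * (th (- a) - th b)).
  { apply Rmult_le_compat_l; [lra |]; apply (Hgap ltac:(lra) Ha Hb ltac:(lra)). }
  assert (0 < tau * (PI / 4)) by (apply Rmult_lt_0_compat; lra).
  assert (X : q <= exp (tau * th (- a)) * exp (- (tau * th b))).
  { rewrite <- exp_plus; apply Hexp; lra. }
  assert (Y : exp (- (tau * th (- a))) * exp (tau * th b) <= 1).
  { rewrite <- exp_plus, <- exp_0; apply Hexp; lra. }
  set (e1 := exp (tau * th (- a))) in *; set (e2 := exp (- (tau * th b))) in *.
  set (e3 := exp (- (tau * th (- a)))) in *; set (e4 := exp (tau * th b)) in *.
  assert (Ss : 0 < s (- a) * s b) by (apply Rmult_lt_0_compat; apply Hs).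
  replace (s (- a) * e1 * Fma * (s b * e2 * Fpb) - s (- a) * e3 * Fpa * (s b * e4 * Fmb))
    with (s (- a) * s b * ((e1 * e2) * (Fma * Fpb) - (e3 * e4) * (Fpa * Fmb))) by ring.
  rewrite Rmult_assoc; apply Rmult_le_compat_l; [lra |].
  assert (P : 0 < g (- a) * g b) by (apply Rmult_lt_0_compat; assumption).
  assert (P1 : (1 - d) * (1 - d) * (g (- a) * g b) <= Fma * Fpb).
  { replace ((1 - d) * (1 - d) * (g (- a) * g b))
      with (((1 - d) * g (- a)) * ((1 - d) * g b)) by ring.
    apply Rmult_le_compat; try lra; apply Rmult_le_pos; lra. }
  assert (P2 : Fpa * Fmb <= (1 + d) * (1 + d) * (g (- a) * g b)).
  { replace ((1 + d) * (1 + d) * (g (- a) * g b))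
      with (((1 + d) * g (- a)) * ((1 + d) * g b)) by ring.
    apply Rmult_le_compat; try lra; apply Cmod_ge_0. }
  assert (P3 : q * ((1 - d) * (1 - d) * (g (- a) * g b)) <= (e1 * e2) * (Fma * Fpb)).
  { apply Rmult_le_compat; try lra; repeat apply Rmult_le_pos; lra. }
  assert (P0 : 0 <= Fpa * Fmb) by (apply Rmult_le_pos; apply Cmod_ge_0).
  assert (P4 : (e3 * e4) * (Fpa * Fmb) <= 1 * (Fpa * Fmb))
    by (apply Rmult_le_compat_r; lra).
  assert (P5 : (q - 1) / 2 <= q * ((1 - d) * (1 - d)) - (1 + d) * (1 + d)).
  { assert (0 <= q * (d * d)) by (apply Rmult_le_pos; [lra | apply Rle_0_sqr]).
    assert (d * d <= d * 1) by (apply Rmult_le_compat_l; lra).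
    assert (d * 1 <= d * q) by (apply Rmult_le_compat_l; lra).
    lra. }
  assert (P6 := Rmult_le_compat_l (g (- a) * g b) _ _ (Rlt_le _ _ P) P5).
  lra. }
eapply Rle_trans; [| exact Hlow].
apply Rle_trans with ((q - 1) / (32 * (E * E)) *
  ((4 * s (- a) * E * g (- a)) * (4 * s b * E * g b))).
- apply Rmult_le_compat_l; [apply Rlt_le, Rdiv_lt_0_compat; [lra |]; repeat apply Rmult_lt_0_compat; lra |].
  apply Rmult_le_compat; try assumption; unfold psi_size;
  apply Rplus_le_le_0_compat; apply Cmod_ge_0.
- apply Req_le; field; lra.
Qed.

(** The determinant controls only the cross products of [psi nu] and [psi (- nu)], while the product
    of the sizes also contains the products of like terms. Comparability at one of the two ends is
    enough to absorb these. *)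
Lemma comparable_product (pa qa pb qb K : R) :
  0 <= pa -> 0 <= qa -> 0 <= pb -> 0 <= qb ->
  (pb <= K * qb /\ qb <= K * pb) \/ (pa <= K * qa /\ qa <= K * pa) ->
  (pa + qa) * (pb + qb) <= (1 + K) * (qa * pb + pa * qb).
Proof.
intros Ha Ha' Hb Hb' [[H1 H2] | [H1 H2]].
- pose proof (Rmult_le_compat_l pa _ _ Ha H1).
  pose proof (Rmult_le_compat_l qa _ _ Ha' H2); lra.
- pose proof (Rmult_le_compat_r pb _ _ Hb H1).
  pose proof (Rmult_le_compat_r qb _ _ Hb' H2); lra.
Qed.

(** Because v >= 1, an absolute error is also a relative one; for real nu the series are at least 1
    on the real axis, so no lower bound depending on m is needed. *)
Lemma Cmod_near (u : C) (v d : R) : 1 <= v -> Cmod (u - RtoC v)%C <= d ->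
  (1 - d) * v <= Cmod u <= (1 + d) * v.
Proof.
intros Hv H.
assert (Hd : 0 <= d) by (eapply Rle_trans; [apply Cmod_ge_0 | exact H]).
assert (Hdv : d * 1 <= d * v) by (apply Rmult_le_compat_l; lra).
assert (Ev : Cmod (RtoC v) = v) by (rewrite Cmod_R, Rabs_pos_eq; lra).
split.
- assert (T : Cmod (RtoC v) <= Cmod u + Cmod (u - RtoC v)%C).
  { replace (RtoC v) with (u + - (u - RtoC v))%C at 1 by ring.
    rewrite <- (Cmod_opp (u - RtoC v)%C); apply Cmod_triangle. }
  lra.
- assert (T : Cmod u <= Cmod (RtoC v) + Cmod (u - RtoC v)%C).
  { replace u with (RtoC v + (u - RtoC v))%C at 1 by ring; apply Cmod_triangle. }
  lra.
Qed.

Lemma Cmod_mult_near (u1 u2 : C) (v1 v2 d : R) : 1 <= v1 -> 1 <= v2 -> d <= 1 ->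
  Cmod (u1 - RtoC v1)%C <= d -> Cmod (u2 - RtoC v2)%C <= d ->
  Cmod (u1 * u2 - RtoC (v1 * v2))%C <= 3 * d * (v1 * v2).
Proof.
intros H1 H2 Hd U1 U2.
assert (Hd0 : 0 <= d) by (eapply Rle_trans; [apply Cmod_ge_0 | exact U1]).
destruct (Cmod_near u1 v1 d H1 U1) as [_ B1].
replace (u1 * u2 - RtoC (v1 * v2))%C
  with (u1 * (u2 - RtoC v2) + (u1 - RtoC v1) * RtoC v2)%C
  by (rewrite RtoC_mult; ring).
eapply Rle_trans; [apply Cmod_triangle |].
rewrite !Cmod_mult, Cmod_R, (Rabs_pos_eq v2) by lra.
assert (Cmod u1 * Cmod (u2 - RtoC v2)%C <= ((1 + d) * v1) * d)
  by (apply Rmult_le_compat; try apply Cmod_ge_0; assumption).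
assert (Cmod (u1 - RtoC v1)%C * v2 <= d * v2) by (apply Rmult_le_compat_r; lra).
assert (0 <= d * v1 * (1 - d)) by (repeat apply Rmult_le_pos; lra).
assert (0 <= d * v1 * (v2 - 1)) by (repeat apply Rmult_le_pos; lra).
assert (0 <= d * v2 * (v1 - 1)) by (repeat apply Rmult_le_pos; lra).
lra.
Qed.

(** The quotient of the two solutions is z^(2n) F_n / F_(-n), which [frobF_ratio_bounded] controls
    at x^2 away from 0 with a constant free of m. At h > 0 it is reached through the two closeness
    hypotheses. *)
Lemma psi_comparable_real (n : R) : 0 < n < 1 / 2 -> exists K, 0 < K /\
  forall h x, 0 < h <= 1 / 2 -> 1 / 2 <= Rabs x ->
  Cmod (frobF n ((x, h) * (x, h)) - frobF n (RtoC (x * x)))%C <= 1 / 2 ->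
  Cmod (frobF (- n) ((x, h) * (x, h)) - frobF (- n) (RtoC (x * x)))%C <= 1 / 2 ->
  Cmod (psi n h x) <= K * Cmod (psi (- n) h x) /\
  Cmod (psi (- n) h x) <= K * Cmod (psi n h x).
Proof.
intros Hn; destruct (frobF_ratio_bounded n Hn) as (B & HB & H).
(* Three factors 2: |z|^(2n) <= 2 |x|^(2n) since h <= |x|, and one for replacing each series by its
   real value. *)
exists (8 * B); split; [lra |]; intros h x Hh Hx N1 N2.
assert (EN : (- RtoC n)%C = RtoC (- n)) by (now rewrite RtoC_opp).
rewrite EN in *.
assert (Hxx : 1 / 4 <= x * x).
{ rewrite <- (Rabs_pos_eq (x * x)) by apply Rle_0_sqr; rewrite Rabs_mult.
  replace (1 / 4) with (1 / 2 * (1 / 2)) by lra; apply Rmult_le_compat; lra. }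
destruct (H (x * x) Hxx) as [H1 H2].
assert (F1 := frobF_real_ge n (x * x) ltac:(lra) ltac:(lra)).
assert (G1 := frobF_real_ge (- n) (x * x) ltac:(lra) ltac:(lra)).
rewrite (frobF_real n (x * x)) in N1 by lra.
rewrite (frobF_real (- n) (x * x)) in N2 by lra.
set (f := fst (frobF n (RtoC (x * x)))) in *.
set (g := fst (frobF (RtoC (- n)) (RtoC (x * x)))) in *.
destruct (Cmod_near _ f (1 / 2) ltac:(lra) N1) as [Fl Fu].
destruct (Cmod_near _ g (1 / 2) ltac:(lra) N2) as [Gl Gu].
unfold psi; rewrite !Cmod_mult.
set (F := Cmod (frobF n _)) in *; set (G := Cmod (frobF (RtoC (- n)) _)) in *.
assert (Hz := Cmod_up_pos h x ltac:(lra)).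
set (q := Rpower (Cmod (x, h) * Cmod (x, h)) n).
assert (EP : Cmod (Cpow_up (RtoC (1 / 2) + n) h x)
             = q * Cmod (Cpow_up (RtoC (1 / 2) + RtoC (- n)) h x)).
{ rewrite !Cmod_Cpow_up; unfold q, Re, Im; simpl.
  unfold Rpower; rewrite ln_mult by assumption.
  rewrite Rplus_0_r, Rmult_0_l, Ropp_0, exp_0, !Rmult_1_r, <- exp_plus.
  f_equal; lra. }
rewrite EP.
set (p := Cmod (Cpow_up (RtoC (1 / 2) + RtoC (- n)) h x)).
assert (Hp : 0 <= p) by apply Cmod_ge_0.
set (q0 := Rpower (x * x) n) in *.
assert (Hhx : h * h <= x * x).
{ apply Rle_trans with (1 / 2 * (1 / 2)); [apply Rmult_le_compat; lra | lra]. }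
assert (0 <= h * h) by apply Rle_0_sqr.
assert (Hq0 : 0 < q0) by apply Rpower_pos.
assert (Hq1 : q0 <= q).
{ unfold q0, q; rewrite Cmod_up_sqr; apply Rle_Rpower_l; lra. }
assert (Hq2 : q <= 2 * q0).
{ unfold q; rewrite Cmod_up_sqr.
  apply Rle_trans with (Rpower (2 * (x * x)) n); [apply Rle_Rpower_l; lra |].
  rewrite <- Rpower_mult_distr by lra; fold q0; apply Rmult_le_compat_r; [lra |].
  rewrite <- (Rpower_1 2) at 2 by lra; apply Rle_Rpower; lra. }
assert (P0 : 0 <= q0 * f) by (apply Rmult_le_pos; lra).
assert (P1 : 0 <= B * g) by (apply Rmult_le_pos; lra).
split.
- apply Rle_trans with (p * (8 * B * G)); [| lra].
  replace (q * p * F) with (p * (q * F)) by ring; apply Rmult_le_compat_l; [exact Hp |].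
  apply Rle_trans with (2 * q0 * (2 * f)); [apply Rmult_le_compat; lra |].
  assert (B * g <= B * (2 * G)) by (apply Rmult_le_compat_l; lra); lra.
- apply Rle_trans with (p * (8 * B * (q * F))); [| lra].
  apply Rmult_le_compat_l; [exact Hp |].
  assert (q0 * f <= q * (2 * F)) by (apply Rmult_le_compat; lra).
  assert (B * (q0 * f) <= B * (q * (2 * F))) by (apply Rmult_le_compat_l; lra).
  assert (0 <= B * (q * (2 * F))) by lra. lra.
Qed.

(** Up to a common factor the determinant is e^w X - e^(-w) Y, with X and Y close to positive reals
    X0 and Y0. The imaginary parts of e^w X0 and - e^(-w) Y0 have the same sign, and - Im w lies
    between n pi/4 and pi/2, so the terms add up instead of cancelling. *)
Lemma psi_det_lower_real (n : R) : 0 < n < 1 / 2 -> psi_det_bounded_below n.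
Proof.
intros Hn.
destruct (psi_comparable_real n Hn) as (K & HK & Hcomp).
assert (HPI := PI_RGT_0). assert (HPI4 := PI_4).
assert (HnPI : n * (PI / 4) < PI / 2).
{ apply Rle_lt_trans with (1 * (PI / 4)); [apply Rmult_le_compat_r; lra | lra]. }
assert (HnPI0 : 0 < n * (PI / 4)) by (apply Rmult_lt_0_compat; lra).
set (sg := sin (n * (PI / 4))).
assert (Hsg : 0 < sg) by (apply sin_gt_0; lra).
assert (Hsg1 : sg <= 1) by apply SIN_bound.
(* By [Cmod_mult_near] an error d on each series costs 3 d on the products, that is half of the main
   term [sg]. *)
set (d := sg / 6).
exists (sg / (4 * (1 + K))); split; [apply Rdiv_lt_0_compat; lra |].
intros m Hm.
assert (Hd : 0 < d) by (unfold d; lra).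
assert (EN : (- RtoC n)%C = RtoC (- n)) by (now rewrite RtoC_opp).
assert (Rp : - (1 / 2) <= Re n) by (simpl; lra).
assert (Rm : - (1 / 2) <= Re (- n)%C) by (rewrite EN; simpl; lra).
destruct (frobF_near_real n m d Rp Hm Hd) as (h1 & Hh1 & N1).
destruct (frobF_near_real (- n)%C m d Rm Hm Hd) as (h2 & Hh2 & N2).
exists (Rmin h1 h2); split.
{ split; [apply Rmin_pos; lra | eapply Rle_trans; [apply Rmin_l | lra]]. }
intros h a b Hh Ha Hb Hab.
assert (hh1 : 0 < h < h1) by (pose proof (Rmin_l h1 h2); lra).
assert (hh2 : 0 < h < h2) by (pose proof (Rmin_r h1 h2); lra).
assert (Hgap := arg_up_gap h a b ltac:(lra) Ha Hb ltac:(lra)).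
assert (Ra : Rabs (- a) <= m) by (rewrite Rabs_Ropp, Rabs_pos_eq; lra).
assert (Rb : Rabs b <= m) by (rewrite Rabs_pos_eq; lra).
assert (Pa := N1 h _ hh1 Ra). assert (Ma := N2 h _ hh2 Ra).
assert (Pb := N1 h _ hh1 Rb). assert (Mb := N2 h _ hh2 Rb).
assert (Hcmp : (Cmod (psi n h b) <= K * Cmod (psi (- n) h b) /\
                Cmod (psi (- n) h b) <= K * Cmod (psi n h b)) \/
               (Cmod (psi n h (- a)) <= K * Cmod (psi (- n) h (- a)) /\
                Cmod (psi (- n) h (- a)) <= K * Cmod (psi n h (- a)))).
(* As a + b = m >= 1, at least one end is at distance 1/2 or more from the singularity. *)
{ unfold d in *; destruct (Rle_dec (1 / 2) b) as [Hc | Hc]; [left | right];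
  apply Hcomp; try lra; [rewrite Rabs_pos_eq | rewrite Rabs_Ropp, Rabs_pos_eq]; lra. }
set (A := - a) in *.
assert (fA := frobF_real_ge n (A * A) ltac:(lra) (Rle_0_sqr A)).
assert (gA := frobF_real_ge (- n) (A * A) ltac:(lra) (Rle_0_sqr A)).
assert (fb := frobF_real_ge n (b * b) ltac:(lra) (Rle_0_sqr b)).
assert (gb := frobF_real_ge (- n) (b * b) ltac:(lra) (Rle_0_sqr b)).
assert (0 <= A * A) by apply Rle_0_sqr. assert (0 <= b * b) by apply Rle_0_sqr.
rewrite (frobF_real n) in Pa, Pb by lra.
rewrite EN, (frobF_real (- n)) in Ma, Mb by lra.
set (fA0 := fst (frobF n (RtoC (A * A)))) in *.
set (gA0 := fst (frobF (RtoC (- n)) (RtoC (A * A)))) in *.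
set (fb0 := fst (frobF n (RtoC (b * b)))) in *.
set (gb0 := fst (frobF (RtoC (- n)) (RtoC (b * b)))) in *.
set (X := (frobF (RtoC (- n)) ((A, h) * (A, h)) * frobF n ((b, h) * (b, h)))%C).
set (Y := (frobF n ((A, h) * (A, h)) * frobF (RtoC (- n)) ((b, h) * (b, h)))%C).
assert (HX : Cmod (X - RtoC (gA0 * fb0))%C <= 3 * d * (gA0 * fb0))
  by (apply Cmod_mult_near; unfold d in *; lra).
assert (HY : Cmod (Y - RtoC (fA0 * gb0))%C <= 3 * d * (fA0 * gb0))
  by (apply Cmod_mult_near; unfold d in *; lra).
set (X0 := gA0 * fb0) in *; set (Y0 := fA0 * gb0) in *.
assert (HX0 : 1 <= X0).
{ unfold X0; replace 1 with (1 * 1) by lra; apply Rmult_le_compat; lra. }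
assert (HY0 : 1 <= Y0).
{ unfold Y0; replace 1 with (1 * 1) by lra; apply Rmult_le_compat; lra. }
(* [U] collects the square roots of z at both ends; e^w is the n-th power of the quotient of the two
   points. *)
set (U := Cexp (RtoC (1 / 2) * (Clog_up h A + Clog_up h b))).
set (w := (RtoC n * (Clog_up h b - Clog_up h A))%C).
assert (E1 : (psi (- n) h A * psi n h b = U * (Cexp w * X))%C).
{ unfold psi, X, U, w, Cpow_up; rewrite EN, (Cmult_assoc (Cexp _) (Cexp _)), <- Cexp_plus.
  replace (RtoC (1 / 2) * (Clog_up h A + Clog_up h b)
           + RtoC n * (Clog_up h b - Clog_up h A))%C
    with ((RtoC (1 / 2) + RtoC (- n)) * Clog_up h A + (RtoC (1 / 2) + RtoC n) * Clog_up h b)%C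
    by (rewrite RtoC_opp; ring).
  rewrite Cexp_plus; ring. }
assert (E2 : (psi n h A * psi (- n) h b = U * (Cexp (- w) * Y))%C).
{ unfold psi, Y, U, w, Cpow_up; rewrite EN, (Cmult_assoc (Cexp _) (Cexp _)), <- Cexp_plus.
  replace (RtoC (1 / 2) * (Clog_up h A + Clog_up h b)
           + - (RtoC n * (Clog_up h b - Clog_up h A)))%C
    with ((RtoC (1 / 2) + RtoC n) * Clog_up h A + (RtoC (1 / 2) + RtoC (- n)) * Clog_up h b)%C
    by (rewrite RtoC_opp; ring).
  rewrite Cexp_plus; ring. }
set (e1 := exp (fst w)); set (e2 := exp (- fst w)).
assert (He1 : 0 < e1) by apply exp_pos. assert (He2 : 0 < e2) by apply exp_pos.
assert (M1 : Cmod (Cexp w) = e1) by apply Cmod_Cexp.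
assert (M2 : Cmod (Cexp (- w)%C) = e2) by apply Cmod_Cexp.
assert (HT : 0 < X0 * e1 + Y0 * e2)
  by (apply Rplus_lt_0_compat; apply Rmult_lt_0_compat; lra).
set (T := X0 * e1 + Y0 * e2) in *.
assert (Hsin : sg <= sin (- snd w)).
{ unfold sg; assert (Ew : - snd w = n * (snd (Clog_up h A) - snd (Clog_up h b)))
    by (unfold w, Cminus; cbn -[Clog_up]; ring).
  rewrite Ew.
  assert (A1 := arg_up_bounds h A). assert (A2 := arg_up_bounds h b).
  assert (n * (PI / 4) <= n * (snd (Clog_up h A) - snd (Clog_up h b)))
    by (apply Rmult_le_compat_l; lra).
  assert (n * (snd (Clog_up h A) - snd (Clog_up h b)) <= 1 / 2 * PI)
    by (apply Rmult_le_compat; lra).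
  apply sin_incr_1; lra. }
(* The imaginary part of the right-hand side is exactly T sin (Im w). *)
assert (Hmain : sg * T <= Cmod (Cexp w * RtoC X0 - Cexp (- w) * RtoC Y0)%C).
{ eapply Rle_trans; [| apply Rabs_snd_le_Cmod].
  replace (snd (Cexp w * RtoC X0 - Cexp (- w) * RtoC Y0)%C)
    with (- (T * sin (- snd w))).
  - rewrite Rabs_Ropp; eapply Rle_trans; [| apply Rle_abs].
    rewrite Rmult_comm; apply Rmult_le_compat_l; lra.
  - unfold T, e1, e2; simpl; rewrite sin_neg; ring. }
assert (Hlow : sg / 2 * T <= Cmod (Cexp w * X - Cexp (- w) * Y)%C).
{ assert (Tri : Cmod (Cexp w * RtoC X0 - Cexp (- w) * RtoC Y0)%C
    <= Cmod (Cexp w * X - Cexp (- w) * Y)%C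
       + (Cmod (Cexp w * (X - RtoC X0))%C + Cmod (Cexp (- w) * (Y - RtoC Y0))%C)).
  { replace (Cexp w * RtoC X0 - Cexp (- w) * RtoC Y0)%C
      with ((Cexp w * X - Cexp (- w) * Y)
        + (- (Cexp w * (X - RtoC X0)) + Cexp (- w) * (Y - RtoC Y0)))%C by ring.
    eapply Rle_trans; [apply Cmod_triangle |]; apply Rplus_le_compat_l.
    eapply Rle_trans; [apply Cmod_triangle |]; rewrite Cmod_opp; lra. }
  rewrite (Cmod_mult (Cexp w) (X - RtoC X0)), (Cmod_mult (Cexp (- w)) (Y - RtoC Y0)) in Tri.
  rewrite M1, M2 in Tri.
  assert (e1 * Cmod (X - RtoC X0)%C <= e1 * (3 * d * X0)) by (apply Rmult_le_compat_l; lra).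
  assert (e2 * Cmod (Y - RtoC Y0)%C <= e2 * (3 * d * Y0)) by (apply Rmult_le_compat_l; lra).
  assert (Ed : e1 * (3 * d * X0) + e2 * (3 * d * Y0) = sg / 2 * T) by (unfold d, T; field).
  lra. }
assert (Hup : Cmod (psi (- n) h A) * Cmod (psi n h b)
              + Cmod (psi n h A) * Cmod (psi (- n) h b) <= 2 * (Cmod U * T)).
{ rewrite <- !Cmod_mult, E1, E2, !Cmod_mult, M1, M2.
  assert (BX : Cmod X <= 2 * X0).
  { replace X with (RtoC X0 + (X - RtoC X0))%C by ring.
    eapply Rle_trans; [apply Cmod_triangle |].
    rewrite Cmod_R, Rabs_pos_eq by lra.
    assert (3 * d * X0 <= 1 * X0) by (apply Rmult_le_compat_r; unfold d; lra); lra. }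
  assert (BY : Cmod Y <= 2 * Y0).
  { replace Y with (RtoC Y0 + (Y - RtoC Y0))%C by ring.
    eapply Rle_trans; [apply Cmod_triangle |].
    rewrite Cmod_R, Rabs_pos_eq by lra.
    assert (3 * d * Y0 <= 1 * Y0) by (apply Rmult_le_compat_r; unfold d; lra); lra. }
  rewrite <- Rmult_plus_distr_l, <- Rmult_assoc, (Rmult_comm 2), Rmult_assoc.
  apply Rmult_le_compat_l; [apply Cmod_ge_0 |].
  assert (e1 * Cmod X <= e1 * (2 * X0)) by (apply Rmult_le_compat_l; lra).
  assert (e2 * Cmod Y <= e2 * (2 * Y0)) by (apply Rmult_le_compat_l; lra).
  unfold T; lra. }
assert (Hdet : Cmod (psi_det n h A b) = Cmod U * Cmod (Cexp w * X - Cexp (- w) * Y)%C).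
{ unfold psi_det; rewrite E1, E2, <- Cmod_mult; f_equal; ring. }
rewrite Hdet; unfold psi_size.
assert (Hprod := comparable_product _ _ _ _ K (Cmod_ge_0 (psi n h A)) (Cmod_ge_0 (psi (- n) h A))
  (Cmod_ge_0 (psi n h b)) (Cmod_ge_0 (psi (- n) h b)) Hcmp).
set (Sz := (Cmod (psi n h A) + Cmod (psi (- n) h A))
  * (Cmod (psi n h b) + Cmod (psi (- n) h b))) in *.
set (Q := Cmod (psi (- n) h A) * Cmod (psi n h b)
  + Cmod (psi n h A) * Cmod (psi (- n) h b)) in *.
apply Rle_trans with (sg / (4 * (1 + K)) * ((1 + K) * (2 * (Cmod U * T)))).
- apply Rmult_le_compat_l; [apply Rlt_le, Rdiv_lt_0_compat; lra |].
  eapply Rle_trans; [exact Hprod |]; apply Rmult_le_compat_l; lra.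
- apply Rle_trans with (Cmod U * (sg / 2 * T)); [apply Req_le; field; lra |].
  apply Rmult_le_compat_l; [apply Cmod_ge_0 | exact Hlow].
Qed.

(** * Energy estimate and L2 bounds *)

Lemma continuous_Cmod_sqr (f : R -> C) (x : R) :
  continuous f x -> continuous (fun t => Cmod (f t) ^ 2) x.
Proof.
intros H; apply continuous_Cmod in H.
apply continuous_ext with (fun t => Cmod (f t) * Cmod (f t)); [intros; simpl; ring |].
exact (continuous_mult (K := R_AbsRing) _ _ x H H).
Qed.

Lemma ex_RInt_Cmod_sqr (f : R -> C) (a b : R) :
  (forall x, continuous f x) -> ex_RInt (fun t => Cmod (f t) ^ 2) a b.
Proof.
intros H; apply (ex_RInt_continuous (V := R_CompleteNormedModule)).
intros x _; now apply continuous_Cmod_sqr.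
Qed.

(* Multiply the equation by the conjugate of the solution: the real part of
   [conj phi * phi'] increases at rate at least [|phi|^2 / 2]. *)
Lemma energy_estimate (phi dphi q : R -> C) (s t : R) : s <= t ->
  (forall x, is_derive_RC phi x (dphi x)) ->
  (forall x, is_derive_RC dphi x (q x * phi x)%C) ->
  (forall x, s <= x <= t -> 1 / 2 <= Re (q x)) ->
  RInt (fun x => Cmod (phi x) ^ 2) s t
  <= 2 * (Re (Cconj (phi t) * dphi t)%C - Re (Cconj (phi s) * dphi s)%C).
Proof.
intros Hst H1 H2 Hq.
assert (Hc : forall x, continuous phi x)
  by (intros x; apply (is_derive_RC_continuous phi x _ (H1 x))).
set (f := fun x => Cmod (phi x) ^ 2).
set (N := fun x => Re (Cconj (phi x) * dphi x)%C).
set (dN := fun x => Re (Cconj (dphi x) * dphi x + Cconj (phi x) * (q x * phi x))%C).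
assert (HN : forall x, is_derive N x (dN x)).
{ intros x.
  exact (proj1 (is_derive_RC_mult _ _ _ _ _ (is_derive_RC_conj _ _ _ (H1 x)) (H2 x))). }
assert (Hle : 2 * N s - RInt f s s <= 2 * N t - RInt f s t).
{ apply (derive_ge0_le (fun x => 2 * N x - RInt f s x) (fun x => 2 * dN x - f x) s t Hst).
  intros x Hx; split.
  - apply (is_derive_minus (fun x => 2 * N x) (fun x => RInt f s x)).
    + apply (is_derive_scal N x 2 (dN x)), HN.
    + apply (is_derive_RInt f (fun x => RInt f s x) s).
      * apply filter_forall; intros u; apply (RInt_correct (V := R_CompleteNormedModule)).
        now apply ex_RInt_Cmod_sqr.
      * now apply continuous_Cmod_sqr.
  - assert (E : dN x = Cmod (dphi x) ^ 2 + Re (q x) * Cmod (phi x) ^ 2).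
    { rewrite !Cmod2_alt; unfold dN, Re, Im; simpl; ring. }
    rewrite E; unfold f; specialize (Hq x Hx).
    assert (0 <= Cmod (dphi x) ^ 2) by apply pow2_ge_0.
    assert (0 <= (Re (q x) - 1 / 2) * Cmod (phi x) ^ 2)
      by (apply Rmult_le_pos; [lra | apply pow2_ge_0]).
    lra. }
rewrite RInt_point in Hle; unfold zero in Hle; simpl in Hle.
unfold f, N in *; lra.
Qed.

Lemma RInt_Cmod_sqr_le (f : R -> C) (s t B : R) : s <= t ->
  (forall x, continuous f x) ->
  (forall x, s <= x <= t -> Cmod (f x) <= B) ->
  RInt (fun x => Cmod (f x) ^ 2) s t <= (t - s) * B ^ 2.
Proof.
intros Hst Hc HB.
replace ((t - s) * B ^ 2) with (RInt (fun _ => B ^ 2) s t)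
  by (rewrite RInt_const; reflexivity).
apply RInt_le; [exact Hst | now apply ex_RInt_Cmod_sqr | apply ex_RInt_const |].
intros x Hx; apply pow_incr; split; [apply Cmod_ge_0 | apply HB; lra].
Qed.

Definition sol (nu : C) (h p x : R) : C :=
  (psi nu h p * psi (- nu) h x - psi (- nu) h p * psi nu h x)%C.

Definition dsol (nu : C) (h p x : R) : C :=
  (psi nu h p * dpsi (- nu) h x - psi (- nu) h p * dpsi nu h x)%C.

Lemma sol_self (nu : C) (h p : R) : sol nu h p p = 0.
Proof. unfold sol; ring. Qed.

Lemma Re_opp_bound (nu : C) (r : R) : Rabs (Re nu) <= r -> Rabs (Re (- nu)%C) <= r.
Proof. intros H; unfold Re in *; simpl; now rewrite Rabs_Ropp. Qed.

Lemma Re_lower_bound (nu : C) : Rabs (Re nu) <= 1 / 2 -> - (1 / 2) <= Re nu.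
Proof. intros H; apply Rabs_le_between in H; lra. Qed.

Lemma is_derive_RC_sol (nu : C) (h p x : R) : 0 < h -> Rabs (Re nu) <= 1 / 2 ->
  is_derive_RC (sol nu h p) x (dsol nu h p x).
Proof.
intros Hh Hnu; pose proof (Re_lower_bound _ Hnu).
pose proof (Re_lower_bound _ (Re_opp_bound _ _ Hnu)).
apply is_derive_RC_minus; apply is_derive_RC_scal; now apply is_derive_RC_psi.
Qed.

Lemma is_derive_RC_dsol (nu : C) (h p x : R) : 0 < h -> Rabs (Re nu) <= 1 / 2 ->
  is_derive_RC (dsol nu h p) x (bessel_pot nu h x * sol nu h p x)%C.
Proof.
intros Hh Hnu; pose proof (Re_lower_bound _ Hnu).
pose proof (Re_lower_bound _ (Re_opp_bound _ _ Hnu)).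
eapply is_derive_RC_eq.
- apply is_derive_RC_minus; apply is_derive_RC_scal; now apply is_derive_RC_dpsi.
- unfold sol, bessel_pot; replace (- nu * - nu)%C with (nu * nu)%C by ring; ring.
Qed.

(** The determinant of the coefficients times the Wronskian of the basis, hence constant in x. *)
Lemma sol_wronskian (nu : C) (h p p' x : R) : 0 < h -> Rabs (Re nu) <= 1 / 2 ->
  (sol nu h p x * dsol nu h p' x - dsol nu h p x * sol nu h p' x
   = 2 * nu * psi_det nu h p p')%C.
Proof.
intros Hh Hnu; pose proof (psi_wronskian nu h x Hh Hnu) as W.
unfold sol, dsol, psi_det.
transitivity ((psi nu h x * dpsi (- nu) h x - dpsi nu h x * psi (- nu) h x)
  * (psi nu h p * psi (- nu) h p' - psi (- nu) h p * psi nu h p'))%C; [ring |].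
rewrite W; ring.
Qed.

Lemma psi_size_pos (nu : C) (h x : R) : 0 < h -> Rabs (Re nu) <= 1 / 2 -> nu <> 0 ->
  0 < psi_size nu h x.
Proof.
intros Hh Hnu Hn; unfold psi_size.
pose proof (Cmod_ge_0 (psi nu h x)). pose proof (Cmod_ge_0 (psi (- nu) h x)).
destruct (Rle_lt_or_eq_dec 0 _ (Rplus_le_le_0_compat _ _ H H0)) as [L | E]; [exact L |].
exfalso; assert (E1 : psi nu h x = 0) by (apply Cmod_eq_0; lra).
assert (E2 : psi (- nu) h x = 0) by (apply Cmod_eq_0; lra).
pose proof (psi_wronskian nu h x Hh Hnu) as W; rewrite E1, E2 in W.
apply Hn; transitivity (- (/ 2) * - (2 * nu))%C.
- field; intros E3; apply (f_equal fst) in E3; simpl in E3; lra.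
- rewrite <- W; ring.
Qed.

(** The point p is unrestricted: its size stays as a factor, to be cancelled against the
    Wronskian. *)
Lemma sol_bound (nu : C) (mu0 r : R) : Rabs (Re nu) <= mu0 -> mu0 <= 1 / 2 -> 1 <= r ->
  exists M, 0 < M /\ forall h p x, 0 < h -> Cmod (x, h) <= r ->
    Cmod (sol nu h p x) <= M * psi_size nu h p * Rpower (Cmod (x, h)) (1 / 2 - mu0) /\
    Cmod (dsol nu h p x) <= M * psi_size nu h p * Rpower (Cmod (x, h)) (- (1 / 2) - mu0).
Proof.
intros Hnu Hmu Hr.
destruct (psi_bound nu mu0 r Hnu Hmu Hr) as (M1 & HM1 & B1).
destruct (psi_bound (- nu) mu0 r (Re_opp_bound _ _ Hnu) Hmu Hr) as (M2 & HM2 & B2).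
exists (M1 + M2); split; [lra |]; intros h p x Hh Hx.
destruct (B1 h x Hh Hx) as [B11 B12]; destruct (B2 h x Hh Hx) as [B21 B22].
assert (K : forall (u v : C) P, 0 <= P -> Cmod u <= M1 * P -> Cmod v <= M2 * P ->
  Cmod (psi nu h p * v - psi (- nu) h p * u)%C <= (M1 + M2) * psi_size nu h p * P).
{ intros u v P HP Hu Hv; unfold Cminus.
  eapply Rle_trans; [apply Cmod_triangle |]; rewrite Cmod_opp, !Cmod_mult.
  pose proof (Cmod_ge_0 (psi nu h p)) as P1. pose proof (Cmod_ge_0 (psi (- nu) h p)) as P2.
  unfold psi_size.
  pose proof (Rmult_le_compat_l _ _ _ P1 Hv). pose proof (Rmult_le_compat_l _ _ _ P2 Hu).
  assert (0 <= Cmod (psi nu h p) * (M1 * P))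
    by (apply Rmult_le_pos; [exact P1 | apply Rmult_le_pos; lra]).
  assert (0 <= Cmod (psi (- nu) h p) * (M2 * P))
    by (apply Rmult_le_pos; [exact P2 | apply Rmult_le_pos; lra]).
  lra. }
split; apply K; try assumption; apply Rlt_le, Rpower_pos.
Qed.

Lemma bessel_pot_far (nu : C) (beta h x : R) : 0 < h -> 0 < beta ->
  (nu * nu = RtoC (1 / 4 - beta ^ 2))%C -> 3 * beta <= Rabs x ->
  1 / 2 <= Re (bessel_pot nu h x).
Proof.
intros Hh Hb Hnu Hx; unfold bessel_pot; rewrite Hnu, <- RtoC_minus.
replace (1 / 4 - (1 / 4 - beta ^ 2)) with (beta ^ 2) by ring.
assert (Hz := up_neq_0 h x Hh). assert (Hzp := Cmod_up_pos h x Hh).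
assert (H : Cmod (RtoC (beta ^ 2) / ((x, h) * (x, h)))%C <= 1 / 2).
{ rewrite Cmod_div, Cmod_mult, Cmod_R, Cmod_up_sqr
    by (intros E; apply Cmod_gt_0 in Hzp; apply Hz; apply Cmod_eq_0;
        apply (f_equal Cmod) in E; rewrite Cmod_mult, Cmod_0 in E; nra).
  rewrite Rabs_pos_eq by apply pow2_ge_0.
  assert (Hx2 : 3 * beta * (3 * beta) <= x * x).
  { rewrite <- (Rabs_pos_eq (x * x)) by apply Rle_0_sqr; rewrite Rabs_mult.
    apply Rmult_le_compat; lra. }
  assert (0 < beta * beta) by (apply Rmult_lt_0_compat; lra).
  assert (0 < h * h) by (apply Rmult_lt_0_compat; lra).
  apply Rle_div_l; [lra |]; simpl; lra. }
set (u := (RtoC (beta ^ 2) / ((x, h) * (x, h)))%C) in *.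
pose proof (re_le_Cmod u) as Hr; pose proof (Rle_abs (Re u)).
change (1 / 2 <= 1 - fst u); unfold Re in *; lra.
Qed.

Lemma Re_conj_mult_le (u v : C) : Rabs (Re (Cconj u * v)%C) <= Cmod u * Cmod v.
Proof. rewrite <- (Cmod_conj u), <- Cmod_mult; apply re_le_Cmod. Qed.

Lemma sol_L2_bound (nu : C) (beta mu0 : R) : 0 < beta ->
  (nu * nu = RtoC (1 / 4 - beta ^ 2))%C -> Rabs (Re nu) <= mu0 -> 0 <= mu0 <= 1 / 2 ->
  exists K, 0 < K /\ forall h p y, 0 < h <= 1 / 2 -> Rabs y <= 3 * beta ->
    (y <= p -> RInt (fun t => Cmod (sol nu h p t) ^ 2) y p <= K * psi_size nu h p ^ 2) /\
    (p <= y -> RInt (fun t => Cmod (sol nu h p t) ^ 2) p y <= K * psi_size nu h p ^ 2).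
Proof.
intros Hb Hnu Hre Hmu.
assert (Hre' : Rabs (Re nu) <= 1 / 2) by lra.
set (r := 3 * beta + 1).
destruct (sol_bound nu mu0 r Hre (proj2 Hmu)) as (M & HM & HB); [unfold r; lra |].
(* Bounds the power in the estimate of the derivative at |x| = 3 beta: there |z| >= 3 beta and the
   exponent is negative. *)
set (D := Rpower (3 * beta) (- (1 / 2) - mu0)).
assert (HD : 0 < D) by apply Rpower_pos.
assert (Hr : 1 <= r) by (unfold r; lra).
assert (HMr : 0 < M * r) by (apply Rmult_lt_0_compat; lra).
(* The supremum squared over the inner interval, of length at most 6 beta, plus twice the boundary
   term of the energy estimate at distance 3 beta. The boundary term at p is 0. *)
set (K := 6 * beta * (M * r) ^ 2 + 2 * (M * r * (M * D))).
assert (HK1 : 0 < 6 * beta * (M * r) ^ 2)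
  by (apply Rmult_lt_0_compat; [lra | apply pow_lt; exact HMr]).
assert (HK2 : 0 < M * r * (M * D)) by (repeat apply Rmult_lt_0_compat; lra).
exists K; split; [unfold K; lra |].
intros h p y Hh Hy; set (S := psi_size nu h p).
assert (HS : 0 <= S) by (apply Rplus_le_le_0_compat; apply Cmod_ge_0).
assert (Hh0 : 0 < h) by lra.
assert (Hz : forall x, Rabs x <= 3 * beta -> Cmod (x, h) <= r).
{ intros x Hx; replace ((x, h) : C) with (RtoC x + RtoC h * Ci)%C
    by (apply injective_projections; simpl; ring).
  eapply Rle_trans; [apply Cmod_triangle |].
  rewrite Cmod_mult, !Cmod_R, Cmod_Ci, (Rabs_pos_eq h) by lra; unfold r; lra. }
assert (Hin : forall x, Rabs x <= 3 * beta -> Cmod (sol nu h p x) <= M * r * S).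
{ intros x Hx; destruct (HB h p x Hh0 (Hz x Hx)) as [H _].
  eapply Rle_trans; [exact H |]; fold S.
  assert (Rpower (Cmod (x, h)) (1 / 2 - mu0) <= r).
  { eapply Rle_trans; [apply (Rpower_le_scaled _ r _ 0) |]; try lra.
    - now apply Cmod_up_pos.
    - now apply Hz.
    - rewrite Rpower_O by (now apply Cmod_up_pos); lra. }
  replace (M * r * S) with (M * S * r) by ring.
  apply Rmult_le_compat_l; [apply Rmult_le_pos; lra | assumption]. }
assert (Hd : forall x, Rabs x = 3 * beta -> Cmod (dsol nu h p x) <= M * D * S).
{ intros x Hx; destruct (HB h p x Hh0 (Hz x (Req_le _ _ Hx))) as [_ H].
  eapply Rle_trans; [exact H |]; fold S.
  replace (M * D * S) with (M * S * D) by ring.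
  apply Rmult_le_compat_l; [apply Rmult_le_pos; lra |].
  unfold D; replace (- (1 / 2) - mu0) with (- (1 / 2 + mu0)) by ring.
  rewrite !Rpower_Ropp; apply Rinv_le_contravar; [apply Rpower_pos |].
  apply Rle_Rpower_l; [lra |]; split; [lra |].
  rewrite <- Hx; apply (re_le_Cmod (x, h)). }
assert (Hc : forall x, continuous (sol nu h p) x).
{ intros x; eapply is_derive_RC_continuous; now apply is_derive_RC_sol. }
assert (Hnear : forall s t, s <= t -> - (3 * beta) <= s -> t <= 3 * beta ->
  RInt (fun t => Cmod (sol nu h p t) ^ 2) s t <= 6 * beta * (M * r) ^ 2 * S ^ 2).
{ intros s t Hst Hs Ht.
  eapply Rle_trans; [apply (RInt_Cmod_sqr_le _ s t (M * r * S) Hst Hc) |].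
  - intros x Hx; apply Hin, Rabs_le; lra.
  - rewrite Rpow_mult_distr, <- Rmult_assoc; apply Rmult_le_compat_r; [apply pow2_ge_0 |].
    apply Rmult_le_compat_r; [apply pow2_ge_0 | lra]. }
assert (Hbd : forall x, Rabs x = 3 * beta ->
  Rabs (Re (Cconj (sol nu h p x) * dsol nu h p x)%C) <= M * r * (M * D) * S ^ 2).
{ intros x Hx; eapply Rle_trans; [apply Re_conj_mult_le |].
  replace (M * r * (M * D) * S ^ 2) with (M * r * S * (M * D * S)) by ring.
  apply Rmult_le_compat; try apply Cmod_ge_0; [apply Hin; lra | now apply Hd]. }
assert (Hp0 : Re (Cconj (sol nu h p p) * dsol nu h p p)%C = 0)
  by (rewrite sol_self, Cconj_RtoC, Cmult_0_l; reflexivity).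
assert (HS2 : 0 <= S ^ 2) by apply pow2_ge_0.
assert (HQ : 0 <= M * r * (M * D) * S ^ 2) by (apply Rmult_le_pos; lra).
assert (HQ' : 0 <= 6 * beta * (M * r) ^ 2 * S ^ 2) by (apply Rmult_le_pos; lra).
assert (Ex : forall s t, ex_RInt (fun t => Cmod (sol nu h p t) ^ 2) s t)
  by (intros; now apply ex_RInt_Cmod_sqr).
apply Rabs_le_between in Hy; unfold K; rewrite Rmult_plus_distr_r; split; intros Hyp.
- destruct (Rle_dec p (3 * beta)) as [Hp | Hp].
  { specialize (Hnear y p Hyp ltac:(lra) Hp); lra. }
  rewrite <- (RInt_Chasles (V := R_CompleteNormedModule) _ y (3 * beta) p (Ex _ _) (Ex _ _)).
  assert (Rabs (3 * beta) = 3 * beta) by (apply Rabs_pos_eq; lra).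
  assert (En := energy_estimate (sol nu h p) (dsol nu h p) (bessel_pot nu h) (3 * beta) p
    ltac:(lra) (fun x => is_derive_RC_sol nu h p x Hh0 Hre')
    (fun x => is_derive_RC_dsol nu h p x Hh0 Hre')).
  rewrite Hp0 in En; specialize (Hbd (3 * beta) H).
  apply Rabs_le_between in Hbd.
  apply Rplus_le_compat; [apply Hnear; lra |].
  eapply Rle_trans; [apply En | lra].
  intros x Hx; apply (bessel_pot_far nu beta h x Hh0 Hb Hnu); rewrite Rabs_pos_eq; lra.
(* The mirror case: the energy estimate runs from p to - 3 beta, and the surviving boundary term is
   the one on the right. *)
- destruct (Rle_dec (- (3 * beta)) p) as [Hp | Hp].
  { specialize (Hnear p y Hyp Hp ltac:(lra)); lra. }
  rewrite <- (RInt_Chasles (V := R_CompleteNormedModule) _ p (- (3 * beta)) y (Ex _ _) (Ex _ _)).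
  assert (Rabs (- (3 * beta)) = 3 * beta) by (rewrite Rabs_Ropp; apply Rabs_pos_eq; lra).
  assert (En := energy_estimate (sol nu h p) (dsol nu h p) (bessel_pot nu h) p (- (3 * beta))
    ltac:(lra) (fun x => is_derive_RC_sol nu h p x Hh0 Hre')
    (fun x => is_derive_RC_dsol nu h p x Hh0 Hre')).
  rewrite Hp0 in En; specialize (Hbd (- (3 * beta)) H).
  apply Rabs_le_between in Hbd.
  unfold plus; simpl; rewrite Rplus_comm.
  apply Rplus_le_compat; [apply Hnear; lra |].
  eapply Rle_trans; [apply En | lra].
  intros x Hx; apply (bessel_pot_far nu beta h x Hh0 Hb Hnu).
  rewrite Rabs_left1; lra.
Qed.

(** * Test functions and weak solutions *)

Definition smooth (f : R -> R) : Prop := forall n x, ex_derive_n f n x.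

(** A class closed under differentiation consists of smooth functions, so no formula for higher
    derivatives is needed. *)
Lemma smooth_coinduction (P : (R -> R) -> Prop) :
  (forall f, P f -> exists g, P g /\ forall x, is_derive f x (g x)) ->
  forall f, P f -> smooth f.
Proof.
intros HP f Hf.
assert (H : forall n, exists g, P g /\ forall x, Derive_n f n x = g x).
{ intros n; induction n as [| n (g & Hg & E)]; [exists f; split; [exact Hf | reflexivity] |].
  destruct (HP g Hg) as (g' & Hg' & D); exists g'; split; [exact Hg' |].
  intros x; simpl; rewrite (Derive_ext _ g) by exact E; now apply is_derive_unique. }
intros [| n] x; [exact I |].
destruct (H n) as (g & Hg & E); destruct (HP g Hg) as (g' & _ & D).
simpl; apply ex_derive_ext with g; [intros t; now rewrite E |].
exists (g' x); apply D.
Qed.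

Lemma smooth_primitive (f g : R -> R) :
  smooth g -> (forall x, is_derive f x (g x)) -> smooth f.
Proof.
intros Hg D n x.
assert (E : forall n x, Derive_n f (S n) x = Derive_n g n x).
{ clear n x; induction n as [| n IH]; intros x.
  - simpl; now apply is_derive_unique.
  - change (Derive (Derive_n f (S n)) x = Derive (Derive_n g n) x).
    now apply Derive_ext. }
destruct n as [| [| n]].
- exact I.
- exists (g x); apply D.
- change (ex_derive (Derive_n f (S n)) x).
  apply ex_derive_ext with (Derive_n g n); [intros t; now rewrite E |].
  apply (Hg (S n)).
Qed.

Lemma smooth_lincomb (a b : R) (f g : R -> R) :
  smooth f -> smooth g -> smooth (fun x => a * f x + b * g x).
Proof.
intros F G n x.
apply (ex_derive_n_plus (fun x => a * f x) (fun x => b * g x));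
  apply filter_forall; intros y k _; apply ex_derive_n_scal_l; auto.
Qed.

(** The translates of smooth functions by c form a class closed under differentiation. *)
Lemma smooth_shift (c : R) (f : R -> R) : smooth f -> smooth (fun x => f (x - c)).
Proof.
intros F; apply (smooth_coinduction
  (fun g => exists f, smooth f /\ g = (fun x => f (x - c)))).
- intros g (f0 & F0 & ->); exists (fun x => Derive f0 (x - c)); split.
  + exists (Derive f0); split; [| reflexivity].
    intros n x; destruct n as [| n]; [exact I |].
    specialize (F0 (S (S n)) x); simpl in F0 |- *.
    revert F0; apply ex_derive_ext; intros t.
    change (Derive_n f0 (S n) t = Derive_n (Derive f0) n t).
    clear; revert t; induction n as [| n IH]; [reflexivity |]; intros t.
    change (Derive (Derive_n f0 (S n)) t = Derive (Derive_n (Derive f0) n) t).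
    now apply Derive_ext.
  + intros x; eapply is_derive_eq.
    * apply (is_derive_comp f0 (fun x => x - c)).
      -- apply Derive_correct, (F0 1%nat).
      -- auto_derive; [exact I | reflexivity].
    * unfold scal; simpl; unfold mult; simpl; ring.
- now exists f.
Qed.

(** x^(-k) exp (-1/x) extended by 0. The index k makes the span of the family closed under
    differentiation. *)
Definition flat (k : nat) (x : R) : R :=
  if Rle_dec x 0 then 0 else (/ x) ^ k * exp (- / x).

(** The n-th power of u/n <= exp (u/n); for n = 0 the constant is 0^0 = 1. *)
Lemma pow_le_exp (n : nat) (u : R) : 0 <= u -> u ^ n <= INR n ^ n * exp u.
Proof.
intros Hu; destruct n as [| n].
- pose proof (exp_ineq1_le u); simpl; lra.
- assert (Hn : 0 < INR (S n)) by apply lt_0_INR, Nat.lt_0_succ.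
  assert (Hv : 0 <= u / INR (S n)) by (apply Rmult_le_pos; [lra | now apply Rlt_le, Rinv_0_lt_compat]).
  replace u with (INR (S n) * (u / INR (S n))) at 1 by (field; lra).
  rewrite Rpow_mult_distr; apply Rmult_le_compat_l; [apply pow_le; lra |].
  apply Rle_trans with (exp (u / INR (S n)) ^ S n).
  + apply pow_incr; split; [exact Hv |].
    pose proof (exp_ineq1_le (u / INR (S n))); lra.
  + apply Req_le; rewrite <- (Rpower_pow (S n)) by apply exp_pos.
    unfold Rpower; rewrite ln_exp; f_equal; field; lra.
Qed.

Lemma flat_pos_eq (k : nat) (x : R) : 0 < x -> flat k x = (/ x) ^ k * exp (- / x).
Proof. intros Hx; unfold flat; destruct (Rle_dec x 0); [lra | reflexivity]. Qed.

Lemma flat_nonpos (k : nat) (x : R) : x <= 0 -> flat k x = 0.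
Proof. intros Hx; unfold flat; destruct (Rle_dec x 0); [reflexivity | lra]. Qed.

Lemma is_derive_flat (k : nat) (x : R) :
  is_derive (flat k) x (- INR k * flat (S k) x + flat (S (S k)) x).
Proof.
destruct (Rtotal_order x 0) as [Hx | [-> | Hx]].
- rewrite !flat_nonpos by lra.
  apply is_derive_ext_loc with (fun _ => 0).
  + exists (mkposreal (- x) ltac:(lra)); intros y Hy; symmetry; apply flat_nonpos.
    unfold ball in Hy; simpl in Hy; unfold AbsRing_ball, abs, minus, plus, opp in Hy;
    simpl in Hy; apply Rabs_lt_between in Hy; lra.
  + eapply is_derive_eq; [apply (@is_derive_const R_AbsRing R_NormedModule) |].
    unfold zero; simpl; ring.
- rewrite !flat_nonpos by lra.
  (* At the origin, t^(-k) exp (-1/t) <= C t^2 is [pow_le_exp] with exponent k + 2 and u = 1/t. *)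
  apply is_derive_quad with (INR (S (S k)) ^ S (S k)); intros t Ht.
  rewrite (flat_nonpos k 0) by lra.
  set (C := INR (S (S k)) ^ S (S k)).
  assert (HC : 0 <= C) by apply pow_le, pos_INR.
  destruct (Rle_dec t 0) as [H | H].
  + rewrite flat_nonpos by exact H.
    replace (0 - 0 - _) with 0 by ring; rewrite Rabs_R0.
    apply Rmult_le_pos; [exact HC | apply pow2_ge_0].
  + assert (H' : 0 < t) by lra; rewrite flat_pos_eq by exact H'.
    assert (Hu : 0 < / t) by now apply Rinv_0_lt_compat.
    replace (_ - _ - _) with ((/ t) ^ k * exp (- / t)) by ring.
    rewrite Rabs_pos_eq
      by (apply Rmult_le_pos; [apply pow_le; lra | apply Rlt_le, exp_pos]).
    pose proof (pow_le_exp (S (S k)) (/ t) (Rlt_le _ _ Hu)) as E; fold C in E.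
    rewrite exp_Ropp; pose proof (exp_pos (/ t)) as He.
    apply Rle_div_l; [exact He |].
    replace ((/ t) ^ k) with ((/ t) ^ S (S k) * t ^ 2) by (simpl; field; lra).
    rewrite Rminus_0_r, (Rmult_comm C), Rmult_assoc, (Rmult_comm _ (t ^ 2)).
    apply Rmult_le_compat_l; [apply pow2_ge_0 | exact E].
- apply is_derive_ext_loc with (fun t => (/ t) ^ k * exp (- / t)).
  + exists (mkposreal x Hx); intros y Hy; symmetry; apply flat_pos_eq.
    unfold ball in Hy; simpl in Hy; unfold AbsRing_ball, abs, minus, plus, opp in Hy;
    simpl in Hy; apply Rabs_lt_between in Hy; lra.
  + rewrite !flat_pos_eq by lra; auto_derive; [split; [lra | exact I] || lra |].
    destruct k as [| k]; [simpl; field; lra |].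
    rewrite !S_INR; simpl pred.
    simpl; field; lra.
Qed.

Definition flat2 (d : R) (j k : nat) (x : R) : R := flat j (d + x) * flat k (d - x).

Lemma is_derive_flat2 (d : R) (j k : nat) (x : R) :
  is_derive (flat2 d j k) x
    (1 * (- INR j * flat2 d (S j) k x + 1 * flat2 d (S (S j)) k x)
     + 1 * (INR k * flat2 d j (S k) x + (- 1) * flat2 d j (S (S k)) x)).
Proof.
unfold flat2; eapply is_derive_eq.
- apply is_derive_Rmult.
  + apply (is_derive_comp (flat j) (fun x => d + x)); [apply is_derive_flat |].
    auto_derive; [exact I | reflexivity].
  + apply (is_derive_comp (flat k) (fun x => d - x)); [apply is_derive_flat |].
    auto_derive; [exact I | reflexivity].
- unfold scal; simpl; unfold mult; simpl; ring.
Qed.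

(** The linear span of the [flat2 d j k], the class to which [smooth_coinduction] is applied. *)
Inductive flat2_span (d : R) : (R -> R) -> Prop :=
| flat2_span_base j k : flat2_span d (flat2 d j k)
| flat2_span_lincomb a b f g : flat2_span d f -> flat2_span d g ->
    flat2_span d (fun x => a * f x + b * g x).

Definition bump (d : R) : R -> R := flat2 d 0 0.

Lemma smooth_bump (d : R) : smooth (bump d).
Proof.
apply (smooth_coinduction (flat2_span d)); [| apply flat2_span_base].
intros f Hf; induction Hf as [j k | a b f g _ (f' & Hf' & Df) _ (g' & Hg' & Dg)].
- eexists; split; [| apply is_derive_flat2].
  repeat apply flat2_span_lincomb; apply flat2_span_base.
- exists (fun x => a * f' x + b * g' x); split; [now apply flat2_span_lincomb |].
  intros x; apply (is_derive_plus (fun x => a * f x) (fun x => b * g x)).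
  + apply (is_derive_scal f x a (f' x)), Df.
  + apply (is_derive_scal g x b (g' x)), Dg.
Qed.

Lemma flat_0_ge0 (x : R) : 0 <= flat 0 x.
Proof.
destruct (Rle_dec x 0) as [H | H]; [rewrite flat_nonpos; lra |].
rewrite flat_pos_eq by lra; simpl; rewrite Rmult_1_l; apply Rlt_le, exp_pos.
Qed.

Lemma bump_ge0 (d x : R) : 0 <= bump d x.
Proof. apply Rmult_le_pos; apply flat_0_ge0. Qed.

Lemma bump_out (d x : R) : d <= Rabs x -> bump d x = 0.
Proof.
unfold Rabs; destruct (Rcase_abs x) as [H | H]; intros Hd; unfold bump, flat2.
- rewrite flat_nonpos by lra; ring.
- rewrite (flat_nonpos _ (d - x)) by lra; ring.
Qed.

Lemma continuous_bump (d x : R) : continuous (bump d) x.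
Proof.
apply (@ex_derive_continuous R_AbsRing R_NormedModule).
eexists; apply is_derive_flat2.
Qed.

Lemma bump_in (d x : R) : Rabs x < d -> 0 < bump d x.
Proof.
intros H; apply Rabs_lt_between in H; unfold bump, flat2.
rewrite !flat_pos_eq by lra; simpl; rewrite !Rmult_1_l.
apply Rmult_lt_0_compat; apply exp_pos.
Qed.

Definition bump1 (d x : R) : R := RInt (bump d) (- d) x.
Definition bump2 (d x : R) : R := RInt (bump1 d) (- d) x.

Lemma is_derive_RInt_cont (f : R -> R) (a x : R) : (forall y, continuous f y) ->
  is_derive (fun x => RInt f a x) x (f x).
Proof.
intros Hf; apply (is_derive_RInt f (fun x => RInt f a x) a); [| apply Hf].
apply filter_forall; intros u; apply (RInt_correct (V := R_CompleteNormedModule)).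
apply (ex_RInt_continuous (V := R_CompleteNormedModule)); auto.
Qed.

Lemma is_derive_bump1 (d x : R) : is_derive (bump1 d) x (bump d x).
Proof. apply is_derive_RInt_cont, continuous_bump. Qed.

Lemma is_derive_bump2 (d x : R) : is_derive (bump2 d) x (bump1 d x).
Proof.
apply is_derive_RInt_cont; intros y.
apply (@ex_derive_continuous R_AbsRing R_NormedModule); eexists; apply is_derive_bump1.
Qed.

Lemma smooth_bump2 (d : R) : smooth (bump2 d).
Proof.
apply smooth_primitive with (bump1 d); [| apply is_derive_bump2].
apply smooth_primitive with (bump d); [apply smooth_bump | apply is_derive_bump1].
Qed.

Lemma const_of_derive0 (f : R -> R) (a b : R) : a <= b ->
  (forall x, a <= x <= b -> is_derive f x 0) -> f b = f a.
Proof.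
intros [Hab | <-] H; [| reflexivity].
symmetry; apply (eq_is_derive f); [exact H | exact Hab].
Qed.

Lemma bump1_left (d x : R) : 0 <= d -> x <= - d -> bump1 d x = 0.
Proof.
intros Hd Hx; transitivity (bump1 d (- d)).
- symmetry; apply const_of_derive0; [exact Hx |]; intros y Hy.
  eapply is_derive_eq; [apply is_derive_bump1 |].
  apply bump_out; rewrite Rabs_left1; lra.
- unfold bump1; now rewrite RInt_point.
Qed.

Lemma bump1_right (d x : R) : 0 <= d -> d <= x -> bump1 d x = bump1 d d.
Proof.
intros Hd Hx; apply const_of_derive0; [exact Hx |]; intros y Hy.
eapply is_derive_eq; [apply is_derive_bump1 |].
apply bump_out; rewrite Rabs_pos_eq; lra.
Qed.

Lemma bump2_left (d x : R) : 0 <= d -> x <= - d -> bump2 d x = 0.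
Proof.
intros Hd Hx; transitivity (bump2 d (- d)).
- symmetry; apply const_of_derive0; [exact Hx |]; intros y Hy.
  eapply is_derive_eq; [apply is_derive_bump2 |]; apply bump1_left; lra.
- unfold bump2; now rewrite RInt_point.
Qed.

Lemma bump2_right (d x : R) : 0 <= d -> d <= x ->
  bump2 d x = bump2 d d + bump1 d d * (x - d).
Proof.
intros Hd Hx.
assert (E : bump2 d x - bump1 d d * (x - d) = bump2 d d - bump1 d d * (d - d)).
{ apply (const_of_derive0 (fun x => bump2 d x - bump1 d d * (x - d))); [exact Hx |].
  intros y Hy; eapply is_derive_eq.
  - apply (is_derive_minus (bump2 d) (fun x => bump1 d d * (x - d))).
    + apply is_derive_bump2.
    + auto_derive; [exact I | reflexivity].
  - unfold minus, plus, opp; simpl; rewrite (bump1_right d y) by lra; ring. }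
lra.
Qed.

Lemma bump_mass_pos (d : R) : 0 < d -> 0 < bump1 d d.
Proof.
intros Hd; unfold bump1; apply RInt_gt_0; [lra | |].
- intros x Hx; apply bump_in, Rabs_def1; lra.
- intros x _; apply continuous_bump.
Qed.

(* [bump2 d] vanishes on the left of its bump and is affine on the right of it; the weights
   make the three affine pieces cancel, so that the support is compact. *)
Definition bump_comb (d lam p r x : R) : R :=
  1 * (lam * bump2 d (x - p) + (1 - lam) * bump2 d (x - r))
  + (- 1) * bump2 d (x - (lam * p + (1 - lam) * r)).

Lemma is_derive_shift (f f' : R -> R) (c x : R) :
  (forall y, is_derive f y (f' y)) -> is_derive (fun y => f (y - c)) x (f' (x - c)).
Proof.
intros H; eapply is_derive_eq.
- apply (is_derive_comp f (fun y => y - c)); [apply H |].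
  auto_derive; [exact I | reflexivity].
- unfold scal; simpl; unfold mult; simpl; ring.
Qed.

Lemma Derive2_bump_comb (d lam p r x : R) :
  Derive_n (bump_comb d lam p r) 2 x =
  lam * bump d (x - p) + (1 - lam) * bump d (x - r)
  - bump d (x - (lam * p + (1 - lam) * r)).
Proof.
set (q := lam * p + (1 - lam) * r).
assert (L : forall (f f' : R -> R), (forall y, is_derive f y (f' y)) -> forall y,
  is_derive (fun x => 1 * (lam * f (x - p) + (1 - lam) * f (x - r)) + (- 1) * f (x - q)) y
    (1 * (lam * f' (y - p) + (1 - lam) * f' (y - r)) + (- 1) * f' (y - q))).
{ intros f f' H y.
  assert (S := fun c => is_derive_shift f f' c y H).
  exact (is_derive_plus _ _ _ _ _
    (is_derive_scal _ _ 1 _ (is_derive_plus _ _ _ _ _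
       (is_derive_scal _ _ lam _ (S p)) (is_derive_scal _ _ (1 - lam) _ (S r))))
    (is_derive_scal _ _ (- 1) _ (S q))). }
change (Derive (Derive (bump_comb d lam p r)) x =
  lam * bump d (x - p) + (1 - lam) * bump d (x - r) - bump d (x - q)).
rewrite (Derive_ext _ (fun y => 1 * (lam * bump1 d (y - p) + (1 - lam) * bump1 d (y - r))
  + (- 1) * bump1 d (y - q))).
- erewrite is_derive_unique; [| apply (L (bump1 d) (bump d)), is_derive_bump1]; ring.
- intros y; apply is_derive_unique, (L (bump2 d) (bump1 d)), is_derive_bump2.
Qed.

Lemma test_function_bump_comb (d lam p r : R) : 0 < d -> 0 <= lam <= 1 -> p <= r ->
  0 < p - d -> r + d < 1 -> test_function (bump_comb d lam p r).
Proof.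
intros Hd Hl Hpr Hp Hr; split.
- apply smooth_lincomb; [apply smooth_lincomb |]; apply smooth_shift, smooth_bump2.
- exists (p - d), (r + d); repeat split; try lra; intros x Hx.
  assert (H1 : 0 <= lam * (r - p)) by (apply Rmult_le_pos; lra).
  assert (H2 : 0 <= (1 - lam) * (r - p)) by (apply Rmult_le_pos; lra).
  unfold bump_comb; destruct (Rlt_dec x (p - d)) as [H | H].
  + rewrite !bump2_left by lra; ring.
  + rewrite (bump2_right d (x - p)), (bump2_right d (x - r)),
      (bump2_right d (x - (lam * p + (1 - lam) * r))) by lra; ring.
Qed.

Lemma continuous_Rmult (f g : R -> R) (x : R) :
  continuous f x -> continuous g x -> continuous (fun t => f t * g t) x.
Proof. exact (continuous_mult (K := R_AbsRing) f g x). Qed.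

Lemma continuous_bump_shift (d c x : R) : continuous (fun x => bump d (x - c)) x.
Proof.
apply (@ex_derive_continuous R_AbsRing R_NormedModule).
eexists; apply (is_derive_shift (bump d)); intros y; apply is_derive_flat2.
Qed.

(** The bump is not normalised, its mass being [bump1 d d]; the conditions on c keep all of this
    mass inside [0,1]. *)
Lemma bump_average (F : R -> R) (c d eps : R) : (forall x, continuous F x) ->
  0 < d -> d <= c -> c <= 1 - d -> 0 <= eps ->
  (forall x, Rabs (x - c) < d -> Rabs (F x - F c) <= eps) ->
  Rabs (RInt (fun x => F x * bump d (x - c)) 0 1 - F c * bump1 d d) <= eps * bump1 d d.
Proof.
intros HF Hd Hc1 Hc2 He Hclose.
assert (Hb : is_RInt (fun x => bump d (x - c)) 0 1 (bump1 d d)).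
{ replace (bump1 d d) with (minus (bump1 d (1 - c)) (bump1 d (0 - c))).
  - apply (is_RInt_derive (V := R_CompleteNormedModule) (fun x => bump1 d (x - c))).
    + intros x _; apply is_derive_shift, is_derive_bump1.
    + intros x _; apply continuous_bump_shift.
  - rewrite bump1_right, (bump1_left d (0 - c)) by lra.
    unfold minus, plus, opp; simpl; ring. }
assert (Eb : ex_RInt (fun x => bump d (x - c)) 0 1) by (eexists; exact Hb).
assert (Ei : forall K, ex_RInt (fun x => K * bump d (x - c)) 0 1)
  by (intros K; now apply (ex_RInt_scal (V := R_NormedModule) _ 0 1 K)).
assert (Ef : ex_RInt (fun x => F x * bump d (x - c)) 0 1).
{ apply (ex_RInt_continuous (V := R_CompleteNormedModule)); intros x _.
  apply continuous_Rmult; [apply HF | apply continuous_bump_shift]. }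
assert (Sc : forall K, RInt (fun x => K * bump d (x - c)) 0 1 = K * bump1 d d).
{ intros K; rewrite <- (is_RInt_unique _ _ _ _ Hb).
  apply (RInt_scal (V := R_CompleteNormedModule) _ 0 1 K Eb). }
assert (Hpt : forall x, (F c - eps) * bump d (x - c) <= F x * bump d (x - c)
                        <= (F c + eps) * bump d (x - c)).
{ intros x; assert (Hp := bump_ge0 d (x - c)).
  destruct (Rlt_dec (Rabs (x - c)) d) as [H | H].
  - specialize (Hclose x H); apply Rabs_le_between in Hclose.
    split; apply Rmult_le_compat_r; lra.
  - rewrite bump_out by lra; lra. }
assert (L1 : (F c - eps) * bump1 d d <= RInt (fun x => F x * bump d (x - c)) 0 1).
{ rewrite <- Sc; apply RInt_le; [lra | apply Ei | exact Ef | intros; apply Hpt]. }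
assert (L2 : RInt (fun x => F x * bump d (x - c)) 0 1 <= (F c + eps) * bump1 d d).
{ rewrite <- Sc; apply RInt_le; [lra | exact Ef | apply Ei | intros; apply Hpt]. }
apply Rabs_le; lra.
Qed.

(** * Continuous weak solutions of F'' = 0 are affine *)

Lemma continuous_eps (F : R -> R) (x eps : R) : continuous F x -> 0 < eps ->
  exists d, 0 < d /\ forall y, Rabs (y - x) < d -> Rabs (F y - F x) <= eps.
Proof.
intros HF He.
destruct (HF (fun y => ball (F x) eps y) (locally_ball _ (mkposreal eps He))) as (d & Hd).
exists d; split; [apply cond_pos |]; intros y Hy; left.
apply (Hd y); exact Hy.
Qed.

(** Tested against [bump_comb], whose second derivative is the matching combination of three bumps,
    the weak equation gives the affine relation for the averages of F; as the bumps shrink, it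
    passes to the values. *)
Lemma weak_affine_interp (F : R -> R) (lam p r : R) : (forall x, continuous F x) ->
  (forall phi, test_function phi -> is_RInt (fun y => F y * Derive_n phi 2 y) 0 1 0) ->
  0 <= lam <= 1 -> 0 < p -> p <= r -> r < 1 ->
  F (lam * p + (1 - lam) * r) = lam * F p + (1 - lam) * F r.
Proof.
intros HF Hw Hl Hp Hpr Hr; set (q := lam * p + (1 - lam) * r).
assert (Hq1 : 0 <= lam * (r - p)) by (apply Rmult_le_pos; lra).
assert (Hq2 : 0 <= (1 - lam) * (r - p)) by (apply Rmult_le_pos; lra).
assert (Hq : p <= q <= r) by (unfold q; lra).
apply cond_eq; intros eps He.
destruct (continuous_eps F p (eps / 4) (HF p) ltac:(lra)) as (d1 & Hd1 & C1).
destruct (continuous_eps F q (eps / 4) (HF q) ltac:(lra)) as (d2 & Hd2 & C2).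
destruct (continuous_eps F r (eps / 4) (HF r) ltac:(lra)) as (d3 & Hd3 & C3).
(* The last two terms keep the supports inside (0,1). Each average is off by at most eps / 4 of the
   mass, and the absolute weights of the three add up to 2. *)
set (d := Rmin (Rmin d1 (Rmin d2 d3)) (Rmin (p / 2) ((1 - r) / 2))).
assert (Hd : 0 < d) by (repeat apply Rmin_pos; lra).
assert (E1 : d <= d1) by (eapply Rle_trans; [apply Rmin_l | apply Rmin_l]).
assert (E2 : d <= d2)
  by (eapply Rle_trans; [apply Rmin_l | eapply Rle_trans; [apply Rmin_r | apply Rmin_l]]).
assert (E3 : d <= d3)
  by (eapply Rle_trans; [apply Rmin_l | eapply Rle_trans; [apply Rmin_r | apply Rmin_r]]).
assert (E4 : d <= p / 2) by (eapply Rle_trans; [apply Rmin_r | apply Rmin_l]).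
assert (E5 : d <= (1 - r) / 2) by (eapply Rle_trans; [apply Rmin_r | apply Rmin_r]).
assert (T := Hw _ (test_function_bump_comb d lam p r Hd Hl Hpr ltac:(lra) ltac:(lra))).
assert (Ef : forall c, ex_RInt (fun x => F x * bump d (x - c)) 0 1).
{ intros c; apply (ex_RInt_continuous (V := R_CompleteNormedModule)); intros x _.
  apply continuous_Rmult; [apply HF | apply continuous_bump_shift]. }
set (I := fun c => RInt (fun x => F x * bump d (x - c)) 0 1).
assert (HI : forall c, is_RInt (fun x => F x * bump d (x - c)) 0 1 (I c))
  by (intros; apply (RInt_correct (V := R_CompleteNormedModule)), Ef).
assert (E0 : lam * I p + (1 - lam) * I r - I q = 0).
{ rewrite <- (is_RInt_unique _ _ _ _ T); symmetry; apply is_RInt_unique.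
  apply is_RInt_ext with (fun x => minus (plus (scal lam (F x * bump d (x - p)))
    (scal (1 - lam) (F x * bump d (x - r)))) (F x * bump d (x - q))).
  - intros x _; rewrite Derive2_bump_comb; fold q.
    unfold minus, plus, opp, scal; simpl; unfold mult; simpl; ring.
  - apply (is_RInt_minus (V := R_NormedModule)); [| apply HI].
    apply (is_RInt_plus (V := R_NormedModule));
      apply (is_RInt_scal (V := R_NormedModule)), HI. }
assert (A1 := bump_average F p d (eps / 4) HF Hd ltac:(lra) ltac:(lra) ltac:(lra)
  (fun x H => C1 x (Rlt_le_trans _ _ _ H E1))).
assert (A2 := bump_average F q d (eps / 4) HF Hd ltac:(lra) ltac:(lra) ltac:(lra)
  (fun x H => C2 x (Rlt_le_trans _ _ _ H E2))).
assert (A3 := bump_average F r d (eps / 4) HF Hd ltac:(lra) ltac:(lra) ltac:(lra)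
  (fun x H => C3 x (Rlt_le_trans _ _ _ H E3))).
fold (I p) in A1; fold (I q) in A2; fold (I r) in A3.
assert (HM := bump_mass_pos d Hd); set (M := bump1 d d) in *.
apply Rabs_le_between in A1; apply Rabs_le_between in A2; apply Rabs_le_between in A3.
assert (B1 := Rmult_le_compat_l lam _ _ ltac:(lra) (proj1 A1)).
assert (B2 := Rmult_le_compat_l lam _ _ ltac:(lra) (proj2 A1)).
assert (B3 := Rmult_le_compat_l (1 - lam) _ _ ltac:(lra) (proj1 A3)).
assert (B4 := Rmult_le_compat_l (1 - lam) _ _ ltac:(lra) (proj2 A3)).
apply Rmult_lt_reg_r with M; [exact HM |].
rewrite <- (Rabs_pos_eq M) at 1 by lra; rewrite <- Rabs_mult.
assert (0 < eps * M) by (apply Rmult_lt_0_compat; lra).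
apply Rabs_def1; lra.
Qed.

Lemma continuous_zero_limit (P : R -> R) (e : R) : continuous P 0 -> 0 < e ->
  (forall s, 0 < s < e -> P s = 0) -> P 0 = 0.
Proof.
intros HP He H; apply cond_eq; intros eps Heps.
destruct (continuous_eps P 0 (eps / 2) HP ltac:(lra)) as (d & Hd & C).
set (s := Rmin (d / 2) (e / 2)).
assert (Hs : 0 < s) by (apply Rmin_pos; lra).
assert (s <= d / 2) by apply Rmin_l. assert (s <= e / 2) by apply Rmin_r.
specialize (C s); rewrite (H s), Rminus_0_r, Rabs_pos_eq in C by lra.
rewrite Rminus_0_r, <- Rabs_Ropp; replace (- P 0) with (0 - P 0) by ring.
specialize (C ltac:(lra)); lra.
Qed.

(** Test functions do not see the end points, so the interpolation between s and 1 - s is carried to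
    s = 0 by continuity. In [P] it is multiplied by 1 - 2 s to clear the denominator. *)
Lemma weak_affine (F : R -> R) : (forall x, continuous F x) ->
  (forall phi, test_function phi -> is_RInt (fun y => F y * Derive_n phi 2 y) 0 1 0) ->
  forall x, 0 <= x <= 1 -> F x = (1 - x) * F 0 + x * F 1.
Proof.
intros HF Hw x Hx.
destruct (Req_dec x 0) as [-> | H0]; [ring |].
destruct (Req_dec x 1) as [-> | H1]; [ring |].
set (P := fun s => (1 - 2 * s) * F x - ((1 - s - x) * F s + (x - s) * F (1 - s))).
assert (E : P 0 = 0).
{ apply continuous_zero_limit with (Rmin x (1 - x)); [| apply Rmin_pos; lra |].
  - assert (Ca : forall a b : R, continuous (fun s => a - b * s) 0).
    { intros a b; apply (@ex_derive_continuous R_AbsRing R_NormedModule); auto_derive; exact I. }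
    assert (Ca' : forall a : R, continuous (fun s => a - s) 0).
    { intros a; apply (@ex_derive_continuous R_AbsRing R_NormedModule); auto_derive; exact I. }
    assert (Ca'' : continuous (fun s => 1 - s - x) 0).
    { apply (@ex_derive_continuous R_AbsRing R_NormedModule); auto_derive; exact I. }
    apply (continuous_minus (V := R_NormedModule)).
    + apply continuous_Rmult; [apply Ca | apply continuous_const].
    + apply (continuous_plus (V := R_NormedModule)).
      * apply continuous_Rmult; [exact Ca'' | apply HF].
      * apply continuous_Rmult; [apply Ca' |].
        apply (continuous_comp (fun s => 1 - s) F); [apply Ca' | apply HF].
  - intros s Hs; assert (s < x) by (pose proof (Rmin_l x (1 - x)); lra).
    assert (s < 1 - x) by (pose proof (Rmin_r x (1 - x)); lra).
    (* The weight that makes x the barycentre of s and 1 - s. *)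
    set (lam := (1 - s - x) / (1 - 2 * s)).
    assert (Hl : lam * (1 - 2 * s) = 1 - s - x) by (unfold lam; field; lra).
    assert (L0 : 0 <= lam) by (apply Rmult_le_pos; [lra | apply Rlt_le, Rinv_0_lt_compat; lra]).
    assert (L1 : lam <= 1) by (apply Rle_div_l; lra).
    pose proof (weak_affine_interp F lam s (1 - s) HF Hw (conj L0 L1)
      ltac:(lra) ltac:(lra) ltac:(lra)) as I.
    replace (lam * s + (1 - lam) * (1 - s)) with x in I by lra.
    unfold P; rewrite I, <- Hl; replace (x - s) with ((1 - lam) * (1 - 2 * s)) by lra; ring. }
unfold P in E; rewrite !Rminus_0_r in E; lra.
Qed.

Lemma weak_affine_C (F : R -> C) : (forall x, continuous F x) ->
  (forall phi, test_function phi ->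
    is_RInt (V := C_R_NormedModule) (fun y => (F y * RtoC (Derive_n phi 2 y))%C) 0 1 (RtoC 0)) ->
  forall x, 0 <= x <= 1 -> F x = (RtoC (1 - x) * F 0%R + RtoC x * F 1%R)%C.
Proof.
intros HF Hw x Hx; apply injective_projections.
- simpl; rewrite !Rmult_0_l, !Rminus_0_r.
  apply (weak_affine (fun y => fst (F y))); [intros; apply continuous_fst_C, HF | | exact Hx].
  intros phi Hphi; destruct (is_RInt_C_inv _ _ _ _ (Hw phi Hphi)) as [H _].
  revert H; apply is_RInt_ext; intros y _; simpl; ring.
- simpl; rewrite !Rmult_0_l, !Rplus_0_r.
  apply (weak_affine (fun y => snd (F y))); [intros; apply continuous_snd_C, HF | | exact Hx].
  intros phi Hphi; destruct (is_RInt_C_inv _ _ _ _ (Hw phi Hphi)) as [_ H].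
  revert H; apply is_RInt_ext; intros y _; simpl; ring.
Qed.

Lemma test_function_derive (phi : R -> R) (x : R) : test_function phi ->
  is_derive phi x (Derive phi x) /\
  is_derive (Derive phi) x (Derive_n phi 2 x) /\ continuous (Derive_n phi 2) x.
Proof.
intros [H _]; split; [| split].
- apply Derive_correct, (H 1%nat).
- apply Derive_correct, (H 2%nat).
- apply (@ex_derive_continuous R_AbsRing R_NormedModule), (H 3%nat).
Qed.

Lemma test_function_boundary (phi : R -> R) : test_function phi ->
  phi 0 = 0 /\ phi 1 = 0 /\ Derive phi 0 = 0 /\ Derive phi 1 = 0.
Proof.
intros (_ & a & b & Ha & Hab & Hb & H).
assert (D : forall x e : R, 0 < e -> (forall y, Rabs (y - x) < e -> phi y = 0) ->
  Derive phi x = 0).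
{ intros x e He Hz; rewrite (Derive_ext_loc phi (fun _ => 0)).
  - apply Derive_const.
  - exists (mkposreal e He); intros y Hy; apply Hz, Hy. }
repeat split.
- apply H; lra.
- apply H; lra.
- apply (D 0 a Ha); intros y Hy; apply H; rewrite Rminus_0_r in Hy.
  apply Rabs_lt_between in Hy; lra.
- apply (D 1 (1 - b) ltac:(lra)); intros y Hy; apply H.
  apply Rabs_lt_between in Hy; lra.
Qed.

Lemma continuous_RtoC (f : R -> R) (x : R) :
  continuous f x -> continuous (fun t => RtoC (f t)) x.
Proof. intros H; apply continuous_pair_C; [exact H | apply continuous_const]. Qed.

(** The integrand has the primitive u phi' - u' phi. The interval is arbitrary, so that the Green's
    function can be treated on each side of its kink. *)
Lemma green_identity (u du ddu : R -> C) (phi : R -> R) (a b : R) : a <= b ->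
  (forall x, a <= x <= b -> is_derive_RC u x (du x) /\ is_derive_RC du x (ddu x) /\
                            continuous ddu x) ->
  test_function phi ->
  is_RInt (V := C_R_NormedModule)
    (fun x => (u x * RtoC (Derive_n phi 2 x) - ddu x * RtoC (phi x))%C) a b
    ((u b * RtoC (Derive phi b) - du b * RtoC (phi b))
     - (u a * RtoC (Derive phi a) - du a * RtoC (phi a)))%C.
Proof.
intros Hab Hu Hphi.
apply (is_RInt_derive_RC (fun x => (u x * RtoC (Derive phi x) - du x * RtoC (phi x))%C));
  [exact Hab | |]; intros x Hx; destruct (Hu x Hx) as (U1 & U2 & U3);
  destruct (test_function_derive phi x Hphi) as (P1 & P2 & P3).
- eapply is_derive_RC_eq.
  + exact (is_derive_RC_minus _ _ _ _ _
      (is_derive_RC_mult _ _ _ _ _ U1 (is_derive_RC_RtoC _ _ _ P2))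
      (is_derive_RC_mult _ _ _ _ _ U2 (is_derive_RC_RtoC _ _ _ P1))).
  + cbv beta; ring.
- apply (continuous_minus (V := C_R_NormedModule)).
  + apply continuous_Cmult; [exact (is_derive_RC_continuous _ _ _ U1) |].
    now apply continuous_RtoC.
  + apply continuous_Cmult; [exact U3 |]; apply continuous_RtoC.
    apply (@ex_derive_continuous R_AbsRing R_NormedModule); eexists; exact P1.
Qed.

Definition primitive_C (f : R -> C) (x : R) : C :=
  (RInt (fun t => fst (f t)) 0 x, RInt (fun t => snd (f t)) 0 x).

Lemma is_derive_primitive_C (f : R -> C) (x : R) :
  (forall y, continuous f y) -> is_derive_RC (primitive_C f) x (f x).
Proof.
intros H; split; [apply (is_derive_RInt_cont (fun t => fst (f t))) |
  apply (is_derive_RInt_cont (fun t => snd (f t)))]; intros y;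
  [apply continuous_fst_C | apply continuous_snd_C]; apply H.
Qed.

(** A second primitive of k differs from D by a weak solution of F'' = 0, which is affine. The
    regular representative lives on the whole line and agrees with D on [0,1] only. *)
Lemma weak_solution_regular (D k : R -> C) :
  (forall x, continuous D x) -> (forall x, continuous k x) ->
  (forall phi, test_function phi ->
    is_RInt (V := C_R_NormedModule)
      (fun y => (D y * RtoC (Derive_n phi 2 y) - k y * RtoC (phi y))%C) 0 1 (RtoC 0)) ->
  exists u du : R -> C,
    (forall x, is_derive_RC u x (du x)) /\ (forall x, is_derive_RC du x (k x)) /\
    forall x, 0 <= x <= 1 -> u x = D x.
Proof.
intros HD Hk Hw.
set (q1 := primitive_C k); set (q := primitive_C q1).
assert (Q1 : forall x, is_derive_RC q1 x (k x)) by (intros; now apply is_derive_primitive_C).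
assert (Q : forall x, is_derive_RC q x (q1 x)).
{ intros x; apply is_derive_primitive_C; intros y.
  exact (is_derive_RC_continuous _ _ _ (Q1 y)). }
assert (HDq : forall x, continuous (fun x => (D x - q x)%C) x).
{ intros x; apply (continuous_minus (V := C_R_NormedModule)); [apply HD |].
  exact (is_derive_RC_continuous _ _ _ (Q x)). }
assert (A : forall x, 0 <= x <= 1 ->
  (D x - q x = RtoC (1 - x) * (D 0%R - q 0%R) + RtoC x * (D 1%R - q 1%R))%C).
{ apply (weak_affine_C (fun x => (D x - q x)%C) HDq); intros phi Hphi.
  destruct (test_function_boundary phi Hphi) as (B0 & B1 & B2 & B3).
  assert (G := green_identity q q1 k phi 0 1 Rle_0_1
    (fun x _ => conj (Q x) (conj (Q1 x) (Hk x))) Hphi).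
  rewrite B0, B1, B2, B3 in G.
  assert (S := is_RInt_minus (V := C_R_NormedModule) _ _ _ _ _ _ (Hw phi Hphi) G).
  replace (RtoC 0) with (minus (RtoC 0 : C_R_NormedModule)
    (q 1%R * RtoC 0 - q1 1%R * RtoC 0 - (q 0%R * RtoC 0 - q1 0%R * RtoC 0))%C).
  - revert S; apply is_RInt_ext; intros y _.
    transitivity ((D y * RtoC (Derive_n phi 2 y) - k y * RtoC (phi y))
     - (q y * RtoC (Derive_n phi 2 y) - k y * RtoC (phi y)))%C; [reflexivity |].
    lazymatch goal with |- @eq _ ?a ?b => change (@eq C a b) end; ring.
  - transitivity (0 - (q 1%R * RtoC 0 - q1 1%R * RtoC 0
                       - (q 0%R * RtoC 0 - q1 0%R * RtoC 0)))%C; [reflexivity |].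
    lazymatch goal with |- @eq _ ?a ?b => change (@eq C a b) end; ring. }
exists (fun x => (q x + (RtoC (1 - x) * (D 0%R - q 0%R) + RtoC x * (D 1%R - q 1%R)))%C).
exists (fun x => (q1 x + ((D 1%R - q 1%R) - (D 0%R - q 0%R)))%C).
split; [| split].
- intros x; eapply is_derive_RC_eq.
  + apply is_derive_RC_plus; [apply Q |].
    apply is_derive_RC_plus; (apply is_derive_RC_mult;
      [apply is_derive_RC_RtoC | apply is_derive_RC_const]).
    * apply (is_derive_minus (fun _ => 1) (fun x => x));
      [apply (@is_derive_const R_AbsRing R_NormedModule) | apply (@is_derive_id R_AbsRing)].
    * apply (@is_derive_id R_AbsRing).
  + cbv beta. change (minus zero (@one R_AbsRing)) with (0 - 1).
    change (@one R_AbsRing) with 1; rewrite RtoC_minus; ring.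
- intros x; eapply is_derive_RC_eq.
  + apply is_derive_RC_plus; [apply Q1 | apply is_derive_RC_const].
  + ring.
- intros x Hx; rewrite <- A by exact Hx; ring.
Qed.

(** * The Green's function *)

Lemma continuous_nonexpansive (f : R -> R) (x : R) :
  (forall y, Rabs (f y - f x) <= Rabs (y - x)) -> continuous f x.
Proof.
intros H P [eps HP]; exists eps; intros y Hy; apply HP.
exact (Rle_lt_trans _ _ _ (H y) Hy).
Qed.

Lemma continuous_Rmin_l (z x : R) : continuous (fun y => Rmin y z) x.
Proof.
apply continuous_nonexpansive; intros y; unfold Rmin.
destruct (Rle_dec y z); destruct (Rle_dec x z); unfold Rabs;
  repeat destruct (Rcase_abs _); lra.
Qed.

Lemma continuous_Rmax_l (z x : R) : continuous (fun y => Rmax y z) x.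
Proof.
apply continuous_nonexpansive; intros y; unfold Rmax.
destruct (Rle_dec y z); destruct (Rle_dec x z); unfold Rabs;
  repeat destruct (Rcase_abs _); lra.
Qed.

(** Composition with it extends a function continuous on [0,1] to one continuous on the line, as the
    lemmas on weak solutions require. *)
Definition clamp (y : R) : R := Rmax (Rmin y 1) 0.

Lemma clamp_range (y : R) : 0 <= clamp y <= 1.
Proof.
unfold clamp; split; [apply Rmax_r | apply Rmax_lub; [apply Rmin_r | lra]].
Qed.

Lemma clamp_id (y : R) : 0 <= y <= 1 -> clamp y = y.
Proof. intros H; unfold clamp; rewrite Rmin_left, Rmax_left by lra; reflexivity. Qed.

Lemma continuous_clamp (x : R) : continuous clamp x.
Proof.
apply (continuous_comp (fun y => Rmin y 1) (fun y => Rmax y 0));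
  [apply continuous_Rmin_l | apply continuous_Rmax_l].
Qed.

Lemma continuous_on_clamp (f : R -> C) (x : R) :
  continuous_on (fun y => 0 <= y <= 1) f -> continuous (fun y => f (clamp y)) x.
Proof.
intros Hf P HP.
specialize (Hf (clamp x) (clamp_range x) P HP).
assert (Hc := continuous_clamp x _ Hf); unfold filtermap in *.
revert Hc; apply filter_imp; intros y Hy; apply Hy, clamp_range.
Qed.

(** Solutions of u'' = q u adapted to the left and to the right end point, with their constant
    Wronskian w. *)
Definition fundamental_pair (q : R -> C) (ul dul ur dur : R -> C) (w : C) : Prop :=
  (forall x, continuous q x) /\
  (forall x, is_derive_RC ul x (dul x)) /\
  (forall x, is_derive_RC dul x (q x * ul x)%C) /\
  (forall x, is_derive_RC ur x (dur x)) /\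
  (forall x, is_derive_RC dur x (q x * ur x)%C) /\
  ul 0 = 0 /\ ur 1 = 0 /\ w <> 0 /\
  forall x, (ul x * dur x - dul x * ur x = w)%C.

Definition green (ul ur : R -> C) (w : C) (y z : R) : C :=
  (ul (Rmin y z) * ur (Rmax y z) / w)%C.

Lemma continuous_green (q ul dul ur dur : R -> C) (w : C) (z y : R) :
  fundamental_pair q ul dul ur dur w -> continuous (fun y => green ul ur w y z) y.
Proof.
intros (_ & U & _ & V & _); unfold green.
apply continuous_Cmult; [apply continuous_Cmult | apply continuous_const].
- apply (continuous_comp (fun y => Rmin y z) ul); [apply continuous_Rmin_l |].
  exact (is_derive_RC_continuous _ _ _ (U _)).
- apply (continuous_comp (fun y => Rmax y z) ur); [apply continuous_Rmax_l |].
  exact (is_derive_RC_continuous _ _ _ (V _)).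
Qed.

Lemma green_boundary (q ul dul ur dur : R -> C) (w : C) (z : R) :
  fundamental_pair q ul dul ur dur w -> 0 < z < 1 ->
  green ul ur w 0 z = 0 /\ green ul ur w 1 z = 0.
Proof.
intros (_ & _ & _ & _ & _ & U0 & U1 & _) Hz; unfold green.
rewrite (Rmin_left 0), (Rmax_left 1), U0, U1 by lra; unfold Cdiv; split; ring.
Qed.

(** On each side of z the kernel is a multiple of one solution, and [green_identity] leaves boundary
    terms only. At z those in phi' cancel by continuity, while those in phi carry the jump of the
    derivative, which is the Wronskian divided by w. *)
Lemma green_weak (q ul dul ur dur : R -> C) (w : C) (z : R) (phi : R -> R) :
  fundamental_pair q ul dul ur dur w -> 0 < z < 1 -> test_function phi ->
  is_RInt (V := C_R_NormedModule)
    (fun y => (green ul ur w y z * (RtoC (Derive_n phi 2 y) - q y * RtoC (phi y)))%C)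
    0 1 (RtoC (phi z)).
Proof.
intros (Hq & U & U' & V & V' & U0 & V1 & Hw & W) Hz Hphi.
destruct (test_function_boundary phi Hphi) as (B0 & B1 & B2 & B3).
assert (Half : forall (c : C) (u du : R -> C) a b, a <= b ->
  (forall x, is_derive_RC u x (du x)) -> (forall x, is_derive_RC du x (q x * u x)%C) ->
  is_RInt (V := C_R_NormedModule)
    (fun y => (c * u y * (RtoC (Derive_n phi 2 y) - q y * RtoC (phi y)))%C) a b
    ((c * u b * RtoC (Derive phi b) - c * du b * RtoC (phi b))
     - (c * u a * RtoC (Derive phi a) - c * du a * RtoC (phi a)))%C).
{ intros c u du a b Hab D1 D2.
  apply is_RInt_ext with
    (fun y => (c * u y * RtoC (Derive_n phi 2 y) - c * (q y * u y) * RtoC (phi y))%C).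
  - intros y _; lazymatch goal with |- @eq _ ?a ?b => change (@eq C a b) end; ring.
  - apply (green_identity (fun y => (c * u y)%C) (fun y => (c * du y)%C)
      (fun y => (c * (q y * u y))%C) phi a b Hab); [| exact Hphi].
    intros x _; split; [apply is_derive_RC_scal, D1 | split; [apply is_derive_RC_scal, D2 |]].
    apply continuous_Cmult; [apply continuous_const |].
    apply continuous_Cmult; [apply Hq | exact (is_derive_RC_continuous _ _ _ (D1 x))]. }
assert (I1 := Half (ur z / w)%C ul dul 0 z (Rlt_le _ _ (proj1 Hz)) U U').
assert (I2 := Half (ul z / w)%C ur dur z 1 (Rlt_le _ _ (proj2 Hz)) V V').
rewrite B0, B1, B2, B3 in *.
replace (RtoC (phi z)) with (plus
  ((ur z / w * ul z * RtoC (Derive phi z) - ur z / w * dul z * RtoC (phi z))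
   - (ur z / w * ul 0%R * RtoC 0 - ur z / w * dul 0%R * RtoC 0))%C
  ((ul z / w * ur 1%R * RtoC 0 - ul z / w * dur 1%R * RtoC 0)
   - (ul z / w * ur z * RtoC (Derive phi z) - ul z / w * dur z * RtoC (phi z)))%C
  : C_R_NormedModule).
- apply (is_RInt_Chasles (V := C_R_NormedModule)) with z.
  + revert I1; apply is_RInt_ext; intros y; rewrite Rmin_left, Rmax_right by lra; intros Hy.
    unfold green; rewrite Rmin_left, Rmax_right by lra; unfold Cdiv.
    lazymatch goal with |- @eq _ ?a ?b => change (@eq C a b) end; ring.
  + revert I2; apply is_RInt_ext; intros y; rewrite Rmin_left, Rmax_right by lra; intros Hy.
    unfold green; rewrite Rmin_right, Rmax_left by lra; unfold Cdiv.
    lazymatch goal with |- @eq _ ?a ?b => change (@eq C a b) end; ring.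
- transitivity ((ul z * dur z - dul z * ur z) / w * RtoC (phi z))%C.
  + unfold Cdiv; lazymatch goal with
      |- @eq _ (plus ?a1 ?a2) ?b => change (@eq C (Cplus a1 a2) b) end.
    ring.
  + rewrite W; lazymatch goal with |- @eq _ ?a ?b => change (@eq C a b) end; field; exact Hw.
Qed.

(** The regular representative of D has constant Wronskians with [ul] and [ur]; both are 0, by the
    values at 0 and at 1 respectively. *)
Lemma weak_solution_unique (q ul dul ur dur D : R -> C) (w : C) :
  fundamental_pair q ul dul ur dur w -> (forall x, continuous D x) ->
  D 0 = 0 -> D 1 = 0 ->
  (forall phi, test_function phi ->
    is_RInt (V := C_R_NormedModule)
      (fun y => (D y * (RtoC (Derive_n phi 2 y) - q y * RtoC (phi y)))%C) 0 1 (RtoC 0)) ->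
  forall x, 0 <= x <= 1 -> D x = 0.
Proof.
intros (Hq & U & U' & V & V' & U0 & V1 & Hw & W) HD D0 D1 Hweak x Hx.
destruct (weak_solution_regular D (fun y => (q y * D y)%C) HD) as (u & du & Hu & Hdu & E).
- intros y; apply continuous_Cmult; [apply Hq | apply HD].
- intros phi Hphi; generalize (Hweak phi Hphi); apply is_RInt_ext; intros y _.
  lazymatch goal with |- @eq _ ?a ?b => change (@eq C a b) end; ring.
- assert (Wr : forall v dv : R -> C, (forall x, is_derive_RC v x (dv x)) ->
    (forall x, is_derive_RC dv x (q x * v x)%C) ->
    forall t, 0 <= t <= 1 -> is_derive_RC (fun t => (u t * dv t - du t * v t)%C) t 0).
  { intros v dv Hv Hdv t Ht; eapply is_derive_RC_eq.
    - exact (is_derive_RC_minus _ _ _ _ _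
        (is_derive_RC_mult _ _ _ _ _ (Hu t) (Hdv t))
        (is_derive_RC_mult _ _ _ _ _ (Hdu t) (Hv t))).
    - cbv beta; rewrite <- (E t Ht); ring. }
  assert (E1 : (u x * dul x - du x * ul x = 0)%C).
  { rewrite <- (is_derive_RC_zero (fun t => (u t * dul t - du t * ul t)%C) 0 x);
      [| lra | intros t Ht; apply (Wr ul dul U U'); lra].
    rewrite (E 0) by lra; rewrite D0, U0; ring. }
  assert (E2 : (u x * dur x - du x * ur x = 0)%C).
  { rewrite (is_derive_RC_zero (fun t => (u t * dur t - du t * ur t)%C) x 1);
      [| lra | intros t Ht; apply (Wr ur dur V V'); lra].
    rewrite (E 1) by lra; rewrite D1, V1; ring. }
  rewrite <- (E x Hx).
  (* Eliminating [du] between the two relations leaves w u = 0. *)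
  transitivity ((ul x * (u x * dur x - du x * ur x)
                 - ur x * (u x * dul x - du x * ul x)) / w)%C.
  + rewrite <- (W x); field; rewrite W; exact Hw.
  + rewrite E1, E2; unfold Cdiv; ring.
Qed.

Lemma filterlim_quotient_RC (f : R -> C) (y : R) (l : C) : is_derive_RC f y l ->
  filterlim (fun x => ((f x - f y) / RtoC (x - y))%C) (locally' y) (locally l).
Proof.
intros [F1 F2] P [eps HP].
apply is_derive_Reals in F1; apply is_derive_Reals in F2.
destruct (F1 eps (cond_pos eps)) as (d1 & H1).
destruct (F2 eps (cond_pos eps)) as (d2 & H2).
exists (mkposreal (Rmin d1 d2) (Rmin_pos _ _ (cond_pos d1) (cond_pos d2))).
intros x Hx Hne; apply HP.
assert (Hx' : Rabs (x - y) < Rmin d1 d2) by exact Hx.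
assert (Hn : x - y <> 0) by lra.
specialize (H1 (x - y) Hn (Rlt_le_trans _ _ _ Hx' (Rmin_l _ _))).
specialize (H2 (x - y) Hn (Rlt_le_trans _ _ _ Hx' (Rmin_r _ _))).
replace (y + (x - y)) with x in H1, H2 by (change R in x; simpl; lra).
assert (Q : ((f x - f y) / RtoC (x - y))%C
            = ((fst (f x) - fst (f y)) / (x - y), (snd (f x) - snd (f y)) / (x - y))).
{ apply injective_projections; simpl; field; exact Hn. }
rewrite Q; split; [exact H1 | exact H2].
Qed.

(** Agreement is asked only inside [0,1], since a Green's function is determined only there; this
    also covers the end points. *)
Lemma is_derive_01_ext (f g : R -> C) (y e : R) (l : C) : 0 < e -> 0 <= y <= 1 ->
  (forall x, 0 <= x <= 1 -> Rabs (x - y) < e -> g x = f x) ->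
  is_derive_RC f y l -> is_derive_01 g y l.
Proof.
intros He Hy Hfg Hf P HP.
assert (L := filterlim_quotient_RC f y l Hf P HP); unfold filtermap in *.
destruct L as (d & Hd).
exists (mkposreal (Rmin d e) (Rmin_pos _ _ (cond_pos d) He)); intros x Hx Hne Hx01.
assert (Hx' : Rabs (x - y) < Rmin d e) by exact Hx.
rewrite (Hfg x Hx01), (Hfg y Hy).
- apply Hd; [| exact Hne]; exact (Rlt_le_trans _ _ _ Hx' (Rmin_l _ _)).
- rewrite Rminus_diag, Rabs_R0; exact He.
- exact (Rlt_le_trans _ _ _ Hx' (Rmin_r _ _)).
Qed.

(** The choice made on the diagonal is arbitrary: [is_partial_y] excludes it and the L2 norm ignores
    it. *)
Definition dgreen (ul dul ur dur : R -> C) (w : C) (y z : R) : C :=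
  if Rle_dec y z then (dul y * ur z / w)%C else (dur y * ul z / w)%C.

Lemma is_partial_y_green (q ul dul ur dur : R -> C) (w : C) (G : R -> R -> C) (y : R) :
  fundamental_pair q ul dul ur dur w ->
  (forall x z, 0 <= x <= 1 -> 0 < z < 1 -> G x z = green ul ur w x z) ->
  0 <= y <= 1 -> is_partial_y G y (dgreen ul dul ur dur w y).
Proof.
intros (Hq & U & U' & V & V' & U0 & V1 & Hw & W) HG Hy z Hz Hzy.
assert (Hd : forall (u du : R -> C) (c : C), is_derive_RC u y (du y) ->
  is_derive_RC (fun x => (u x * c / w)%C) y (du y * c / w)%C).
{ intros u du c H; unfold Cdiv; eapply is_derive_RC_eq.
  - exact (is_derive_RC_mult _ _ _ _ _ (is_derive_RC_mult _ _ _ _ _ H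
      (is_derive_RC_const c y)) (is_derive_RC_const (/ w)%C y)).
  - cbv beta; ring. }
unfold dgreen; destruct (Rle_dec y z) as [H | H].
- apply (is_derive_01_ext (fun x => (ul x * ur z / w)%C) _ y (z - y)); [lra | exact Hy | |].
  + intros x Hx Hxy; rewrite HG by assumption; unfold green.
    apply Rabs_lt_between in Hxy; rewrite Rmin_left, Rmax_right by lra; reflexivity.
  + apply (Hd ul dul (ur z)), U.
- apply (is_derive_01_ext (fun x => (ur x * ul z / w)%C) _ y (y - z)); [lra | exact Hy | |].
  + intros x Hx Hxy; rewrite HG by assumption; unfold green.
    apply Rabs_lt_between in Hxy; rewrite Rmin_right, Rmax_left by lra.
    unfold Cdiv; ring.
  + apply (Hd ur dur (ul z)), V.
Qed.

(** The values of g at 0, y and 1 are free, as the kink at y requires. *)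
Lemma L2norm_piecewise (g f1 f2 : R -> C) (c1 c2 : C) (y B : R) : 0 <= y <= 1 -> 0 <= B ->
  (forall x, continuous f1 x) -> (forall x, continuous f2 x) ->
  (forall z, 0 < z < y -> g z = (c1 * f1 z)%C) ->
  (forall z, y < z < 1 -> g z = (c2 * f2 z)%C) ->
  Cmod c1 ^ 2 * RInt (fun z => Cmod (f1 z) ^ 2) 0 y
  + Cmod c2 ^ 2 * RInt (fun z => Cmod (f2 z) ^ 2) y 1 <= B ^ 2 ->
  in_L2 g /\ L2norm g <= B.
Proof.
intros Hy HB C1 C2 G1 G2 Hle.
assert (I : forall (f : R -> C) (c : C) a b, a <= b -> (forall x, continuous f x) ->
  (forall z, a < z < b -> g z = (c * f z)%C) ->
  is_RInt (fun z => Cmod (g z) ^ 2) a b (Cmod c ^ 2 * RInt (fun z => Cmod (f z) ^ 2) a b)).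
{ intros f c a b Hab Cf Gf.
  apply is_RInt_ext with (fun z => scal (Cmod c ^ 2) (Cmod (f z) ^ 2)).
  - intros z; rewrite Rmin_left, Rmax_right by lra; intros Hz.
    rewrite (Gf z Hz), Cmod_mult; unfold scal; simpl; unfold mult; simpl; ring.
  - apply (is_RInt_scal (V := R_NormedModule) (fun z => Cmod (f z) ^ 2) a b).
    apply (RInt_correct (V := R_CompleteNormedModule)); now apply ex_RInt_Cmod_sqr. }
assert (J := is_RInt_Chasles (V := R_NormedModule) _ _ _ _ _ _
  (I f1 c1 0 y (proj1 Hy) C1 G1) (I f2 c2 y 1 (proj2 Hy) C2 G2)).
split; [eexists; exact J |].
unfold L2norm; rewrite (is_RInt_unique _ _ _ _ J); unfold plus; simpl AbelianMonoid.plus.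
rewrite <- (sqrt_pow2 B HB); apply sqrt_le_1_alt; exact Hle.
Qed.

(** * Rescaling and the final estimate *)

(** The exponent is real or imaginary according to the sign of 1/4 - beta^2. The excluded value
    would give nu = 0, where the two Frobenius solutions coincide. *)
Lemma exists_exponent (beta : R) : 0 < beta -> beta ^ 2 <> 1 / 4 ->
  exists nu : C, (nu * nu = RtoC (1 / 4 - beta ^ 2))%C /\ Rabs (Re nu) <= mu beta /\
    0 <= mu beta <= 1 / 2 /\ nu <> 0 /\ psi_det_bounded_below nu.
Proof.
intros Hb Hb2; set (t := 1 / 4 - beta ^ 2).
assert (Hmu : mu beta = sqrt ((Rabs t + t) / 2)).
{ unfold mu, Csqrt; fold t; rewrite Cmod_R; reflexivity. }
assert (Hb0 : 0 < beta ^ 2) by (apply pow_lt, Hb).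
destruct (Rlt_dec 0 t) as [Ht | Ht].
- rewrite Rabs_pos_eq in Hmu by lra.
  replace ((t + t) / 2) with t in Hmu by lra.
  assert (Hn : 0 < sqrt t) by now apply sqrt_lt_R0.
  assert (Hn2 : sqrt t < 1 / 2).
  { rewrite <- (sqrt_pow2 (1 / 2)) by lra; apply sqrt_lt_1_alt; unfold t in *; split; lra. }
  exists (RtoC (sqrt t)); rewrite Hmu; repeat split.
  + rewrite <- RtoC_mult, sqrt_sqrt by lra; reflexivity.
  + simpl; rewrite Rabs_pos_eq; lra.
  + lra.
  + lra.
  + intros E; apply RtoC_inj in E; lra.
  + apply psi_det_lower_real; lra.
- assert (Ht' : t < 0) by (unfold t in *; lra).
  rewrite Rabs_left in Hmu by lra.
  replace ((- t + t) / 2) with 0 in Hmu by lra; rewrite sqrt_0 in Hmu.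
  assert (Hn : 0 < sqrt (- t)) by (apply sqrt_lt_R0; lra).
  exists ((0, sqrt (- t)) : C); rewrite Hmu; repeat split.
  + apply injective_projections; simpl; [rewrite sqrt_sqrt by lra |]; ring.
  + simpl; rewrite Rabs_R0; lra.
  + lra.
  + lra.
  + intros E; apply (f_equal snd) in E; simpl in E; lra.
  + now apply psi_det_lower_imag.
Qed.

(** With d = - M y0 the end points y = 0 and y = 1 become d and M + d. *)
Definition sol_resc (nu : C) (h M d p y : R) : C := sol nu h p (M * y + d).
Definition dsol_resc (nu : C) (h M d p y : R) : C := (RtoC M * dsol nu h p (M * y + d))%C.
Definition pot_resc (nu : C) (h M d y : R) : C :=
  (RtoC (M ^ 2) * bessel_pot nu h (M * y + d))%C.
Definition wr_resc (nu : C) (h M d : R) : C :=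
  (RtoC M * (2 * nu * psi_det nu h d (M + d)))%C.

Lemma continuous_pot_resc (nu : C) (h M d y : R) : 0 < h ->
  continuous (pot_resc nu h M d) y.
Proof.
intros Hh.
assert (Hi : continuous (fun x : R => (/ ((M * x + d)%R, h))%C) y).
{ assert (D := is_derive_RC_affine (fun x => / ((x, h) : C))%C M d y _
    (is_derive_RC_up_inv h (M * y + d) Hh)).
  exact (is_derive_RC_continuous _ _ _ D). }
apply continuous_ext with (fun x : R => (RtoC (M ^ 2) * (1 + - (RtoC (1 / 4) - nu * nu) *
   (/ ((M * x + d)%R, h) * / ((M * x + d)%R, h))))%C).
- intros x; assert (Hn := up_neq_0 h (M * x + d) Hh).
  unfold pot_resc, bessel_pot; lazymatch goal with |- @eq _ ?a ?b => change (@eq C a b) end.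
  field; exact Hn.
- apply continuous_Cmult; [apply continuous_const |].
  apply continuous_Cplus; [apply continuous_const |].
  apply continuous_Cmult; [apply continuous_const |].
  now apply continuous_Cmult.
Qed.

Lemma fundamental_pair_sol (nu : C) (h M d : R) : 0 < h -> 0 < M ->
  Rabs (Re nu) <= 1 / 2 -> wr_resc nu h M d <> 0 ->
  fundamental_pair (pot_resc nu h M d) (sol_resc nu h M d d) (dsol_resc nu h M d d)
    (sol_resc nu h M d (M + d)) (dsol_resc nu h M d (M + d)) (wr_resc nu h M d).
Proof.
intros Hh HM Hnu Hw.
assert (S1 : forall p x, is_derive_RC (sol_resc nu h M d p) x (dsol_resc nu h M d p x)).
{ intros p x; apply is_derive_RC_affine; now apply is_derive_RC_sol. }
assert (S2 : forall p x, is_derive_RC (dsol_resc nu h M d p) x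
  (pot_resc nu h M d x * sol_resc nu h M d p x)%C).
{ intros p x; eapply is_derive_RC_eq.
  - apply is_derive_RC_scal, is_derive_RC_affine; now apply is_derive_RC_dsol.
  - unfold pot_resc, sol_resc; rewrite RtoC_pow; ring. }
split; [| split; [| split; [| split; [| split; [| split; [| split; [| split]]]]]]]; auto.
- intros x; now apply continuous_pot_resc.
- unfold sol_resc; replace (M * 0 + d) with d by ring; apply sol_self.
- unfold sol_resc; replace (M * 1 + d) with (M + d) by ring; apply sol_self.
- intros x; unfold sol_resc, dsol_resc, wr_resc.
  rewrite <- (sol_wronskian nu h d (M + d) (M * x + d) Hh Hnu); ring.
Qed.

Lemma up_scale (M y y0 eps : R) :
  ((M * y + - (M * y0), M * eps) : C) = (RtoC M * (y - y0, eps)%R)%C.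
Proof. apply injective_projections; simpl; ring. Qed.

(** The inverse square has the homogeneity of the second derivative, so the factor m^2 turns z = m
    (y - y0 + i eps) back into the original variable. *)
Lemma TG_Plus_eq (nu : C) (beta : R) (m : nat) (eps y0 : R) (phi : R -> R) (y : R) :
  0 < eps -> (1 <= m)%nat -> (nu * nu = RtoC (1 / 4 - beta ^ 2))%C ->
  TG Plus beta m eps y0 phi y =
  (RtoC (Derive_n phi 2 y)
   - pot_resc nu (INR m * eps) (INR m) (- (INR m * y0)) y * RtoC (phi y))%C.
Proof.
intros He Hm Hnu; unfold TG, potential, pot_resc, bessel_pot.
rewrite Hnu, <- RtoC_minus, up_scale.
replace (1 / 4 - (1 / 4 - beta ^ 2)) with (beta ^ 2) by ring.
replace (sgn Plus * eps) with eps by (simpl; ring).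
assert (Hn := up_neq_0 eps (y - y0) He).
assert (HM : RtoC (INR m) <> 0).
{ intros E; apply RtoC_inj in E; apply (not_0_INR m); [lia | exact E]. }
rewrite !RtoC_pow; field; split; assumption.
Qed.

Lemma Cmod_wr_resc (nu : C) (h M d : R) : 0 < M ->
  Cmod (wr_resc nu h M d) = M * (2 * Cmod nu * Cmod (psi_det nu h d (M + d))).
Proof.
intros HM; unfold wr_resc; rewrite !Cmod_mult, !Cmod_R, !Rabs_pos_eq by lra; reflexivity.
Qed.

Lemma RInt_sol_resc (nu : C) (h M d p a b : R) : 0 < M -> 0 < h -> Rabs (Re nu) <= 1 / 2 ->
  RInt (fun y => Cmod (sol_resc nu h M d p y) ^ 2) a b
  = / M * RInt (fun x => Cmod (sol nu h p x) ^ 2) (M * a + d) (M * b + d).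
Proof.
intros HM Hh Hnu; unfold sol_resc.
assert (Ex : forall s t, ex_RInt (fun x => Cmod (sol nu h p x) ^ 2) s t).
{ intros s t; apply ex_RInt_Cmod_sqr; intros x.
  exact (is_derive_RC_continuous _ _ _ (is_derive_RC_sol nu h p x Hh Hnu)). }
rewrite <- (RInt_comp_lin (V := R_CompleteNormedModule) (fun x => Cmod (sol nu h p x) ^ 2) M d a b)
  by apply Ex.
rewrite (RInt_scal (V := R_CompleteNormedModule)
  (fun y => Cmod (sol nu h p (M * y + d)) ^ 2)).
- set (I := RInt _ a b : R); change (@eq R I (/ M * (M * I))); field; lra.
- apply (ex_RInt_Cmod_sqr (fun y => sol nu h p (M * y + d))); intros x.
  eapply is_derive_RC_continuous, is_derive_RC_affine; now apply is_derive_RC_sol.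
Qed.

(* [Z] stands for the size at [y] of the solutions, or of their derivatives, relative to
   [psi_size]; [g] is [G y] or [d_y G y] accordingly. *)
Lemma green_slice_L2 (nu : C) (h M d y K1 c1 N Z : R) (g : R -> C) (ca cb : C) :
  0 < h -> 0 < M -> Rabs (Re nu) <= 1 / 2 -> nu <> 0 -> 0 <= y <= 1 ->
  0 < K1 -> 0 < c1 -> 0 < N -> 0 < Z ->
  c1 * (psi_size nu h d * psi_size nu h (M + d)) <= Cmod (psi_det nu h d (M + d)) ->
  RInt (fun t => Cmod (sol nu h d t) ^ 2) d (M * y + d) <= K1 * psi_size nu h d ^ 2 ->
  RInt (fun t => Cmod (sol nu h (M + d) t) ^ 2) (M * y + d) (M + d)
    <= K1 * psi_size nu h (M + d) ^ 2 ->
  Cmod cb <= N * psi_size nu h (M + d) * Z -> Cmod ca <= N * psi_size nu h d * Z ->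
  (forall z, 0 < z < y -> g z = (cb * sol_resc nu h M d d z / wr_resc nu h M d)%C) ->
  (forall z, y < z < 1 -> g z = (ca * sol_resc nu h M d (M + d) z / wr_resc nu h M d)%C) ->
  in_L2 g /\
  L2norm g <= N * sqrt K1 / (Cmod nu * c1) * (Z / (M * sqrt M)).
Proof.
intros Hh HM Hnu Hn Hy HK1 Hc1 HN HZ Hdet Ia Ib Cb Ca Gb Ga.
assert (Hna : 0 < Cmod nu) by now apply Cmod_gt_0.
set (Sa := psi_size nu h d) in *; set (Sb := psi_size nu h (M + d)) in *.
assert (HSa : 0 < Sa) by now apply psi_size_pos.
assert (HSb : 0 < Sb) by now apply psi_size_pos.
set (w := wr_resc nu h M d) in *.
set (W0 := M * (2 * Cmod nu * (c1 * (Sa * Sb)))).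
assert (HW0 : 0 < W0) by (repeat apply Rmult_lt_0_compat; lra).
assert (HwW : W0 <= Cmod w).
{ unfold w; rewrite Cmod_wr_resc by exact HM.
  apply Rmult_le_compat_l; [lra |]; apply Rmult_le_compat_l; [lra | exact Hdet]. }
assert (Hw : w <> 0) by (apply Cmod_gt_0; lra).
assert (HsM : 0 < sqrt M) by now apply sqrt_lt_R0.
assert (HsK : 0 < sqrt K1) by now apply sqrt_lt_R0.
assert (EM : sqrt M * sqrt M = M) by (apply sqrt_sqrt; lra).
assert (EK : sqrt K1 * sqrt K1 = K1) by (apply sqrt_sqrt; lra).
assert (Hcont : forall p x, continuous (sol_resc nu h M d p) x).
{ intros p x; eapply is_derive_RC_continuous, is_derive_RC_affine;
  now apply is_derive_RC_sol. }
assert (HB : 0 <= N * sqrt K1 / (Cmod nu * c1) * (Z / (M * sqrt M))).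
{ apply Rmult_le_pos; apply Rlt_le, Rdiv_lt_0_compat; repeat apply Rmult_lt_0_compat; lra. }
apply (L2norm_piecewise g (sol_resc nu h M d d) (sol_resc nu h M d (M + d))
  (cb / w)%C (ca / w)%C y); try assumption; try apply Hcont.
- intros z Hz; rewrite Gb by exact Hz; unfold Cdiv; ring.
- intros z Hz; rewrite Ga by exact Hz; unfold Cdiv; ring.
- rewrite !RInt_sol_resc by assumption.
  replace (M * 0 + d) with d by ring; replace (M * 1 + d) with (M + d) by ring.
  (* The sizes cancel here: S comes from the solution evaluated at y, S' from the L2 norm of the
     other one, and S' S from the Wronskian. The quarter is the square of the factor 2 of the
     Wronskian, so the two pieces add up to half of the square of the bound. *)
  assert (Q : forall (c : C) S S' I, 0 < S -> 0 < S' -> Cmod c <= N * S * Z ->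
    I <= K1 * S' ^ 2 -> W0 = M * (2 * Cmod nu * (c1 * (S' * S))) ->
    Cmod (c / w)%C ^ 2 * (/ M * I)
    <= (N * sqrt K1 / (Cmod nu * c1) * (Z / (M * sqrt M))) ^ 2 * / 4).
  { intros c S S' I HS HS' Hc HI EW.
    assert (H1 : Cmod (c / w)%C <= N * Z / (2 * M * Cmod nu * c1 * S')).
    { rewrite Cmod_div by exact Hw.
      apply Rle_trans with (N * S * Z / W0).
      - apply Rmult_le_compat; [apply Cmod_ge_0 | | exact Hc |].
        + apply Rlt_le, Rinv_0_lt_compat; lra.
        + apply Rinv_le_contravar; assumption.
      - rewrite EW; apply Req_le; field; repeat split; lra. }
    assert (H2 : Cmod (c / w)%C ^ 2 <= (N * Z / (2 * M * Cmod nu * c1 * S')) ^ 2)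
      by (apply pow_incr; split; [apply Cmod_ge_0 | exact H1]).
    apply Rle_trans with ((N * Z / (2 * M * Cmod nu * c1 * S')) ^ 2 * (/ M * (K1 * S' ^ 2))).
    - apply Rle_trans with (Cmod (c / w)%C ^ 2 * (/ M * (K1 * S' ^ 2))).
      + apply Rmult_le_compat_l; [apply pow2_ge_0 |].
        apply Rmult_le_compat_l; [apply Rlt_le, Rinv_0_lt_compat, HM | exact HI].
      + apply Rmult_le_compat_r; [| exact H2].
        apply Rmult_le_pos; [apply Rlt_le, Rinv_0_lt_compat, HM |].
        apply Rmult_le_pos; [lra | apply pow2_ge_0].
    - apply Req_le.
      transitivity ((N * Z) ^ 2 * (sqrt K1 * sqrt K1)
                    / ((Cmod nu * c1 * M) ^ 2 * (sqrt M * sqrt M)) / 4).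
      + rewrite EK, EM; field; repeat split; lra.
      + field; repeat split; lra. }
  assert (Q1 := Q cb Sb Sa _ HSb HSa Cb Ia eq_refl).
  assert (Q2 := Q ca Sa Sb _ HSa HSb Ca Ib
    ltac:(unfold W0; rewrite (Rmult_comm Sa); reflexivity)).
  set (B := (N * sqrt K1 / (Cmod nu * c1) * (Z / (M * sqrt M))) ^ 2) in *.
  assert (0 <= B) by apply pow2_ge_0. lra.
Qed.

(** The count of powers of M, with e the exponent of |z| = M w in the pointwise bound and k the
    number of derivatives in y. The cases e = 1/2 - mu, k = 0 and e = -1/2 - mu, k = 1 both give 1 +
    mu. *)
Lemma rescaling_identity (M w e k : R) : 0 < M -> 0 < w ->
  Rpower w (- e) * (Rpower M k * Rpower (M * w) e / (M * sqrt M))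
  = / Rpower M (3 / 2 - e - k).
Proof.
intros HM Hw.
assert (E0 : Rpower w (- e) * Rpower w e = 1).
{ rewrite <- Rpower_plus, Rplus_opp_l; now apply Rpower_O. }
assert (E1 : M * sqrt M = Rpower M (3 / 2 - e - k) * (Rpower M k * Rpower M e)).
{ rewrite <- !Rpower_plus; replace (3 / 2 - e - k + (k + e)) with (1 + / 2) by lra.
  rewrite Rpower_plus, Rpower_1, Rpower_sqrt by exact HM; reflexivity. }
rewrite E1, <- Rpower_mult_distr by assumption.
pose proof (Rpower_pos M (3 / 2 - e - k)). pose proof (Rpower_pos M k).
pose proof (Rpower_pos M e).
transitivity ((Rpower w (- e) * Rpower w e) / Rpower M (3 / 2 - e - k)).
- field; repeat split; lra.
- rewrite E0; unfold Rdiv; ring.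
Qed.

Lemma is_Green_green (nu : C) (beta : R) (m : nat) (eps y0 : R)
    (ul dul ur dur : R -> C) (w : C) :
  0 < eps -> (1 <= m)%nat -> (nu * nu = RtoC (1 / 4 - beta ^ 2))%C ->
  fundamental_pair (pot_resc nu (INR m * eps) (INR m) (- (INR m * y0))) ul dul ur dur w ->
  is_Green Plus beta m eps y0 (green ul ur w).
Proof.
intros He Hm Hnu FP z Hz.
destruct (green_boundary _ _ _ _ _ _ z FP Hz) as [B0 B1].
split; [| split; [| split; assumption]].
- intros x _; apply (filterlim_filter_le_1 _ (filter_le_within _)).
  exact (continuous_green _ _ _ _ _ _ z x FP).
- intros phi Hphi; generalize (green_weak _ _ _ _ _ _ z phi FP Hz Hphi).
  apply is_RInt_ext; intros y _; now rewrite (TG_Plus_eq nu).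
Qed.

(** For fixed z the difference with the explicit kernel is a continuous weak solution of the
    homogeneous problem, the two terms phi(z) cancelling. *)
Lemma is_Green_unique (nu : C) (beta : R) (m : nat) (eps y0 : R)
    (ul dul ur dur : R -> C) (w : C) (G : R -> R -> C) :
  0 < eps -> (1 <= m)%nat -> (nu * nu = RtoC (1 / 4 - beta ^ 2))%C ->
  fundamental_pair (pot_resc nu (INR m * eps) (INR m) (- (INR m * y0))) ul dul ur dur w ->
  is_Green Plus beta m eps y0 G ->
  forall x z, 0 <= x <= 1 -> 0 < z < 1 -> G x z = green ul ur w x z.
Proof.
intros He Hm Hnu FP HG x z Hx Hz.
destruct (HG z Hz) as (Gc & Gw & G0 & G1).
destruct (is_Green_green nu beta m eps y0 _ _ _ _ _ He Hm Hnu FP z Hz) as (Gc' & Gw' & G0' & G1').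
set (D := fun y => (G (clamp y) z - green ul ur w (clamp y) z)%C).
assert (E : D x = 0).
{ apply (weak_solution_unique _ _ _ _ _ D w FP); [| | | | exact Hx].
  - intros y; apply (continuous_minus (V := C_R_NormedModule)).
    + exact (continuous_on_clamp (fun y => G y z) y Gc).
    + exact (continuous_on_clamp (fun y => green ul ur w y z) y Gc').
  - unfold D; rewrite clamp_id, G0, G0' by lra; ring.
  - unfold D; rewrite clamp_id, G1, G1' by lra; ring.
  - intros phi Hphi.
    assert (I := is_RInt_minus (V := C_R_NormedModule) _ _ _ _ _ _ (Gw phi Hphi) (Gw' phi Hphi)).
    replace (RtoC 0) with (minus (RtoC (phi z) : C_R_NormedModule) (RtoC (phi z)))
      by apply (minus_eq_zero (G := C_R_NormedModule)).
    revert I; apply is_RInt_ext; intros y; rewrite Rmin_left, Rmax_right by lra; intros Hy.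
    unfold D; rewrite clamp_id, <- (TG_Plus_eq nu beta) by (assumption || lra).
    lazymatch goal with |- @eq _ (minus ?a ?b) ?c => change (@eq C (Cminus a b) c) end; ring. }
unfold D in E; rewrite clamp_id in E by exact Hx.
replace (G x z) with (G x z - green ul ur w x z + green ul ur w x z)%C by ring.
rewrite E; ring.
Qed.

Lemma green_estimate_Plus (beta : R) (hbeta : 0 < beta) (hbeta2 : beta ^ 2 <> 1 / 4) :
  exists K : R, 0 < K /\
  forall m : nat, (1 <= m)%nat ->
  exists eps0 : R, 0 < eps0 /\
  forall (eps y0 : R), 0 < eps < eps0 -> 0 <= y0 <= 1 ->
    (exists G : R -> R -> C, is_Green Plus beta m eps y0 G) /\
    (forall G : R -> R -> C, is_Green Plus beta m eps y0 G ->
     forall y : R, 0 <= y <= 1 -> INR m * Rabs (y - y0) <= 3 * beta ->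
     exists dG : R -> C,
       is_partial_y G y dG /\ in_L2 (G y) /\ in_L2 dG /\
       Rpower (Cmod (y - y0, eps)) (- (1 / 2) + mu beta) * L2norm (G y)
       + Rpower (Cmod (y - y0, eps)) (1 / 2 + mu beta) * L2norm dG
       <= K / Rpower (INR m) (1 + mu beta)).
Proof.
destruct (exists_exponent beta hbeta hbeta2) as (nu & Hnu & Hre & Hmu & Hn & c1 & Hc1 & Hdet).
assert (Hre' : Rabs (Re nu) <= 1 / 2) by lra.
(* The radius covers |x| <= 3 beta with h <= 1/2. *)
destruct (sol_bound nu (mu beta) (3 * beta + 1) Hre (proj2 Hmu)) as (N & HN & HB); [lra |].
destruct (sol_L2_bound nu beta (mu beta) hbeta Hnu Hre Hmu) as (K1 & HK1 & HI).
assert (Hna : 0 < Cmod nu) by now apply Cmod_gt_0.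
set (Q := N * sqrt K1 / (Cmod nu * c1)).
assert (HQ : 0 < Q).
{ apply Rdiv_lt_0_compat; apply Rmult_lt_0_compat; try lra; now apply sqrt_lt_R0. }
(* One [Q] for G and one for its derivative; its ingredients [N], [K1], [nu] and [c1] are all fixed
   before m. *)
exists (2 * Q); split; [lra |]; intros m Hm.
assert (HM : 1 <= INR m) by (apply (le_INR 1); exact Hm).
set (M := INR m) in *.
destruct (Hdet M HM) as (h0 & Hh0 & Hlow).
(* The rescaled height m eps has to stay below [h0], which depends on m. *)
exists (h0 / M); split; [apply Rdiv_lt_0_compat; lra |]; intros eps y0 He Hy0.
set (h := M * eps); set (d := - (M * y0)).
assert (Hh : 0 < h < h0).
{ split; [apply Rmult_lt_0_compat; lra |].
  destruct He as [_ He]; apply Rlt_div_r in He; [unfold h; lra | lra]. }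
assert (Ha : 0 <= M * y0) by (apply Rmult_le_pos; lra).
assert (Hb : 0 <= M + d).
{ unfold d; assert (M * y0 <= M * 1) by (apply Rmult_le_compat_l; lra); lra. }
specialize (Hlow h (M * y0) (M + d) Hh Ha Hb ltac:(unfold d; ring)); fold d in Hlow.
assert (Hw : wr_resc nu h M d <> 0).
{ apply Cmod_gt_0; rewrite Cmod_wr_resc by lra.
  apply Rmult_lt_0_compat; [lra |]; apply Rmult_lt_0_compat; [lra |].
  eapply Rlt_le_trans; [| exact Hlow].
  repeat apply Rmult_lt_0_compat; [lra | |]; apply psi_size_pos; tauto. }
assert (FP := fundamental_pair_sol nu h M d (proj1 Hh) ltac:(lra) Hre' Hw).
split; [eexists; exact (is_Green_green nu beta m eps y0 _ _ _ _ _ (proj1 He) Hm Hnu FP) |].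
intros G HG y Hy Hyy.
assert (GE := is_Green_unique nu beta m eps y0 _ _ _ _ _ G (proj1 He) Hm Hnu FP HG).
set (w := wr_resc nu h M d) in *.
set (ul := sol_resc nu h M d d) in *; set (dul := dsol_resc nu h M d d) in *.
set (ur := sol_resc nu h M d (M + d)) in *; set (dur := dsol_resc nu h M d (M + d)) in *.
exists (dgreen ul dul ur dur w y).
split; [exact (is_partial_y_green _ _ _ _ _ w G y FP GE Hy) |].
set (x := M * y + d).
assert (Hx : Rabs x <= 3 * beta).
{ unfold x, d; replace (M * y + - (M * y0)) with (M * (y - y0)) by ring.
  rewrite Rabs_mult, (Rabs_pos_eq M) by lra; exact Hyy. }
assert (Ez : Cmod (x, h) = M * Cmod (y - y0, eps)).
{ unfold x, d, h; rewrite up_scale, Cmod_mult, Cmod_R, Rabs_pos_eq by lra; reflexivity. }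
assert (Hz : Cmod (x, h) <= 3 * beta + 1).
{ replace ((x, h) : C) with (RtoC x + RtoC h * Ci)%C
    by (apply injective_projections; simpl; ring).
  eapply Rle_trans; [apply Cmod_triangle |].
  rewrite Cmod_mult, !Cmod_R, Cmod_Ci, (Rabs_pos_eq h) by lra; lra. }
assert (Hwp := Cmod_up_pos eps (y - y0) (proj1 He)).
assert (Hh2 : 0 < h <= 1 / 2) by lra.
assert (Hdx : d <= x).
{ unfold x; assert (0 <= M * y) by (apply Rmult_le_pos; lra); lra. }
assert (Hxb : x <= M + d).
{ unfold x; assert (M * y <= M * 1) by (apply Rmult_le_compat_l; lra); lra. }
assert (Ia := proj2 (HI h d x Hh2 Hx) Hdx).
assert (Ib := proj1 (HI h (M + d) x Hh2 Hx) Hxb).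
destruct (HB h d x (proj1 Hh) Hz) as [Ba Bda].
destruct (HB h (M + d) x (proj1 Hh) Hz) as [Bb Bdb].
assert (EZ : forall e, Rpower (Cmod (x, h)) e = Rpower M 0 * Rpower (M * Cmod (y - y0, eps)) e)
  by (intros e; rewrite Ez, Rpower_O by lra; ring).
assert (EdZ : forall e, M * Rpower (Cmod (x, h)) e
                        = Rpower M 1 * Rpower (M * Cmod (y - y0, eps)) e)
  by (intros e; rewrite Ez, Rpower_1 by lra; ring).
destruct (green_slice_L2 nu h M d y K1 c1 N (Rpower (Cmod (x, h)) (1 / 2 - mu beta)) (G y)
  (ul y) (ur y)) as [L1 L1']; try assumption; try lra; try (apply Rpower_pos).
{ intros z Hzy; rewrite GE by lra; unfold green; rewrite Rmin_right, Rmax_left by lra.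
  fold w ul; unfold Cdiv; ring. }
{ intros z Hzy; rewrite GE by lra; unfold green; rewrite Rmin_left, Rmax_right by lra.
  reflexivity. }
(* A derivative in y is M times a derivative in x. *)
assert (Hscal : forall p, Cmod (dsol nu h p x)
    <= N * psi_size nu h p * Rpower (Cmod (x, h)) (- (1 / 2) - mu beta) ->
  Cmod (dsol_resc nu h M d p y)
    <= N * psi_size nu h p * (M * Rpower (Cmod (x, h)) (- (1 / 2) - mu beta))).
{ intros p Hp; unfold dsol_resc; rewrite Cmod_mult, Cmod_R, Rabs_pos_eq by lra.
  fold x; apply (Rmult_le_compat_l M) in Hp; [| lra].
  eapply Rle_trans; [exact Hp |]; apply Req_le; ring. }
destruct (green_slice_L2 nu h M d y K1 c1 N (M * Rpower (Cmod (x, h)) (- (1 / 2) - mu beta))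
  (dgreen ul dul ur dur w y) (dul y) (dur y)) as [L2 L2']; try assumption; try lra.
{ apply Rmult_lt_0_compat; [lra | apply Rpower_pos]. }
{ now apply Hscal. }
{ now apply Hscal. }
{ intros z Hzy; unfold dgreen; destruct (Rle_dec y z); [lra | reflexivity]. }
{ intros z Hzy; unfold dgreen; destruct (Rle_dec y z); [reflexivity | lra]. }
split; [exact L1 | split; [exact L2 |]].
fold Q in L1', L2'; rewrite EZ in L1'; rewrite EdZ in L2'.
set (v := Cmod (y - y0, eps)) in *.
assert (R1 := rescaling_identity M v (1 / 2 - mu beta) 0 ltac:(lra) Hwp).
assert (R2 := rescaling_identity M v (- (1 / 2) - mu beta) 1 ltac:(lra) Hwp).
replace (- (1 / 2 - mu beta)) with (- (1 / 2) + mu beta) in R1 by ring.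
replace (- (- (1 / 2) - mu beta)) with (1 / 2 + mu beta) in R2 by ring.
replace (3 / 2 - (1 / 2 - mu beta) - 0) with (1 + mu beta) in R1 by field.
replace (3 / 2 - (- (1 / 2) - mu beta) - 1) with (1 + mu beta) in R2 by field.
apply (Rmult_le_compat_l (Rpower v (- (1 / 2) + mu beta))) in L1';
  [| apply Rlt_le, Rpower_pos].
apply (Rmult_le_compat_l (Rpower v (1 / 2 + mu beta))) in L2';
  [| apply Rlt_le, Rpower_pos].
replace (2 * Q / Rpower M (1 + mu beta))
  with (Q * / Rpower M (1 + mu beta) + Q * / Rpower M (1 + mu beta))
  by (unfold Rdiv; ring).
rewrite <- R1 at 1; rewrite <- R2.
apply Rplus_le_compat; (eapply Rle_trans; [eassumption |]); apply Req_le; ring.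
Qed.

(** * The lower sign, by complex conjugation *)

Definition pm_opp (s : pm) : pm := match s with Plus => Minus | Minus => Plus end.

(** For real [phi] only the potential is complex, and conjugation flips the sign of i eps in it. *)
Lemma TG_conj (s : pm) (beta : R) (m : nat) (eps y0 : R) (phi : R -> R) (y : R) : 0 < eps ->
  Cconj (TG s beta m eps y0 phi y) = TG (pm_opp s) beta m eps y0 phi y.
Proof.
intros He; unfold TG, potential.
assert (Hn : ((y - y0, sgn s * eps)%R * (y - y0, sgn s * eps)%R)%C <> 0).
{ assert (H : ((y - y0, sgn s * eps) : C) <> 0).
  { intros E; apply (f_equal snd) in E; destruct s; simpl in E; lra. }
  intros E; apply Cmod_gt_0 in H; apply (f_equal Cmod) in E.
  rewrite Cmod_mult, Cmod_0 in E.
  assert (P := Rmult_lt_0_compat _ _ H H); lra. }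
rewrite Cplus_conj, Cminus_conj, !Cmult_conj, Cdiv_conj, !Cmult_conj, !Cconj_RtoC by exact Hn.
replace (Cconj (y - y0, sgn s * eps)) with ((y - y0, sgn (pm_opp s) * eps) : C);
  [reflexivity |].
apply injective_projections; destruct s; simpl; ring.
Qed.

Lemma filterlim_conj (l : C) : filterlim Cconj (locally l) (locally (Cconj l)).
Proof.
intros P [e HP]; exists e; intros z [H1 H2]; apply HP; split; [exact H1 |].
unfold ball in H2 |- *; simpl in H2 |- *.
unfold AbsRing_ball, abs, minus, plus, opp in H2 |- *; simpl in H2 |- *.
rewrite <- Ropp_plus_distr, Rabs_Ropp; exact H2.
Qed.

Lemma is_Green_conj (s : pm) (beta : R) (m : nat) (eps y0 : R) (G : R -> R -> C) : 0 < eps ->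
  is_Green s beta m eps y0 G ->
  is_Green (pm_opp s) beta m eps y0 (fun y z => Cconj (G y z)).
Proof.
intros He HG z Hz; destruct (HG z Hz) as (Gc & Gw & G0 & G1).
split; [| split; [| rewrite G0, G1, !Cconj_RtoC; split; reflexivity]].
- intros x Hx; exact (filterlim_comp _ _ _ _ _ _ _ _ (Gc x Hx) (filterlim_conj _)).
- intros phi Hphi; destruct (is_RInt_C_inv _ _ _ _ (Gw phi Hphi)) as [I1 I2].
  apply is_RInt_C.
  + revert I1; apply is_RInt_ext; intros y _.
    rewrite <- TG_conj, <- Cmult_conj by exact He; reflexivity.
  + apply (is_RInt_opp (V := R_NormedModule)) in I2.
    rewrite <- (Ropp_involutive (snd (RtoC (phi z)))); simpl (- snd _); rewrite Ropp_0.
    revert I2; apply is_RInt_ext; intros y _.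
    rewrite <- TG_conj, <- Cmult_conj by exact He; reflexivity.
Qed.

Lemma is_partial_y_conj (G : R -> R -> C) (y : R) (g : R -> C) :
  is_partial_y G y g ->
  is_partial_y (fun y z => Cconj (G y z)) y (fun z => Cconj (g z)).
Proof.
intros H z Hz Hzy P HP.
assert (L := filterlim_comp _ _ _ _ _ _ _ _ (H z Hz Hzy) (filterlim_conj _) P HP).
destruct L as (d & Hd); exists d; intros x Hx Hne Hx01.
specialize (Hd x Hx Hne Hx01).
replace ((Cconj (G x z) - Cconj (G y z)) / RtoC (x - y))%C
  with (Cconj ((G x z - G y z) / RtoC (x - y))%C); [exact Hd |].
rewrite Cdiv_conj, Cminus_conj, Cconj_RtoC; [reflexivity |].
intros E; apply RtoC_inj in E; apply Hne; lra.
Qed.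

Lemma L2norm_conj (f : R -> C) :
  (in_L2 (fun z => Cconj (f z)) <-> in_L2 f) /\ L2norm (fun z => Cconj (f z)) = L2norm f.
Proof.
split.
- split; apply ex_RInt_ext; intros z _; now rewrite Cmod_conj.
- unfold L2norm; f_equal; apply RInt_ext; intros z _; now rewrite Cmod_conj.
Qed.

Theorem theorem2 (beta : R) (hbeta : 0 < beta) (hbeta2 : beta ^ 2 <> 1 / 4) :
  exists K : R, 0 < K /\
  forall m : nat, (1 <= m)%nat ->
  exists eps0 : R, 0 < eps0 /\
  forall (s : pm) (eps y0 : R), 0 < eps < eps0 -> 0 <= y0 <= 1 ->
    (exists G : R -> R -> C, is_Green s beta m eps y0 G) /\
    (forall G : R -> R -> C, is_Green s beta m eps y0 G ->
     forall y : R, 0 <= y <= 1 -> INR m * Rabs (y - y0) <= 3 * beta ->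
     exists dG : R -> C,
       is_partial_y G y dG /\ in_L2 (G y) /\ in_L2 dG /\
       Rpower (Cmod (y - y0, eps)) (- (1 / 2) + mu beta) * L2norm (G y)
       + Rpower (Cmod (y - y0, eps)) (1 / 2 + mu beta) * L2norm dG
       <= K / Rpower (INR m) (1 + mu beta)).
Proof.
destruct (green_estimate_Plus beta hbeta hbeta2) as (K & HK & H).
exists K; split; [exact HK |]; intros m Hm.
destruct (H m Hm) as (eps0 & He0 & H').
exists eps0; split; [exact He0 |]; intros s eps y0 He Hy0.
destruct (H' eps y0 He Hy0) as ((G0 & HG0) & Hest); destruct s.
- split; [now exists G0 | exact Hest].
- split.
  + exists (fun y z => Cconj (G0 y z)); exact (is_Green_conj Plus _ _ _ _ _ (proj1 He) HG0).
  + intros G HG y Hy Hyy.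
    (* The conjugate of G is a Green's function for [Plus]; the weights and the L2 norms involve
       moduli only, so the estimate carries over unchanged. *)
    destruct (Hest _ (is_Green_conj Minus _ _ _ _ _ (proj1 He) HG) y Hy Hyy)
      as (dG & P1 & P2 & P3 & P4).
    exists (fun z => Cconj (dG z)).
    split; [| split; [exact (proj1 (proj1 (L2norm_conj (G y))) P2) |
      split; [exact (proj2 (proj1 (L2norm_conj dG)) P3) |]]].
    * intros z Hz Hzy.
      assert (P := is_partial_y_conj _ _ _ P1 z Hz Hzy).
      revert P; unfold is_derive_01; apply filterlim_ext; intros x.
      now rewrite !Cconj_conj.
    * rewrite (proj2 (L2norm_conj dG)), <- (proj2 (L2norm_conj (G y))); exact P4.
Qed.
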